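(* Let $d\ge1$, let $r\ge 1$ be an integer, let $(X_i)_{i\ge1}$ be an i.i.d. sequence of random variables in $\mathbb{R}^d$, and let $(e_i)_{i\ge1}$ be an i.i.d. sequence of real random variables, independent of $(X_i)_{i\ge1}$, with $\mathbb{E}[e_1]=0$ and $\mathbb{E}[e_1^2]<\infty$. Let $Y_i=g(X_i)+\sigma(X_i)e_i$ with $g,\sigma:\mathbb{R}^d\to\mathbb{R}$. Let $Q\subset\mathbb{R}^d$ be compact and let $(h_n)_{n\ge 1}$ be a sequence of positive bandwidths, written $h=h_n$. Assume: (i) $X_1$ has a bounded density $f$ on $\mathbb{R}^d$ whose $r$-th order derivatives exist and are bounded; (ii) there is $b>0$ such that $f(x)\ge b$ for every $x\in Q$; (iii) the kernel $K:\mathbb{R}^d\to\mathbb{R}$ is symmetric with order $r$, and there are constants $C_1,C_2>0$ such that $|K(x)|\le C_1\exp(-C_2\|x\|)$ for every $x\in\mathbb{R}^d$; (iv) the function $\psi:\mathbb{R}^d\to\mathbb{R}$ vanishes outside $Q$ and is H\''older on its support $Q$, which is nonempty, bounded and convex; (v) $g$ is H\''older on $Q$ and $\sigma$ is bounded; (vi) $n^{1/2}h^r\to0$ and $n^{1/2}h^d\to+\infty$ as $n\to\infty$. Set $$c=\int g(x)\psi(x)\,dx,\qquad \widehat c=n^{-1}\sum_{i=1}^n\frac{Y_i\psi(X_i)}{\widehat f^{(i)}(X_i)},$$ with $\widehat f^{(i)}$ the leave-one-out kernel estimator defined in the context. Then $$n^{1/2}(\widehat c-c)\ \longrightarrow\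 \mathcal{N}(0,v)\quad\text{in distribution},$$ where $v$ is the variance of the random variable $\dfrac{Y_1-g(X_1)}{f(X_1)}\,\psi(X_1)$.
   Context: Leave-one-out kernel density estimator, based on $X_1,\dots,X_n$ with bandwidth $h=h_n$: for $1\le i\le n$ and $x\in\mathbb{R}^d$, $$\widehat f^{(i)}(x)=(nh^d)^{-1}\sum_{1\le j\le n,\ j\ne i}K\big(h^{-1}(X_j-x)\big).$$ Kernel: $K$ is symmetric if $K(-x)=K(x)$ for all $x$. $K$ has order $r$ if $\int K(x)\,dx=1$ and $\int P(x)K(x)\,dx=0$ for every non-constant monomial $P$ of degree at most $r$. A function is H\''older on a set $Q$ if for some $\alpha\in(0,1]$ and some constant $C$ one has $|\psi(x)-\psi(y)|\le C\|x-y\|^{\alpha}$ for all $x,y\in Q$. Continuity of $\psi$ across the boundary of $Q$ is not required. The quantity $\psi(X_1)/f(X_1)$ is read as $0$ when $\psi(X_1)=0$. *)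

(* Defs.v *)
From HB Require Import structures.
From mathcomp Require Import all_boot all_order all_algebra finmap.
From mathcomp Require Import all_classical all_reals all_analysis.

Set Implicit Arguments.
Unset Strict Implicit.
Unset Printing Implicit Defensive.
Import Order.TTheory GRing.Theory Num.Theory.
Import numFieldNormedType.Exports.

Local Open Scope classical_set_scope.
Local Open Scope ring_scope.

(* The sigma-algebra on row vectors is the one generated by the coordinates;
   over a realType it is the Borel sigma-algebra (open_measurable_rV below). *)
Definition measure_rV_display : measure_display -> measure_display.
Proof. exact. Qed.

Section measurable_rV.
Context {d} {T : measurableType d}.
Variable n : nat.

Let coord : 'I_n -> 'rV[T]_n -> T := fun i v => v ord0 i.

Let rV_set0 : g_sigma_preimage coord set0.
Proof. exact: sigma_algebra0. Qed.

Let rV_setC A : g_sigma_preimage coord A -> g_sigma_preimage coord (~` A).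
Proof. exact: sigma_algebraC. Qed.

Let rV_bigcup (F : (set 'rV[T]_n)^nat) :
  (forall i, g_sigma_preimage coord (F i)) ->
  g_sigma_preimage coord (\bigcup_i (F i)).
Proof. exact: sigma_algebra_bigcup. Qed.

HB.instance Definition _ := @isMeasurable.Build (measure_rV_display d)
  'rV[T]_n (g_sigma_preimage coord) rV_set0 rV_setC rV_bigcup.

End measurable_rV.

Lemma measurable_rV_coord d (T : measurableType d) n (i : 'I_n) :
  measurable_fun [set: 'rV[T]_n] (fun v => v ord0 i).
Proof.
move=> _ Y mY; rewrite setTI; apply: sub_sigma_algebra => /=.
rewrite -bigcup_seq/=; exists i => /=; first by rewrite mem_index_enum.
by exists Y => //; rewrite setTI.
Qed.

Lemma measurable_fun_rVP d1 d2 (T1 : measurableType d1) (T2 : measurableType d2)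
    n (f : T1 -> 'rV[T2]_n) :
  measurable_fun [set: T1] f <->
  forall i, measurable_fun [set: T1] (fun x => f x ord0 i).
Proof.
split=> [mf i|mf].
  exact: (measurableT_comp (measurable_rV_coord i) mf).
move=> _ A mA; rewrite setTI.
suff: g_sigma_preimage (fun i (v : 'rV[T2]_n) => v ord0 i) `<=`
    [set B | measurable (f @^-1` B)] by apply.
apply: smallest_sub.
  split=> /=; first by rewrite preimage_set0.
  - by move=> B mB; rewrite setTD -preimage_setC; exact: measurableC.
  - by move=> F mF; rewrite preimage_bigcup; exact: bigcupT_measurable.
rewrite -bigcup_seq; apply: bigcup_sub => i _ _ [B mB <-] /=.
by rewrite setTI; have := mf i measurableT B mB; rewrite setTI.
Qed.

Section lebesgue_rV_step.
Context {R : realType} (n : nat).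
Variable mu : {sigma_finite_measure set 'rV[R]_n -> \bar R}.

Definition cons_rV (p : R * 'rV[R]_n) : 'rV[R]_n.+1 :=
  \row_i (if unlift ord0 i is Some j then p.2 ord0 j else p.1).

Definition uncons_rV (v : 'rV[R]_n.+1) : R * 'rV[R]_n :=
  (v ord0 ord0, \row_j v ord0 (lift ord0 j)).

Lemma cons_rV0 p : cons_rV p ord0 ord0 = p.1.
Proof. by rewrite mxE unlift_none. Qed.

Lemma cons_rVS p i : cons_rV p ord0 (lift ord0 i) = p.2 ord0 i.
Proof. by rewrite mxE liftK. Qed.

Lemma cons_rVK : cancel cons_rV uncons_rV.
Proof.
move=> [x v]; congr (_, _); first by rewrite cons_rV0.
by apply/rowP => i; rewrite mxE cons_rVS.
Qed.

Lemma measurable_cons_rV : measurable_fun [set: R * 'rV[R]_n] cons_rV.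
Proof.
apply/measurable_fun_rVP => i; case: (unliftP ord0 i) => [j ->|->].
  under eq_fun do rewrite cons_rVS.
  exact: (measurableT_comp (measurable_rV_coord j) measurable_snd).
by under eq_fun do rewrite cons_rV0; exact: measurable_fst.
Qed.

Lemma measurable_uncons_rV : measurable_fun [set: 'rV[R]_n.+1] uncons_rV.
Proof.
apply/measurable_fun_pairP; split; first exact: measurable_rV_coord.
apply/measurable_fun_rVP => i; under eq_fun do rewrite mxE.
exact: measurable_rV_coord.
Qed.

Definition lebesgue_rV_step : set 'rV[R]_n.+1 -> \bar R :=
  pushforward (lebesgue_measure \x mu)%E cons_rV.

Let step0 : lebesgue_rV_step set0 = 0%E.
Proof. by rewrite /lebesgue_rV_step /pushforward preimage_set0 measure0. Qed.

Let step_ge0 A : (0 <= lebesgue_rV_step A)%E.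
Proof. by rewrite /lebesgue_rV_step /pushforward measure_ge0. Qed.

Let step_sigma_additive : semi_sigma_additive lebesgue_rV_step.
Proof.
move=> F mF tF mUF; rewrite /lebesgue_rV_step /pushforward preimage_bigcup.
have mcF k : measurable (cons_rV @^-1` F k).
  by rewrite -[X in measurable X]setTI; exact: measurable_cons_rV.
apply: measure_semi_sigma_additive => //.
- apply/trivIsetP => i j _ _ ij; rewrite -preimage_setI.
  by move/trivIsetP : tF => -> //; rewrite preimage_set0.
- exact: bigcupT_measurable.
Qed.

HB.instance Definition _ := isMeasure.Build _ _ _ lebesgue_rV_step
  step0 step_ge0 step_sigma_additive.

Lemma lebesgue_rV_stepE (A : set R) (B : set 'rV[R]_n) :
  measurable A -> measurable B ->
  lebesgue_rV_step (uncons_rV @^-1` (A `*` B)) = (lebesgue_measure A * mu B)%E.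
Proof.
move=> mA mB; rewrite /lebesgue_rV_step /pushforward.
rewrite -comp_preimage (_ : uncons_rV \o cons_rV = id).
  by rewrite preimage_id product_measure1E.
by apply/funext => p /=; rewrite cons_rVK.
Qed.

Let step_sigma_finite : sigma_finite setT lebesgue_rV_step.
Proof.
have [F FT mF] : sigma_finite setT (@lebesgue_measure R).
  exact: sigma_finiteT.
have [G GT mG] := sigma_finiteT mu.
pose S := fun i j : nat => uncons_rV @^-1` (F i `*` G j).
have mS i j : measurable (S i j).
  rewrite -[X in measurable X]setTI; apply: measurable_uncons_rV => //.
  by apply: measurableX; [exact: (mF i).1|exact: (mG j).1].
pose H k := if (choice.unpickle k : option (nat * nat)) is Some p
  then S p.1 p.2 else set0.
exists H => [|k]; last first.
  rewrite /H; case: (choice.unpickle k) => [[i j]/=|]; last first.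
    by rewrite measure0.
  split => //; rewrite /S [X in (X < _)%E]lebesgue_rV_stepE.
  - by rewrite lte_mul_pinfty// ?ge0_fin_numE// ?(mF i).2// ?(mG j).2.
  - exact: (mF i).1.
  - exact: (mG j).1.
apply/esym; rewrite -subTset => v _.
have [i _ Fi] : (\bigcup_i F i) (uncons_rV v).1 by rewrite -FT.
have [j _ Gj] : (\bigcup_i G i) (uncons_rV v).2 by rewrite -GT.
by exists (choice.pickle (i, j)) => //; rewrite /H choice.pickleK.
Qed.

HB.instance Definition _ := @Measure_isSigmaFinite.Build _ _ _
  lebesgue_rV_step step_sigma_finite.

End lebesgue_rV_step.

(* Lebesgue measure on R^n as an iterated product measure; lebesgue_rV_box
   gives its value on boxes. *)
Fixpoint lebesgue_rV {R : realType} (n : nat) :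
    {sigma_finite_measure set 'rV[R]_n -> \bar R} :=
  match n with
  | 0 => @dirac _ 'rV[R]_0 0 R
  | m.+1 => lebesgue_rV_step (@lebesgue_rV R m)
  end.

Lemma lebesgue_rV_box (R : realType) (n : nat) (A : 'I_n -> set R) :
  (forall i, measurable (A i)) ->
  lebesgue_rV n [set v | forall i, A i (v ord0 i)] =
  (\prod_(i < n) lebesgue_measure (A i))%E.
Proof.
elim: n A => [|n IH] A mA /=.
  by rewrite big_ord0 diracE mem_set// => -[].
rewrite big_ord_recl.
pose B := [set v : 'rV[R]_n | forall i, A (lift ord0 i) (v ord0 i)].
have mB : measurable B.
  rewrite (_ : B = \bigcap_(i in [set: 'I_n])
      (fun v : 'rV[R]_n => v ord0 i) @^-1` A (lift ord0 i)).
    apply: fin_bigcap_measurable => // i _; rewrite -[X in measurable X]setTI.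
    exact: measurable_rV_coord.
  by apply/seteqP; split=> [v Av i _|v Av i]; exact: Av.
rewrite -IH// -lebesgue_rV_stepE//; congr (lebesgue_rV_step _ _).
apply/seteqP; split=> [v Av|v [A0 AS] i].
  by split=> [|i]; rewrite /= ?mxE; exact: Av.
case: (unliftP ord0 i) => [j ->|->] //.
by have := AS j; rewrite /= mxE.
Qed.

Lemma open_measurable_rV (R : realType) (n : nat) (U : set 'rV[R]_n) :
  open U -> measurable U.
Proof.
move=> oU.
pose box (p : 'rV[rat]_n * 'rV[rat]_n) := [set v : 'rV[R]_n | forall i,
  ratr (p.1 ord0 i) < v ord0 i /\ v ord0 i < ratr (p.2 ord0 i)].
have mbox p : measurable (box p).
  rewrite (_ : box p = \bigcap_(i in [set: 'I_n]) (fun v : 'rV[R]_n =>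
      v ord0 i) @^-1` `]ratr (p.1 ord0 i), ratr (p.2 ord0 i)[%classic).
    apply: fin_bigcap_measurable => // i _; rewrite -[X in measurable X]setTI.
    exact: measurable_rV_coord.
  apply/seteqP; split=> [v Bv i _|v Bv i].
    by rewrite /= in_itv/=; have [-> ->] := Bv i.
  by have := Bv i I; rewrite /= in_itv/= => /andP[].
pose F k := if (choice.unpickle k : option ('rV[rat]_n * 'rV[rat]_n)) is Some p
  then (if `[< box p `<=` U >] then box p else set0) else set0.
rewrite (_ : U = \bigcup_k F k).
  apply: bigcupT_measurable => k; rewrite /F.
  by case: (choice.unpickle k) => [p|//]; case: ifP.
apply/seteqP; split=> [v Uv|v [k _]]; last first.
  rewrite /F; case: (choice.unpickle k) => [p|//].
  by case: ifPn => [/asboolP|//]; apply.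
have /nbhs_ballP[e /= e0 eU] : nbhs v U by exact: open_nbhs_nbhs.
have ltl i : v ord0 i - e < v ord0 i by rewrite ltrBlDr ltrDl.
have ltr i : v ord0 i < v ord0 i + e by rewrite ltrDl.
pose a i := sval (cid (rat_in_itvoo (ltl i))).
pose b i := sval (cid (rat_in_itvoo (ltr i))).
exists (choice.pickle (\row_i a i, \row_i b i)) => //; rewrite /F choice.pickleK.
have aP i : v ord0 i - e < ratr (a i) < v ord0 i.
  by rewrite /a; case: cid => q /=; rewrite in_itv.
have bP i : v ord0 i < ratr (b i) < v ord0 i + e.
  by rewrite /b; case: cid => q /=; rewrite in_itv.
rewrite asboolT => [i|w bw].
  by rewrite /= !mxE; have /andP[_ ->] := aP i; have /andP[-> _] := bP i.
apply: eU; split=> // j i; rewrite ord1; have := bw i; rewrite /= !mxE => -[aw wb].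
rewrite /ball/= ltr_distlC; have /andP[ea _] := aP i; have /andP[_ eb] := bP i.
by rewrite (lt_trans ea aw) (lt_trans wb eb).
Qed.

Section real_functions.
Context {R : realType} {d : nat}.
Implicit Types (f K : 'rV[R]_d -> R) (Q : set 'rV[R]_d).

(* The library norm on row vectors is the sup norm. *)
Definition enorm (x : 'rV[R]_d) : R := Num.sqrt (\sum_(i < d) x ord0 i ^+ 2).

Definition holder_on Q f := exists alpha C : R,
  [/\ 0 < alpha, alpha <= 1 & forall x y, Q x -> Q y ->
    `|f x - f y| <= C * enorm (x - y) `^ alpha].

Definition std_basis (i : 'I_d) : 'rV[R]_d := delta_mx ord0 i.

Definition iter_partial (s : seq 'I_d) f : 'rV[R]_d -> R :=
  foldr (fun i F x => 'D_(std_basis i) F x) f s.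

(* All iterated partial derivatives of f up to order r exist everywhere and
   those of order exactly r are bounded. *)
Definition bounded_partials (r : nat) f :=
  (forall (s : seq 'I_d) (i : 'I_d) (x : 'rV[R]_d), (size s < r)%N ->
    derivable (iter_partial s f) x (std_basis i)) /\
  (forall s : seq 'I_d, size s = r -> bounded_fun (iter_partial s f)).

Definition monomial (m : 'I_d -> nat) (x : 'rV[R]_d) : R :=
  \prod_(i < d) x ord0 i ^+ m i.

Definition symmetric_kernel K := forall x, K (- x) = K x.

Definition kernel_order (r : nat) K :=
  [/\ (lebesgue_rV d).-integrable setT (EFin \o K),
      \int[lebesgue_rV d]_x K x = 1 &
      forall m : 'I_d -> nat, (0 < \sum_(i < d) m i <= r)%N ->
        (lebesgue_rV d).-integrable setT (fun x => (monomial m x * K x)%:E) /\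
        \int[lebesgue_rV d]_x (monomial m x * K x) = 0].

(* Sample points are indexed from 0, so X_1, ..., X_n are x 0, ..., x n.-1. *)
Definition loo_kde K (h : R) (n : nat) (x : nat -> 'rV[R]_d) (i : nat)
    (t : 'rV[R]_d) : R :=
  (n%:R * h ^+ d)^-1 *
  \sum_(j < n | (j : nat) != i) K (h^-1 *: (x j - t)).

Definition kernel_estimator K psi (h : R) (n : nat)
    (x : nat -> 'rV[R]_d) (y : nat -> R) : R :=
  n%:R^-1 * \sum_(i < n) (y i * psi (x i)) / loo_kde K h n x i (x i).

End real_functions.

Section random_sequences.
Context {dO : measure_display} {Omega : measurableType dO} {R : realType}.
Variable P : probability Omega R.
Local Open Scope ereal_scope.

Definition mutually_independent {d'} {T : measurableType d'}
    (X : nat -> {RV P >-> T}) :=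
  forall (J : {fset nat}) (A : nat -> set T), (forall i, measurable (A i)) ->
    P (\bigcap_(i in [set` J]) (X i @^-1` A i)) =
    \prod_(i <- J) P (X i @^-1` A i).

Definition identically_distributed {d'} {T : measurableType d'}
    (X : nat -> {RV P >-> T}) :=
  forall i (A : set T), measurable A ->
    distribution P (X i) A = distribution P (X 0%N) A.

Definition iid {d'} {T : measurableType d'} (X : nat -> {RV P >-> T}) :=
  mutually_independent X /\ identically_distributed X.

Definition sigma_sequence {d'} {T : measurableType d'}
    (X : nat -> {RV P >-> T}) : set (set Omega) :=
  <<s \bigcup_i preimage_set_system setT (X i) measurable >>.

Definition independent_sequences {d1 d2} {T1 : measurableType d1}
    {T2 : measurableType d2} (X : nat -> {RV P >-> T1})
    (Y : nat -> {RV P >-> T2}) :=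
  forall A B, sigma_sequence X A -> sigma_sequence Y B ->
    P (A `&` B) = P A * P B.

Definition has_density {d : nat} (X : {RV P >-> 'rV[R]_d})
    (f : 'rV[R]_d -> R) :=
  [/\ measurable_fun setT f, forall x, (0 <= f x)%R &
    forall A, measurable A ->
      distribution P X A = \int[lebesgue_rV d]_(x in A) (f x)%:E].

Definition cvg_in_distribution (Z : nat -> Omega -> R)
    (nu : probability (measurableTypeR R) R) :=
  (forall n, measurable_fun setT (Z n)) /\
  forall t : R, {for t, continuous (fun s : R => nu `]-oo, s]%classic)} ->
    P [set w | (Z n w <= t)%R] @[n --> \oo] --> nu `]-oo, t]%classic.

End random_sequences.

(* normal_prob m 0 is not the degenerate law, so variance 0 is treated apart;
   normal_prob takes a standard deviation. *)
Definition normal_law {R : realType} (m v : R) :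
    probability (measurableTypeR R) R :=
  if v == 0 then [the probability _ R of @dirac _ (measurableTypeR R) m R]
  else [the probability _ R of normal_prob m (Num.sqrt v)].

(* Main.v *)
(* Write [F i] for the leave-one-out estimator at [X i]. From
     1 / F = 1 / f - (F - f) / f^2 + (F - f)^2 / (f^2 F)
   the normalized error is [n^(-1/2) \sum_i sigma psi / f (X i) * e i] plus three
   remainders, each controlled in mean or mean square on the event that
   [b / 2 <= F i] at all the sample points of [Q]; by fourth moments the complement
   has vanishing probability.
   - The noise multiplied by [1 / F - 1 / f] is small by independence of the noise
     from the design.
   - The quadratic part is of order [sqrt n * ((n h^d)^-1 + h^(2r))].
   - The part linear in [F] is a U-statistic. Its degenerate part is small; its
     Hoeffding projections are smoothed versions of [q = g psi / f], and they cancel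
     the remaining term up to the squared L2 distance between [q] and its smoothing,
     which vanishes because translations are continuous in mean on a closed support.
   The main term is a sum of i.i.d. centered variables of finite variance, handled
   by exchanging its summands with Gaussian ones inside logistic test functions,
   which sandwich the indicators of half-lines. *)

Require Import Defs.
From HB Require Import structures.
From mathcomp Require Import all_boot all_order all_algebra finmap.
From mathcomp Require Import all_classical all_reals all_analysis.
From mathcomp Require Import measurable_realfun.
From mathcomp Require Import ring lra.

Set Implicit Arguments.
Unset Strict Implicit.
Unset Printing Implicit Defensive.
Import Order.TTheory GRing.Theory Num.Theory.
Import numFieldNormedType.Exports.

Local Open Scope classical_set_scope.
Local Open Scope ring_scope.

(** * Bounded measurable functions *)

(** The function [q = g psi / f] may jump across the boundary of [Q], so its smoothing error comes
    without a rate: it only tends to zero in mean square. This suffices for a centered sum divided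
    by [sqrt n], but not for a mean. The way out is that the two Hoeffding projections have equal
    means, and one of them is a weight times the smoothing of [f], whose bias is [O(h^r)]. The mean
    of the linear part is then off by [O(h^r + 1/n)] per summand, which [sqrt n h^r -> 0] absorbs.

    The denominators can be zero or tiny, so no moment of the estimator is available. Comparisons
    are therefore made under Lipschitz test functions with values in [[0, 1]], which lose at most
    [1] on the bad event; on the good one the denominators may be truncated at [b / 2]. The bad
    event is a union over [n] sample points: second moments would bound its probability by a
    multiple of [n (n h^d)^-1 = h^-d], whereas fourth moments give the leading order
    [n (n h^d)^-2 = (sqrt n h^d)^-2], which is where [sqrt n h^d -> +oo] is decisive. *)

Section bounded_measurable.
Context {d} {T : measurableType d} {R : realType}.
Implicit Types (F G : T -> R).

(** This class is stable under sums, products and composition with measurable maps, and integrable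
    against every probability, so integrals of its members need no integrability side conditions. *)
Definition bmeas F := measurable_fun setT F /\ exists M : R, forall x, `|F x| <= M.

Lemma bmeas_meas F : bmeas F -> measurable_fun setT F. Proof. by case. Qed.

Lemma bmeas_bound F : bmeas F -> exists2 M : R, 0 < M & forall x, `|F x| <= M.
Proof.
move=> [_ [M FM]]; exists (`|M| + 1); first by rewrite ltr_wpDl.
by move=> x; rewrite (le_trans (FM x))// (le_trans (ler_norm _))// lerDl.
Qed.

Lemma bmeas_cst (c : R) : bmeas (fun _ => c).
Proof. by split; [exact: measurable_cst|exists `|c|]. Qed.

Lemma bmeasD F G : bmeas F -> bmeas G -> bmeas (fun x => F x + G x).
Proof.
move=> [mF [M FM]] [mG [N GN]]; split; first exact: measurable_funD.
by exists (M + N) => x; rewrite (le_trans (ler_normD _ _))// lerD.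
Qed.

Lemma bmeasM F G : bmeas F -> bmeas G -> bmeas (fun x => F x * G x).
Proof.
move=> [mF [M FM]] [mG [N GN]]; split; first exact: measurable_funM.
by exists (M * N) => x; rewrite normrM ler_pM.
Qed.

Lemma bmeasN F : bmeas F -> bmeas (fun x => - F x).
Proof.
move=> [mF [M FM]]; split; last by exists M => x; rewrite normrN.
exact: measurableT_comp.
Qed.

Lemma bmeasB F G : bmeas F -> bmeas G -> bmeas (fun x => F x - G x).
Proof. by move=> bF bG; apply: bmeasD => //; exact: bmeasN. Qed.

Lemma bmeasX F n : bmeas F -> bmeas (fun x => F x ^+ n).
Proof.
move=> bF; elim: n => [|n IH].
  by under eq_fun do rewrite expr0; exact: bmeas_cst.
by under eq_fun do rewrite exprS; exact: bmeasM.
Qed.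

Lemma bmeas_norm F : bmeas F -> bmeas (fun x => `|F x|).
Proof.
move=> [mF [M FM]]; split; first exact: measurableT_comp.
by exists M => x; rewrite normr_id.
Qed.

Lemma bmeas_sum I (s : seq I) (p : pred I) (F : I -> T -> R) :
  (forall i, p i -> bmeas (F i)) -> bmeas (fun x => \sum_(i <- s | p i) F i x).
Proof.
move=> bF; elim: s => [|i s IH].
  by under eq_fun do rewrite big_nil; exact: bmeas_cst.
under eq_fun do rewrite big_cons.
by case: (boolP (p i)) => // pi; apply: bmeasD => //; exact: bF.
Qed.

Lemma bmeas_integrable (mu : {finite_measure set T -> \bar R}) F :
  bmeas F -> mu.-integrable setT (EFin \o F).
Proof.
move=> [mF [M FM]]; apply: measurable_bounded_integrable => //.
  by rewrite -ge0_fin_numE// fin_num_measure.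
exists M; split; first exact: num_real.
by move=> x Mx y _ /=; rewrite (le_trans (FM y)) ?ltW.
Qed.

End bounded_measurable.

Lemma bmeas_comp d1 d2 (T1 : measurableType d1) (T2 : measurableType d2)
    (R : realType) (F : T2 -> R) (phi : T1 -> T2) :
  bmeas F -> measurable_fun setT phi -> bmeas (fun x => F (phi x)).
Proof.
move=> [mF [M FM]] mphi; split; last by exists M => x.
exact: (measurableT_comp mF).
Qed.

Section expectation_bounded.
Context {d} {T : measurableType d} {R : realType} (P : probability T R).
Implicit Types (F G : T -> R).

Lemma Rintegral_prob_cst (c : R) : \int[P]_x c = c.
Proof.
by rewrite Rintegral_cst//; have := probability_setT P => /= ->; rewrite mulr1.
Qed.

Lemma Rint_D F G : bmeas F -> bmeas G ->
  \int[P]_x (F x + G x) = \int[P]_x F x + \int[P]_x G x.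
Proof. by move=> bF bG; rewrite RintegralD//; exact: bmeas_integrable. Qed.

Lemma Rint_B F G : bmeas F -> bmeas G ->
  \int[P]_x (F x - G x) = \int[P]_x F x - \int[P]_x G x.
Proof. by move=> bF bG; rewrite RintegralB//; exact: bmeas_integrable. Qed.

Lemma Rint_Zl F c : bmeas F -> \int[P]_x (c * F x) = c * \int[P]_x F x.
Proof. by move=> bF; rewrite RintegralZl//; exact: bmeas_integrable. Qed.

Lemma Rint_Zr F c : bmeas F -> \int[P]_x (F x * c) = \int[P]_x F x * c.
Proof. by move=> bF; rewrite RintegralZr//; exact: bmeas_integrable. Qed.

Lemma Rint_le F G : bmeas F -> bmeas G -> (forall x, F x <= G x) ->
  \int[P]_x F x <= \int[P]_x G x.
Proof. by move=> bF bG FG; apply: le_Rintegral => //; exact: bmeas_integrable. Qed.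

Lemma Rint_sum I (s : seq I) (p : pred I) (F : I -> T -> R) :
  (forall i, p i -> bmeas (F i)) ->
  \int[P]_x (\sum_(i <- s | p i) F i x) = \sum_(i <- s | p i) \int[P]_x F i x.
Proof.
move=> bF; elim: s => [|i s IH].
  by under eq_Rintegral do rewrite big_nil; rewrite Rintegral_prob_cst big_nil.
rewrite big_cons; under eq_Rintegral do rewrite big_cons.
case: (boolP (p i)) => // pi; rewrite -IH Rint_D//; first exact: bF.
exact: bmeas_sum.
Qed.

Lemma Rint_norm F : bmeas F -> `|\int[P]_x F x| <= \int[P]_x `|F x|.
Proof. by move=> bF; apply: le_normr_Rintegral => //; exact: bmeas_integrable. Qed.

Lemma Rint_norm_le F c : bmeas F -> (forall x, `|F x| <= c) ->
  `|\int[P]_x F x| <= c.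
Proof.
move=> bF Fc; rewrite (le_trans (Rint_norm bF))//.
rewrite -[leRHS]Rintegral_prob_cst; apply: Rint_le => //.
  exact: bmeas_norm.
exact: bmeas_cst.
Qed.

Lemma Rint_EFin F : bmeas F ->
  (\int[P]_x F x)%:E = (\int[P]_x (F x)%:E)%E.
Proof.
move=> bF; rewrite /Rintegral fineK//.
by apply: integrable_fin_num => //; exact: (bmeas_integrable P bF).
Qed.

End expectation_bounded.

(** Tonelli gives measurability of partial integrals of nonnegative functions, so [F] is shifted by
    its bound [M]; against a probability the shift integrates to [M] and is subtracted again. *)
Lemma bmeas_fubini d1 d2 (T1 : measurableType d1) (T2 : measurableType d2)
    (R : realType) (P : probability T2 R) (F : T1 * T2 -> R) :
  bmeas F -> bmeas (fun x => \int[P]_y F (x, y)).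
Proof.
move=> bF; have [M M0 FM] := bmeas_bound bF.
have bFx x : bmeas (fun y => F (x, y)).
  by apply: bmeas_comp bF _; exact: measurable_pair1.
split; last by exists M => x; apply: Rint_norm_le.
rewrite (_ : (fun x => _) = (fun x => \int[P]_y (F (x, y) + M) - M)); last first.
  apply/funext => x; rewrite Rint_D//; last exact: bmeas_cst.
  by rewrite Rintegral_prob_cst addrK.
apply: measurable_funB => //; apply: measurableT_comp => //.
have := @measurable_fun_fubini_tonelli_F _ _ T1 T2 R P
  (fun z => (F z + M)%:E).
apply.
  by apply/measurable_EFinP; apply: measurable_funD => //; exact: bF.1.
move=> z; rewrite lee_fin -lerBlDr sub0r.
by have := FM z; rewrite ler_norml => /andP[].
Qed.

Section integrable_real.
Context {d} {T : measurableType d} {R : realType}.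
Variable mu : {measure set T -> \bar R}.
Implicit Types f g : T -> R.

Lemma integrable_realZ f (k : R) : mu.-integrable setT (EFin \o f) ->
  mu.-integrable setT (EFin \o (fun w => k * f w)).
Proof.
move=> fi; rewrite (_ : EFin \o _ = (fun w => k%:E * (EFin \o f) w)%E).
  exact: integrableZl.
by apply/funext => w /=; rewrite EFinM.
Qed.

Lemma integrable_realD f g : mu.-integrable setT (EFin \o f) ->
  mu.-integrable setT (EFin \o g) ->
  mu.-integrable setT (EFin \o (fun w => f w + g w)).
Proof.
move=> fi gi; rewrite (_ : EFin \o _ = (EFin \o f) \+ (EFin \o g))%E.
  exact: integrableD.
by apply/funext => w /=; rewrite EFinD.
Qed.

Lemma integrable_realB f g : mu.-integrable setT (EFin \o f) ->
  mu.-integrable setT (EFin \o g) ->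
  mu.-integrable setT (EFin \o (fun w => f w - g w)).
Proof.
move=> fi gi; rewrite (_ : EFin \o _ = (EFin \o f) \- (EFin \o g))%E.
  exact: integrableB.
by apply/funext => w /=; rewrite EFinB.
Qed.

End integrable_real.

(** * Affine changes of variables and densities *)

(** The image of Lebesgue measure under [t |-> a + b * t], scaled by [b], gives half-open intervals
    their length, hence is Lebesgue measure by uniqueness. *)
Lemma lebesgue_integral_affine (R : realType) (a b : R) (F : R -> \bar R) :
  0 < b -> measurable_fun setT F -> (forall x, 0 <= F x)%E ->
  (b%:E * \int[lebesgue_measure]_t F (a + b * t)%R =
   \int[lebesgue_measure]_x F x)%E.
Proof.
move=> b0 mF F0.
pose phi (t : R) : measurableTypeR R := a + b * t.
have mphi : measurable_fun setT phi.
  by apply: measurable_funD => //; apply: measurable_funM.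
have pE (x y : R) : phi @^-1` `]x, y] = `](x - a) / b, (y - a) / b]%classic.
  apply/seteqP; split => t /=; rewrite /phi !in_itv/= ltr_pdivrMr// ler_pdivlMr//.
    by move=> /andP[h1 h2]; apply/andP; split; lra.
  by move=> /andP[h1 h2]; apply/andP; split; lra.
pose k : {nonneg R} := NngNum (ltW b0).
have mE (A : set R) : measurable A ->
    mscale k (pushforward (@lebesgue_measure R) phi) A = lebesgue_measure A.
  move=> mA; apply/esym/lebesgue_measure_unique => //= _ [[x y] _ <-] /=.
  rewrite /mscale/= /pushforward pE.
  rewrite !lebesgue_measure_itv/= !lte_fin ltr_pM2r ?invr_gt0// ltrD2r.
  case: ifPn => _; last by rewrite mule0.
  by rewrite -EFinM; congr EFin; field; rewrite gt_eqF.
rewrite [RHS](_ : _ = \int[mscale k (pushforward (@lebesgue_measure R) phi)]_x F x)%E; last first.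
  by apply: eq_measure_integral => A mA _; exact/esym/mE.
rewrite ge0_integral_mscale//=; congr (_ * _)%E.
by rewrite ge0_integral_pushforward.
Qed.

Section rV_integral.
Context {R : realType}.

Lemma integral_rVS n (F : 'rV[R]_n.+1 -> \bar R) :
  measurable_fun setT F -> (forall x, 0 <= F x)%E ->
  (\int[lebesgue_rV n.+1]_x F x =
   \int[lebesgue_rV n]_v \int[lebesgue_measure]_t F (cons_rV (t, v)))%E.
Proof.
move=> mF F0.
rewrite [LHS](_ : _ = \int[pushforward (lebesgue_measure \x lebesgue_rV n)
  (@cons_rV R n)]_x F x)%E //.
rewrite ge0_integral_pushforward//; last exact: measurable_cons_rV.
rewrite fubini_tonelli2//; last by move=> x; exact: F0.
by apply: (measurableT_comp mF); exact: measurable_cons_rV.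
Qed.

Lemma measurable_affine_rV n (a : 'rV[R]_n) (b : R) :
  measurable_fun setT (fun u : 'rV[R]_n => a + b *: u).
Proof.
apply/measurable_fun_rVP => i; under eq_fun do rewrite !mxE.
apply: measurable_funD => //; apply: measurable_funM => //.
exact: measurable_rV_coord.
Qed.

(** Induction on the dimension: the map acts coordinatewise, so the first coordinate is split off by
    Tonelli and contributes one factor [b]. *)
Lemma lebesgue_rV_integral_affine n (a : 'rV[R]_n) (b : R)
    (F : 'rV[R]_n -> \bar R) :
  0 < b -> measurable_fun setT F -> (forall x, 0 <= F x)%E ->
  ((b ^+ n)%:E * \int[lebesgue_rV n]_u F (a + b *: u)%R =
   \int[lebesgue_rV n]_x F x)%E.
Proof.
move=> b0; elim: n a F => [|n IH] a F mF F0.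
  rewrite expr0 mul1e; apply: eq_integral => u _; congr F.
  by apply/rowP => -[].
rewrite !integral_rVS//; last first.
  by apply: (measurableT_comp mF); exact: measurable_affine_rV.
pose a' : 'rV[R]_n := \row_j a ord0 (lift ord0 j).
pose G (v : 'rV[R]_n) := (\int[lebesgue_measure]_t F (cons_rV (t, v)))%E.
have mG : measurable_fun setT G.
  apply: (@measurable_fun_fubini_tonelli_G _ _ _ _ R lebesgue_measure
    (fun z => F (cons_rV z))) => //.
  by apply: (measurableT_comp mF); exact: measurable_cons_rV.
have G0 v : (0 <= G v)%E by apply: integral_ge0.
transitivity (\int[lebesgue_rV n]_v G v)%E; last by [].
rewrite -(IH a' G mG G0) exprSr EFinM -muleA; congr (_ * _)%E.
have E v t : a + b *: cons_rV (t, v) = cons_rV (a ord0 ord0 + b * t, a' + b *: v).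
  apply/rowP => i; rewrite mxE [X in _ + X]mxE.
  by case: (unliftP ord0 i) => [j ->|->]; rewrite ?cons_rVS ?cons_rV0 /= ?mxE.
pose G2 (v : 'rV[R]_n) :=
  (\int[lebesgue_measure]_t F (cons_rV (a ord0 ord0 + b * t, a' + b *: v))%R)%E.
have mG2 : measurable_fun setT G2.
  apply: (@measurable_fun_fubini_tonelli_G _ _ _ _ R lebesgue_measure
    (fun z : R * 'rV[R]_n => F (cons_rV (a ord0 ord0 + b * z.1, a' + b *: z.2)))) => //.
  apply: (measurableT_comp mF); apply: (measurableT_comp (@measurable_cons_rV R n)).
  apply/measurable_fun_pairP; split => /=.
    by apply: measurable_funD => //; apply: measurable_funM.
  exact: (measurableT_comp (measurable_affine_rV a' b) measurable_snd).
under eq_integral do under eq_integral do rewrite E.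
rewrite -ge0_integralZl//; last 2 first.
- by move=> v _; apply: integral_ge0.
- by rewrite lee_fin ltW.
apply: eq_integral => v _; rewrite (lebesgue_integral_affine _
  (F := fun t => F (cons_rV (t, a' + b *: v))))//.
by apply: (measurableT_comp mF);
  apply: (measurableT_comp (@measurable_cons_rV R n)); exact: measurable_pair2.
Qed.

End rV_integral.

Import HBNNSimple.

(** Monotone approximation by simple functions reduces the claim to indicators of level sets, where
    it is the assumption on [nu]. *)
Lemma ge0_integral_density d (T : measurableType d) (R : realType)
    (mu nu : {measure set T -> \bar R}) (f : T -> R) (F : T -> \bar R) :
  measurable_fun setT f -> (forall x, 0 <= f x) ->
  (forall A, measurable A -> nu A = \int[mu]_(x in A) (f x)%:E)%E ->
  measurable_fun setT F -> (forall x, 0 <= F x)%E ->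
  (\int[nu]_x F x = \int[mu]_x (F x * (f x)%:E))%E.
Proof.
move=> mf f0 nuE mF F0.
have fE0 x : (0 <= (f x)%:E)%E by rewrite lee_fin.
have mfE : measurable_fun setT (EFin \o f) by exact/measurable_EFinP.
pose F_ := nnsfun_approx measurableT mF.
have F_E x : (F_ n x)%:E @[n --> \oo] --> F x by exact: cvg_nnsfun_approx.
transitivity (limn (fun n => \int[nu]_x (F_ n x)%:E))%E.
  rewrite -monotone_convergence//=.
  - by apply: eq_integral => x _; apply/esym/cvg_lim => //; exact: F_E.
  - by move=> n; exact/measurable_EFinP.
  - by move=> n x _; rewrite lee_fin.
  - by move=> x _ m n mn; rewrite lee_fin; exact/lefP/nd_nnsfun_approx.
transitivity (limn (fun n => \int[mu]_x ((F_ n x)%:E * (f x)%:E)))%E; last first.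
  rewrite -monotone_convergence//=.
  - apply: eq_integral => x _; apply/cvg_lim => //.
    by apply: cvgeMr => //; exact: F_E.
  - by move=> n; apply: emeasurable_funM => //; exact/measurable_EFinP.
  - by move=> n x _; rewrite -EFinM lee_fin mulr_ge0.
  - move=> x _ m n mn; rewrite lee_fin ler_wpM2r//.
    exact/lefP/nd_nnsfun_approx.
congr (limn _); apply/funext => n.
rewrite integral_nnsfun// sintegralE.
have -> : F_ n \_ setT = F_ n by apply/funext => x; rewrite patchE in_setT.
rewrite [RHS](eq_integral (fun x => \sum_(r \in range (F_ n))
    ((r * \1_(F_ n @^-1` [set r]) x)%:E * (f x)%:E))%E); last first.
  move=> x _; rewrite fimfunE -fsumEFin// ge0_mule_fsuml// => r.
  by rewrite EFinM nnfun_muleindic_ge0.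
rewrite ge0_integral_fsum//; last 2 first.
- move=> r; apply: emeasurable_funM => //.
  by apply/measurable_EFinP/measurable_funM.
- by move=> r x _; rewrite mule_ge0// EFinM nnfun_muleindic_ge0.
apply: eq_fsbigr => r _.
have [r0|r0] := leP 0 r; last first.
  rewrite (_ : F_ n @^-1` [set r] = set0) ?measure0 ?mule0; last first.
    apply/seteqP; split => // x /= Fr.
    by move: r0; rewrite -Fr ltNge => /negP; apply.
  by under eq_integral do rewrite indic0 mulr0 mul0e; rewrite integral0.
under eq_integral do rewrite EFinM -muleA.
rewrite ge0_integralZl//; last 2 first.
- apply: emeasurable_funM => //; exact/measurable_EFinP.
- by move=> x _; rewrite mule_ge0// lee_fin.
congr (_ * _)%E; rewrite nuE// integral_mkcond/=.
apply: eq_integral => x _; rewrite patchE indicE.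
by case: ifPn => _; rewrite ?mul1e ?mul0e.
Qed.

(** * Independence and decoupling *)

Section decoupling.
Context {dO : measure_display} {Omega : measurableType dO} {R : realType}.
Context (P : probability Omega R).
Context {d1 d2 : measure_display} {T1 : measurableType d1} {T2 : measurableType d2}.
Variables (X : Omega -> T1) (Y : Omega -> T2).

Definition indep_rv := forall A B, measurable A -> measurable B ->
  (P (X @^-1` A `&` Y @^-1` B) = P (X @^-1` A) * P (Y @^-1` B))%E.

Hypothesis mX : measurable_fun setT X.
Hypothesis mY : measurable_fun setT Y.
Hypothesis XY : indep_rv.

Let X' : {mfun Omega >-> T1} := HB.pack X (isMeasurableFun.Build _ _ _ _ _ mX).
Let Y' : {mfun Omega >-> T2} := HB.pack Y (isMeasurableFun.Build _ _ _ _ _ mY).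
Let mu1 : probability T1 R := distribution P X'.
Let mu2 : probability T2 R := distribution P Y'.

Let mXY : measurable_fun setT (fun w => (X w, Y w)).
Proof. exact/measurable_fun_pairP. Qed.

Let joint_law (C : set (T1 * T2)) : measurable C ->
  (mu1 \x mu2)%E C = pushforward P (fun w => (X w, Y w)) C.
Proof.
by move=> mC; exact: product_measure_unique.
Qed.

(** By uniqueness of product measures, independence makes the joint law the product of the two laws;
    Tonelli then separates the variables. *)
Lemma ge0_decouple (F : T1 * T2 -> \bar R) :
  measurable_fun setT F -> (forall z, 0 <= F z)%E ->
  (\int[P]_w F (X w, Y w) = \int[P]_w' \int[P]_w F (X w, Y w'))%E.
Proof.
move=> mF F0.
transitivity (\int[pushforward P (fun w => (X w, Y w))]_z F z)%E.
  by rewrite ge0_integral_pushforward.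
transitivity (\int[mu1 \x mu2]_z F z)%E.
  by apply: eq_measure_integral => C mC _; exact/esym/joint_law.
rewrite fubini_tonelli2// /mu2 (@ge0_integral_distribution _ _ _ _ _ _ Y')//; last 2 first.
- exact: measurable_fun_fubini_tonelli_G.
- by move=> y; apply: integral_ge0.
apply: eq_integral => w' _; rewrite /fubini_G /= /mu1.
rewrite (@ge0_integral_distribution _ _ _ _ _ _ X' (fun x => F (x, Y w')))//.
by apply: (measurableT_comp mF); exact: measurable_pair2.
Qed.

Lemma bmeas_decouple (F : T1 * T2 -> R) : bmeas F ->
  \int[P]_w F (X w, Y w) = \int[P]_w' (\int[P]_w F (X w, Y w')).
Proof.
move=> bF; have [M M0 FM] := bmeas_bound bF.
pose G z := F z + M.
have bG : bmeas G by apply: bmeasD => //; exact: bmeas_cst.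
have G0 z : 0 <= G z.
  by rewrite -lerBlDr sub0r; have := FM z; rewrite ler_norml => /andP[].
have bG1 : bmeas (fun w => G (X w, Y w)) by exact: bmeas_comp bG mXY.
have bG2 w' : bmeas (fun w => G (X w, Y w')).
  apply: (bmeas_comp bG (phi := fun w => (X w, Y w'))).
  by apply/measurable_fun_pairP; split => //; exact: measurable_cst.
have bG3 : bmeas (fun w' => \int[P]_w G (X w, Y w')).
  apply: (@bmeas_fubini _ _ _ _ R P (fun z : Omega * Omega => G (X z.2, Y z.1))).
  apply: (bmeas_comp bG (phi := fun z : Omega * Omega => (X z.2, Y z.1))).
  apply/measurable_fun_pairP; split => /=.
    exact: (measurableT_comp mX measurable_snd).
  exact: (measurableT_comp mY measurable_fst).
have E : \int[P]_w G (X w, Y w) = \int[P]_w' (\int[P]_w G (X w, Y w')).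
  apply: EFin_inj; rewrite !Rint_EFin//.
  rewrite (@ge0_decouple (fun z => (G z)%:E))//.
    by apply: eq_integral => w' _; rewrite Rint_EFin.
  by apply/measurable_EFinP; exact: bG.1.
have -> : F = (fun z => G z - M) by apply/funext => z; rewrite /G addrK.
have bM : bmeas (fun _ : Omega => M) by exact: bmeas_cst.
have e1 := Rint_B P bG1 bM; have e3 := Rint_B P bG3 bM.
transitivity (\int[P]_w' ((\int[P]_w G (X w, Y w')) - M)).
  by rewrite [LHS]e1 [RHS]e3 E.
apply: eq_Rintegral => w' _.
by have := Rint_B P (bG2 w') bM; rewrite Rintegral_prob_cst.
Qed.

(** Counterpart of [bmeas_decouple] for unbounded integrands: the noise is merely square integrable.
    Joint integrability is transported to the product law, so that Fubini applies. *)
Lemma decouple0 (F : T1 * T2 -> R) : measurable_fun setT F ->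
  P.-integrable setT (fun w => (F (X w, Y w))%:E) ->
  (forall y, \int[P]_w (F (X w, y))%:E = 0)%E ->
  (\int[P]_w (F (X w, Y w))%:E = 0)%E.
Proof.
move=> mF iF F0.
have mFE : measurable_fun setT (EFin \o F) by exact/measurable_EFinP.
transitivity (\int[pushforward P (fun w => (X w, Y w))]_z (F z)%:E)%E.
  by rewrite integral_pushforward.
have iF' : (mu1 \x mu2)%E.-integrable setT (EFin \o F).
  apply/integrableP; split => //.
  rewrite (_ : \int[_]_z _ =
    \int[pushforward P (fun w => (X w, Y w))]_z `|(F z)%:E|)%E; last first.
    by apply: eq_measure_integral => C mC _; exact: joint_law.
  rewrite ge0_integral_pushforward//; last exact: measurableT_comp.
  by move/integrableP : iF => [].
transitivity (\int[mu1 \x mu2]_z (F z)%:E)%E.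
  by apply: eq_measure_integral => C mC _; exact/esym/joint_law.
rewrite -integral21_prod_meas1// (_ : fubini_G _ _ = cst 0%E) ?integral0//.
apply/funext => y; rewrite /fubini_G/= -[RHS](F0 y).
have mFy : measurable_fun setT (fun x => (F (x, y))%:E).
  by apply: (measurableT_comp mFE); exact: measurable_pair2.
rewrite [LHS]integralE [RHS]integralE; congr (_ - _)%E.
  rewrite (@ge0_integral_distribution _ _ _ _ _ _ X')//; last exact: measurable_funepos.
  by apply: eq_integral => w _; rewrite /= !funeposE.
rewrite (@ge0_integral_distribution _ _ _ _ _ _ X')//; last exact: measurable_funeneg.
by apply: eq_integral => w _; rewrite /= !funenegE.
Qed.

End decoupling.

(** The measures [A |-> P (A]&[B)] and [A |-> P A * P B] agree on a pi-system containing the whole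
    space, hence on the sigma-algebra it generates. *)
Lemma indep_sigma_algebraW d (T : measurableType d) (R : realType)
    (P : probability T R) (G : set (set T)) (B : set T) :
  G `<=` measurable -> G setT -> setI_closed G -> measurable B ->
  (forall A, G A -> P (A `&` B) = P A * P B)%E ->
  forall A, <<s G >> A -> (P (A `&` B) = P A * P B)%E.
Proof.
move=> Gm GT GI mB GB A sA.
have PB0 : 0 <= fine (P B) by rewrite fine_ge0.
have fB : P B \is a fin_num by rewrite fin_num_measure.
pose k : {nonneg R} := NngNum PB0.
pose m1 := mrestr P mB; pose m2 := mscale k P.
have m2E C : m2 C = (P C * P B)%E by rewrite /m2/= /mscale/= fineK// muleC.
rewrite -m2E; apply: (@g_sigma_algebra_measure_unique _ R T G Gm (fun=> setT) _ _ m1 m2) => //.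
- by apply/seteqP; split => // x _; exists 0%N.
- by move=> C GC; rewrite [RHS]m2E -GB.
- move=> _; rewrite /= /mrestr setTI.
  by rewrite -ge0_fin_numE.
Qed.

Lemma indep_sigma_algebra d (T : measurableType d) (R : realType)
    (P : probability T R) (G H : set (set T)) :
  G `<=` measurable -> G setT -> setI_closed G ->
  H `<=` measurable -> H setT -> setI_closed H ->
  (forall A B, G A -> H B -> P (A `&` B) = P A * P B)%E ->
  forall A B, <<s G >> A -> <<s H >> B -> (P (A `&` B) = P A * P B)%E.
Proof.
move=> Gm GT GI Hm HT HI GH A B sA sB.
have mA : measurable A by have := smallest_sub (@sigma_algebra_measurable _ T) Gm; apply.
rewrite setIC muleC; apply: (indep_sigma_algebraW Hm) => // B' HB'.
rewrite setIC muleC; apply: (indep_sigma_algebraW Gm) => //; first exact: Hm.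
by move=> A' GA'; exact: GH.
Qed.

Section iid_pairs.
Context {dO : measure_display} {Omega : measurableType dO} {R : realType}.
Context (P : probability Omega R).
Context {d1 d2 : measure_display} {T1 : measurableType d1} {T2 : measurableType d2}.
Variables (X : nat -> {RV P >-> T1}) (e : nat -> {RV P >-> T2}).
Hypotheses (iidX : iid X) (iide : iid e) (XeI : independent_sequences X e).

(** Cylinders on finitely many indices: they are stable under intersection and their probabilities
    factor, so they generate all the independence statements about pairs. *)
Definition box_event (J : {fset nat}) (A : nat -> set T1) (B : nat -> set T2) :=
  [set w : Omega | forall i, i \in J -> A i (X i w) /\ B i (e i w)].

Let sigma_sequence_cap d' (T : measurableType d') (Z : nat -> {RV P >-> T})
    (J : {fset nat}) (A : nat -> set T) : (forall i, measurable (A i)) ->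
  sigma_sequence Z (\bigcap_(i in [set` J]) (Z i @^-1` A i)).
Proof.
move=> mA.
pose G := \bigcup_i preimage_set_system setT (Z i) measurable.
suff : measurable (\bigcap_(i in [set` J]) (Z i @^-1` A i) : set (g_sigma_algebraType G)) by [].
apply: fin_bigcap_measurable; first exact: finite_fset.
move=> i _; apply: sub_sigma_algebra; exists i => //.
by exists (A i) => //; rewrite setTI.
Qed.

Lemma box_event_prob J A B :
  (forall i, measurable (A i)) -> (forall i, measurable (B i)) ->
  (P (box_event J A B) =
   \prod_(i <- J) (P (X i @^-1` A i) * P (e i @^-1` B i)))%E.
Proof.
move=> mA mB.
rewrite (_ : box_event J A B = (\bigcap_(i in [set` J]) (X i @^-1` A i)) `&`
    (\bigcap_(i in [set` J]) (e i @^-1` B i))); last first.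
  apply/seteqP; split => [w h|w [h1 h2] i iJ].
    by split => i /= iJ; have [] := h i iJ.
  by split; [exact: h1|exact: h2].
rewrite XeI; [|exact: sigma_sequence_cap|exact: sigma_sequence_cap].
by rewrite iidX.1// iide.1// big_split.
Qed.

Let measurable_box J A B :
  (forall i, measurable (A i)) -> (forall i, measurable (B i)) ->
  measurable (box_event J A B).
Proof.
move=> mA mB.
rewrite (_ : box_event J A B = \bigcap_(i in [set` J])
  ((X i @^-1` A i) `&` (e i @^-1` B i))); last first.
  by apply/seteqP; split => [w h i|w h i] iJ; exact: h.
apply: fin_bigcap_measurable; first exact: finite_fset.
by move=> i _; apply: measurableI; exact: measurable_funPTI.
Qed.

Variable j : nat.

Definition other_boxes : set (set Omega) := [set E | exists J A B,
  [/\ j \notin J, forall i, measurable (A i), forall i, measurable (B i) &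
      E = box_event J A B]].

(* [Omega] with the sigma-algebra generated by the pairs [(X i, e i)], [i != j]:
   a function of these pairs is a measurable function on [otherT]. *)
Definition otherT := g_sigma_algebraType other_boxes.
HB.instance Definition _ := Measurable.on otherT.

Let own_boxes : set (set Omega) := [set E | exists A B,
  [/\ measurable A, measurable B & E = X j @^-1` A `&` e j @^-1` B]].

Let own_box A B : X j @^-1` A `&` e j @^-1` B =
  box_event [fset j]%fset (fun=> A) (fun=> B).
Proof.
apply/seteqP; split => [w [Aw Bw] i|w h].
  by rewrite inE => /eqP ->.
by apply: h; rewrite inE.
Qed.

Let other_boxesI : setI_closed other_boxes.
Proof.
move=> _ _ [J1 [A1 [B1 [j1 mA1 mB1 ->]]]] [J2 [A2 [B2 [j2 mA2 mB2 ->]]]].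
(* Padding with [setT] outside each index set lets both boxes live on the union of the two index
   sets. *)
pose A i := (if i \in J1 then A1 i else setT) `&` (if i \in J2 then A2 i else setT).
pose B i := (if i \in J1 then B1 i else setT) `&` (if i \in J2 then B2 i else setT).
exists (J1 `|` J2)%fset, A, B; split.
- by rewrite inE negb_or j1.
- by move=> i; apply: measurableI; case: ifP.
- by move=> i; apply: measurableI; case: ifP.
- apply/seteqP; split => [w [h1 h2] i|w h].
    rewrite /A /B inE => _; split; split; case: ifP => //.
    + by move/h1 => [].
    + by move/h2 => [].
    + by move/h1 => [].
    + by move/h2 => [].
  split => i iJ; have := h i; rewrite inE iJ ?orbT /A /B iJ => /(_ isT).
    by move=> [[? _] [? _]].
  by move=> [[_ ?] [_ ?]].
Qed.

Let other_boxesT : other_boxes setT.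
Proof.
exists fset0, (fun=> setT), (fun=> setT); split => //.
by apply/seteqP; split => // w _ i.
Qed.

Let other_boxes_measurable : other_boxes `<=` measurable.
Proof. by move=> _ [J [A [B [_ mA mB ->]]]]; exact: measurable_box. Qed.

Lemma measurable_to_other : measurable_fun setT (fun w : Omega => w : otherT).
Proof.
move=> _ A mA; rewrite setTI.
have := smallest_sub (@sigma_algebra_measurable _ Omega) other_boxes_measurable.
exact.
Qed.

Lemma measurable_other_X i : i != j ->
  measurable_fun setT (fun w : otherT => X i w).
Proof.
move=> ij _ A mA; rewrite setTI; apply: sub_sigma_algebra.
exists [fset i]%fset, (fun=> A), (fun=> setT); split => //.
  by rewrite inE eq_sym.
apply/seteqP; split => [w /= Aw k|w h]; first by rewrite inE => /eqP ->.
by have [] := h i; rewrite ?inE.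
Qed.

Lemma measurable_other_e i : i != j ->
  measurable_fun setT (fun w : otherT => e i w).
Proof.
move=> ij _ A mA; rewrite setTI; apply: sub_sigma_algebra.
exists [fset i]%fset, (fun=> setT), (fun=> A); split => //.
  by rewrite inE eq_sym.
apply/seteqP; split => [w /= Aw k|w h]; first by rewrite inE => /eqP ->.
by have [] := h i; rewrite ?inE.
Qed.

Let own_other A B : own_boxes A -> other_boxes B -> (P (A `&` B) = P A * P B)%E.
Proof.
move=> [A0 [B0 [mA0 mB0 ->]]] [J [A1 [B1 [jJ mA1 mB1 ->]]]].
pose A2 i := if i == j then A0 else A1 i.
pose B2 i := if i == j then B0 else B1 i.
have mA2 i : measurable (A2 i) by rewrite /A2; case: ifP.
have mB2 i : measurable (B2 i) by rewrite /B2; case: ifP.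
rewrite (_ : _ `&` box_event J A1 B1 = box_event (j |` J)%fset A2 B2); last first.
  apply/seteqP; split => [w [[h1 h2] h3] i|w h].
    rewrite /A2 /B2 !inE; case: eqVneq => [->//|ij /= iJ]; exact: h3.
  split.
    by have := h j; rewrite !inE eqxx /A2 /B2 eqxx => /(_ isT) [].
  move=> i iJ; have := h i; rewrite !inE iJ orbT => /(_ isT).
  by rewrite /A2 /B2; case: eqVneq iJ => // ->; rewrite (negbTE jJ).
rewrite own_box !box_event_prob// big_fsetU1//= big_seq_fset1 /A2 /B2 eqxx.
congr (_ * _)%E; apply: eq_big_seq => i iJ.
by case: eqVneq iJ => // ->; rewrite (negbTE jJ).
Qed.

(** A box at [j] and a box avoiding [j] intersect in a single box on the enlarged index set, so the
    product formula holds on two pi-systems and extends to the sigma-algebras. *)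
Lemma indep_pair_other :
  indep_rv P (fun w => (X j w, e j w)) (fun w : Omega => w : otherT).
Proof.
move=> C E mC mE.
apply: (@indep_sigma_algebra _ _ R P own_boxes other_boxes) => //.
- move=> _ [A [B [mA mB ->]]]; rewrite own_box; exact: measurable_box.
- by exists setT, setT; split => //; rewrite !preimage_setT setTI.
- move=> _ _ [A1 [B1 [mA1 mB1 ->]]] [A2 [B2 [mA2 mB2 ->]]].
  exists (A1 `&` A2), (B1 `&` B2); split; [exact: measurableI|exact: measurableI|].
  by rewrite setIACA.
(* Measurability of the pair for the sigma-algebra generated by the boxes at [j] places every
   preimage of a measurable set in that sigma-algebra. *)
have mown : measurable_fun setT
    (fun w : g_sigma_algebraType own_boxes => (X j w, e j w)).
  apply/measurable_fun_pairP; split => _ A mA; rewrite setTI;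
      apply: sub_sigma_algebra.
    by exists A, setT; split => //; rewrite preimage_setT setIT.
  by exists setT, A; split => //; rewrite preimage_setT setTI.
by rewrite -[X in <<s _ >> X]setTI; exact: mown.
Qed.

End iid_pairs.

Section iid_law.
Context {dO : measure_display} {Omega : measurableType dO} {R : realType}.
Context (P : probability Omega R).
Context {d1 d2 : measure_display} {T1 : measurableType d1} {T2 : measurableType d2}.
Variables (X : nat -> {RV P >-> T1}) (e : nat -> {RV P >-> T2}).
Hypotheses (iidX : iid X) (iide : iid e) (XeI : independent_sequences X e).

Lemma ge0_iid_law d' (T : measurableType d') (Z : nat -> {RV P >-> T})
    (k : T -> \bar R) j : iid Z -> measurable_fun setT k -> (forall x, 0 <= k x)%E ->
  (\int[P]_w k (Z j w) = \int[P]_w k (Z 0%N w))%E.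
Proof.
move=> [_ idZ] mk k0.
rewrite -(@ge0_integral_distribution _ _ _ _ _ _ (Z j) k)//.
rewrite -(@ge0_integral_distribution _ _ _ _ _ _ (Z 0%N) k)//.
by apply: eq_measure_integral => A mA _; exact: idZ.
Qed.

Lemma bmeas_ge0 d' (T : measurableType d') (k : T -> R) : bmeas k ->
  exists M : R, bmeas (fun x => k x + M) /\ forall x, 0 <= k x + M.
Proof.
move=> bk; have [M M0 kM] := bmeas_bound bk; exists M; split.
  by apply: bmeasD => //; exact: bmeas_cst.
by move=> x; rewrite -lerBlDr sub0r; have := kM x; rewrite ler_norml => /andP[].
Qed.

Lemma iid_law d' (T : measurableType d') (Z : nat -> {RV P >-> T})
    (k : T -> R) j : iid Z -> bmeas k ->
  \int[P]_w k (Z j w) = \int[P]_w k (Z 0%N w).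
Proof.
move=> iZ bk; have [M [bkM kM]] := bmeas_ge0 bk.
have bZ i : bmeas (fun w => k (Z i w)) by exact: (bmeas_comp bk).
have bZM i : bmeas (fun w => k (Z i w) + M) by exact: (bmeas_comp bkM).
have E i : \int[P]_w (k (Z i w) + M) = \int[P]_w k (Z i w) + M.
  by have := Rint_D P (bZ i) (bmeas_cst M); rewrite Rintegral_prob_cst.
apply: (@addIr _ M); rewrite -!E; apply: EFin_inj; rewrite !Rint_EFin//.
apply: (@ge0_iid_law _ _ Z (fun x => (k x + M)%:E)) => //.
by apply/measurable_EFinP; exact: bkM.1.
Qed.

Let sigma_sequence_preimage d' (T : measurableType d') (Z : nat -> {RV P >-> T})
  i A : measurable A -> sigma_sequence Z (Z i @^-1` A).
Proof.
move=> mA; apply: sub_sigma_algebra; exists i => //.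
by exists A => //; rewrite setTI.
Qed.

Lemma indep_X_e i j : indep_rv P (X i) (e j).
Proof. by move=> A B mA mB; apply: XeI; exact: sigma_sequence_preimage. Qed.

(** Independence of [X j] and [e j] reduces the joint law to the marginals, which are replaced one
    after the other. *)
Lemma pair_law j (k : T1 * T2 -> R) : bmeas k ->
  \int[P]_w k (X j w, e j w) = \int[P]_w k (X 0%N w, e 0%N w).
Proof.
move=> bk.
have bk1 y : bmeas (fun x => k (x, y)).
  by apply: bmeas_comp bk _; exact: measurable_pair2.
rewrite (bmeas_decouple _ _ (indep_X_e j j) bk)//.
rewrite (bmeas_decouple _ _ (indep_X_e 0%N 0%N) bk)//.
rewrite [LHS](_ : _ = \int[P]_w' \int[P]_w k (X 0%N w, e j w')); last first.
  by apply: eq_Rintegral => w' _; exact: (iid_law j iidX (bk1 _)).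
apply: (@iid_law _ _ e (fun y => \int[P]_w k (X 0%N w, y))) => //.
apply: (bmeas_fubini P (F := fun z => k (X 0%N z.2, z.1))).
apply: (bmeas_comp bk (phi := fun z => (X 0%N z.2, z.1))).
apply/measurable_fun_pairP; split; last exact: measurable_fst.
exact: (measurableT_comp (measurable_funP (X 0%N)) measurable_snd).
Qed.

(** The form in which independence is used later: the [j]-th pair is averaged as a fresh copy of the
    pair of index [0], everything else being frozen at [w']. The type [otherT X e j] enforces that
    the rest does not involve index [j]. *)
Lemma decouple_pair j (F : (T1 * T2) * otherT X e j -> R) : bmeas F ->
  \int[P]_w F ((X j w, e j w), w) =
  \int[P]_w' (\int[P]_w F ((X 0%N w, e 0%N w), w')).
Proof.
move=> bF.
rewrite (@bmeas_decouple _ _ R P _ _ (T1 * T2)%type (otherT X e j)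
  (fun w => (X j w, e j w)) (fun w => w) _ _ _ F)//.
- apply: eq_Rintegral => w' _.
  rewrite (@pair_law j (fun z => F (z, w')))//.
  by apply: bmeas_comp bF _; exact: measurable_pair2.
- by apply/measurable_fun_pairP.
- exact: measurable_to_other.
- exact: indep_pair_other.
Qed.

Lemma decouple_X j (F : T1 * otherT X e j -> R) : bmeas F ->
  \int[P]_w F (X j w, w) = \int[P]_w' (\int[P]_w F (X 0%N w, w')).
Proof.
move=> bF; apply: (@decouple_pair j (fun z => F (z.1.1, z.2))).
apply: (bmeas_comp bF (phi := fun z => (z.1.1, z.2))).
apply/measurable_fun_pairP; split; last exact: measurable_snd.
exact: (measurableT_comp measurable_fst measurable_fst).
Qed.

End iid_law.

(** * Moments of sums and of degenerate U-statistics *)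

Lemma bmeas_comp2 d1 d2 d (T1 : measurableType d1) (T2 : measurableType d2)
    (T : measurableType d) (R : realType) (k : T1 * T2 -> R)
    (f : T -> T1) (g : T -> T2) :
  bmeas k -> measurable_fun setT f -> measurable_fun setT g ->
  bmeas (fun w => k (f w, g w)).
Proof.
move=> bk mf mg; apply: (bmeas_comp bk (phi := fun w => (f w, g w))).
exact/measurable_fun_pairP.
Qed.

Lemma bmeas_fst d1 d2 (T1 : measurableType d1) (T2 : measurableType d2)
    (R : realType) (F : T1 -> R) : bmeas F -> bmeas (fun z : T1 * T2 => F z.1).
Proof. by move=> bF; apply: (bmeas_comp bF); exact: measurable_fst. Qed.

Lemma bmeas_snd d1 d2 (T1 : measurableType d1) (T2 : measurableType d2)
    (R : realType) (F : T2 -> R) : bmeas F -> bmeas (fun z : T1 * T2 => F z.2).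
Proof. by move=> bF; apply: (bmeas_comp bF); exact: measurable_snd. Qed.

Section moments.
Context {dO : measure_display} {Omega : measurableType dO} {R : realType}.
Context (P : probability Omega R).
Context {d1 d2 : measure_display} {T1 : measurableType d1} {T2 : measurableType d2}.
Variables (X : nat -> {RV P >-> T1}) (e : nat -> {RV P >-> T2}).
Hypotheses (iidX : iid X) (iide : iid e) (XeI : independent_sequences X e).

Let mXk d (T : measurableType d) (f : T -> Omega) i :
  measurable_fun setT f -> measurable_fun setT (fun w => X i (f w)).
Proof. by move=> mf; exact: (measurableT_comp (measurable_funP (X i)) mf). Qed.

Let other j := otherT X e j.

Let mto j : measurable_fun setT (fun w : Omega => w : other j).
Proof. exact: measurable_to_other. Qed.

Let bother j (U : other j -> R) : bmeas U -> bmeas (fun w : Omega => U w).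
Proof. by move=> bU; apply: bmeas_comp bU _; exact: measurable_to_other. Qed.

Lemma cross_moment0 j (F : T1 * other j -> R) : bmeas F ->
  (forall w', \int[P]_w F (X 0%N w, w') = 0) -> \int[P]_w F (X j w, w) = 0.
Proof.
move=> bF F0; rewrite (decouple_X iidX iide XeI bF).
by under eq_Rintegral do rewrite F0; rewrite Rintegral_prob_cst.
Qed.

Section one_step.
Variables (j : nat) (U : other j -> R) (Z : T1 * other j -> R) (tau B : R).
Hypotheses (bU : bmeas U) (bZ : bmeas Z).
Hypothesis Z0 : forall w', \int[P]_w Z (X 0%N w, w') = 0.
Hypothesis Z2 : forall w', \int[P]_w Z (X 0%N w, w') ^+ 2 <= tau.

Let bU1 : bmeas (fun z : T1 * other j => U z.2).
Proof. exact: bmeas_snd. Qed.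

Let bZw w' : bmeas (fun w => Z (X 0%N w, w')).
Proof. by apply: bmeas_comp2 bZ _ _ => //; exact: measurable_cst. Qed.

(** In the expanded square the cross term vanishes because [Z] is centered once the other variables
    are frozen. *)
Lemma moment2_step :
  \int[P]_w (U w + Z (X j w, w)) ^+ 2 <= \int[P]_w U w ^+ 2 + tau.
Proof.
have bF : bmeas (fun z : T1 * other j => (U z.2 + Z z) ^+ 2).
  by apply: bmeasX; apply: bmeasD.
rewrite [leLHS](decouple_X iidX iide XeI bF).
have bU2 : bmeas (fun w : Omega => U w ^+ 2) by apply: bmeasX; exact: bother.
have bF' : bmeas (fun w' : Omega => \int[P]_w (U w' + Z (X 0%N w, w')) ^+ 2).
  apply: (bmeas_fubini P (F := fun z : Omega * Omega => (U z.1 + Z (X 0%N z.2, z.1)) ^+ 2)).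
  apply: bmeasX; apply: bmeasD.
    exact: (@bmeas_fst _ _ Omega Omega R (fun w : Omega => U w) (bother bU)).
  apply: (bmeas_comp2 bZ (f := fun z : Omega * Omega => X 0%N z.2)
    (g := fun z : Omega * Omega => (z.1 : other j))).
    by apply: mXk; exact: measurable_snd.
  exact: (measurableT_comp (@mto j) measurable_fst).
rewrite -[tau](Rintegral_prob_cst P) -Rint_D//; last exact: bmeas_cst.
apply: Rint_le => //; first by apply: bmeasD => //; exact: bmeas_cst.
move=> w'.
have b1 : bmeas (fun w => U w' ^+ 2 + 2 * U w' * Z (X 0%N w, w')).
  apply: bmeasD; first exact: bmeas_cst.
  by apply: bmeasM => //; exact: bmeas_cst.
rewrite (_ : \int[P]_w _ = \int[P]_w ((U w' ^+ 2 + 2 * U w' * Z (X 0%N w, w')) +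
   Z (X 0%N w, w') ^+ 2)); last by apply: eq_Rintegral => w _; ring.
rewrite Rint_D//; last exact: bmeasX.
rewrite lerD// Rint_D//; [|exact: bmeas_cst|by apply: bmeasM => //; exact: bmeas_cst].
by rewrite Rintegral_prob_cst Rint_Zl// Z0 mulr0 addr0.
Qed.

Hypothesis ZB : forall z, `|Z z| <= B.

(** In the expansion of [(U + Z)^4] the term [4 U^3 Z] has mean zero, and
    [4 U Z^3 <= 2 U^2 Z^2 + 2 Z^4] turns the coefficients [6] and [1] into [8] and [3]; finally
    [Z^4 <= B^2 Z^2]. *)
Lemma moment4_step :
  \int[P]_w (U w + Z (X j w, w)) ^+ 4 <=
  \int[P]_w U w ^+ 4 + 8 * tau * \int[P]_w U w ^+ 2 + 3 * B ^+ 2 * tau.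
Proof.
have bF : bmeas (fun z : T1 * other j => (U z.2 + Z z) ^+ 4).
  by apply: bmeasX; apply: bmeasD.
rewrite [leLHS](decouple_X iidX iide XeI bF).
have bU2 : bmeas (fun w : Omega => U w ^+ 2) by apply: bmeasX; exact: bother.
have bU4 : bmeas (fun w : Omega => U w ^+ 4) by apply: bmeasX; exact: bother.
have bF' : bmeas (fun w' : Omega => \int[P]_w (U w' + Z (X 0%N w, w')) ^+ 4).
  apply: (bmeas_fubini P (F := fun z : Omega * Omega => (U z.1 + Z (X 0%N z.2, z.1)) ^+ 4)).
  apply: bmeasX; apply: bmeasD.
    exact: (@bmeas_fst _ _ Omega Omega R (fun w : Omega => U w) (bother bU)).
  apply: (bmeas_comp2 bZ (f := fun z : Omega * Omega => X 0%N z.2)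
    (g := fun z : Omega * Omega => (z.1 : other j))).
    by apply: mXk; exact: measurable_snd.
  exact: (measurableT_comp (@mto j) measurable_fst).
have bc c : bmeas (fun _ : Omega => c : R) by exact: bmeas_cst.
rewrite -[3 * _ * _](Rintegral_prob_cst P) -Rint_Zl// -Rint_D//; last exact: bmeasM.
rewrite -Rint_D//; last by apply: bmeasD => //; exact: bmeasM.
apply: Rint_le => //; first by apply: bmeasD => //; apply: bmeasD => //; exact: bmeasM.
move=> w' /=.
have b0 : bmeas (fun w => 4 * U w' ^+ 3 * Z (X 0%N w, w')) by exact: bmeasM.
have b1 : bmeas (fun w => U w' ^+ 4 + 4 * U w' ^+ 3 * Z (X 0%N w, w')).
  exact: bmeasD.
have b2 : bmeas (fun w => (8 * U w' ^+ 2 + 3 * B ^+ 2) * Z (X 0%N w, w') ^+ 2).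
  by apply: bmeasM => //; exact: bmeasX.
apply: (@le_trans _ _ (\int[P]_w ((U w' ^+ 4 + 4 * U w' ^+ 3 * Z (X 0%N w, w')) +
   (8 * U w' ^+ 2 + 3 * B ^+ 2) * Z (X 0%N w, w') ^+ 2))).
  apply: Rint_le.
  - by apply: bmeasX; exact: bmeasD.
  - exact: bmeasD.
  - move=> w; have := ZB (X 0%N w, w').
    set z := Z _; set u := U _ => zB.
    have B0 : 0 <= B by rewrite (le_trans _ zB).
    have zz : z ^+ 2 <= B ^+ 2.
      by rewrite -(real_normK (num_real z)) lerXn2r// nnegrE.
    have := sqr_ge0 (u * z - z ^+ 2).
    have : z ^+ 2 * z ^+ 2 <= B ^+ 2 * z ^+ 2 by rewrite ler_wpM2r// sqr_ge0.
    nra.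
rewrite Rint_D// Rint_D// Rintegral_prob_cst Rint_Zl// Z0 mulr0 addr0.
rewrite Rint_Zl//; last exact: bmeasX.
have := Z2 w'; have := sqr_ge0 (U w'); have := sqr_ge0 B.
set u := U w' ^+ 2; set I := \int[P]_w _ => B2 u2 I2.
nra.
Qed.

End one_step.

Section sums.
Variables (tau B : R).

Let bX j i : i != j -> measurable_fun setT (fun w : other j => X i w).
Proof. exact: measurable_other_X. Qed.

Lemma centered_sum_moment2 (xi : T1 -> R) n : bmeas xi ->
  \int[P]_w xi (X 0%N w) = 0 -> \int[P]_w xi (X 0%N w) ^+ 2 <= tau ->
  \int[P]_w (\sum_(i < n) xi (X i w)) ^+ 2 <= n%:R * tau.
Proof.
move=> bxi xi0 xi2; elim: n => [|n IH].
  under eq_Rintegral do rewrite big_ord0 expr0n/=.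
  by rewrite Rintegral_prob_cst mul0r.
under eq_Rintegral do rewrite big_ord_recr/=.
have bU : bmeas (fun w : other n => \sum_(i < n) xi (X i w)).
  apply: bmeas_sum => i _; apply: (bmeas_comp bxi); apply: bX.
  by rewrite neq_ltn ltn_ord.
have bZ : bmeas (fun z : T1 * other n => xi z.1).
  by apply: (bmeas_comp bxi); exact: measurable_fst.
apply: (le_trans (moment2_step bU bZ _ _ (tau := tau))) => //.
by rewrite -natr1 mulrDl mul1r lerD2r.
Qed.

Section kernel.
Variable Z : T1 * T1 -> R.
Hypotheses (bZ : bmeas Z) (Z0 : forall x, \int[P]_w Z (x, X 0%N w) = 0).
Hypothesis Z2 : forall x, \int[P]_w Z (x, X 0%N w) ^+ 2 <= tau.
Hypothesis ZB : forall z, `|Z z| <= B.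

Let S i n w := \sum_(j < n | (j : nat) != i) Z (X i w, X j w).

Let SS i n w : S i n.+1 w = S i n w + (if n != i then Z (X i w, X n w) else 0).
Proof. by rewrite /S big_mkcond big_ord_recr/= -big_mkcond. Qed.

Let bS i n : n != i -> bmeas (fun w : other n => S i n w).
Proof.
move=> ni; apply: bmeas_sum => j _; apply: (bmeas_comp2 bZ); apply: bX.
  by rewrite eq_sym.
by rewrite neq_ltn ltn_ord.
Qed.

Let bZo i n : n != i -> bmeas (fun z : T1 * other n => Z (X i z.2, z.1)).
Proof.
move=> ni; apply: (bmeas_comp2 bZ); last exact: measurable_fst.
by apply: (measurableT_comp (bX _) measurable_snd); rewrite eq_sym.
Qed.

Let tau0 : 0 <= tau.
Proof.
by apply: le_trans (Z2 (X 0%N point)); apply: Rintegral_ge0 => w _; exact: sqr_ge0.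
Qed.

Lemma kernel_sum_moment2 i n : \int[P]_w (S i n w) ^+ 2 <= n%:R * tau.
Proof.
elim: n => [|n IH].
  under eq_Rintegral do rewrite /S big_ord0 expr0n/=.
  by rewrite Rintegral_prob_cst mul0r.
under eq_Rintegral do rewrite SS.
rewrite -natr1 mulrDl mul1r; case: (boolP (n != i)) => ni; last first.
  under eq_Rintegral do rewrite addr0.
  by rewrite (le_trans IH)// lerDl.
apply: (le_trans (moment2_step (bS ni) (bZo ni) (fun w' => Z0 (X i w'))
  (fun w' => Z2 (X i w')))).
by rewrite lerD2r.
Qed.

(** Given [X i] the summands are independent and centered, so the growth is quadratic in [n]. In the
    induction [8 * tau * (n * tau)] is absorbed by the increment of [8 * (n * tau)^2]. *)
Lemma kernel_sum_moment4 i n :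
  \int[P]_w (S i n w) ^+ 4 <= 8 * (n%:R * tau) ^+ 2 + 3 * n%:R * B ^+ 2 * tau.
Proof.
elim: n => [|n IH].
  under eq_Rintegral do rewrite /S big_ord0 expr0n/=.
  by rewrite Rintegral_prob_cst !(mul0r, mulr0) expr0n/= mulr0 addr0.
under eq_Rintegral do rewrite SS.
have n0 : 0 <= n%:R :> R by [].
have B0 := sqr_ge0 B; have h0 := mulr_ge0 B0 tau0.
have h1 := mulr_ge0 tau0 tau0; have h2 := mulr_ge0 n0 h1.
rewrite -natr1; case: (boolP (n != i)) => ni; last first.
  under eq_Rintegral do rewrite addr0.
  by rewrite (le_trans IH)//; nra.
apply: (le_trans (moment4_step (bS ni) (bZo ni) (fun w' => Z0 (X i w'))
  (fun w' => Z2 (X i w')) (fun z => ZB _))).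
have S2 := kernel_sum_moment2 i n.
have := ler_wpM2l tau0 S2.
nra.
Qed.

Hypothesis Z0' : forall y, \int[P]_w Z (X 0%N w, y) = 0.

(** Adding the row of index [n] adds a variable that is centered when only [X n] is averaged
    ([Z0']), so rows are orthogonal; by [Z0] a row of length [k] has second moment at most
    [k * tau], and these sum to at most [n^2 * tau]. *)
Lemma degenerate_ustat_moment2 n :
  \int[P]_w (\sum_(i < n) \sum_(j < i) Z (X i w, X j w)) ^+ 2 <=
  n%:R ^+ 2 * tau.
Proof.
pose D n w := \sum_(i < n) \sum_(j < i) Z (X i w, X j w).
pose Tn n w := \sum_(j < n) Z (X n w, X j w).
have bD m : bmeas (fun w : other m => D m w).
  apply: bmeas_sum => i _; apply: bmeas_sum => j _.
  by apply: (bmeas_comp2 bZ); apply: bX; rewrite neq_ltn ?ltn_ord// (ltn_trans (ltn_ord j)).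
have bT m : bmeas (fun z : T1 * other m => \sum_(j < m) Z (z.1, X j z.2)).
  apply: bmeas_sum => j _; apply: (bmeas_comp2 bZ); first exact: measurable_fst.
  by apply: (measurableT_comp (bX _) measurable_snd); rewrite neq_ltn ltn_ord.
have bDO m : bmeas (fun w => D m w) by exact: bother.
have bTO m : bmeas (fun w => Tn m w).
  by apply: bmeas_sum => j _; exact: (bmeas_comp2 bZ).
rewrite -/(D n _); elim: n => [|n IH].
  under eq_Rintegral do rewrite /D big_ord0 expr0n/=.
  by rewrite Rintegral_prob_cst expr0n mul0r.
have DS w : D n.+1 w = D n w + Tn n w by rewrite /D big_ord_recr.
rewrite (_ : \int[P]_w _ = \int[P]_w (D n w ^+ 2 + 2 * (D n w * Tn n w) + Tn n w ^+ 2)); last first.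
  by apply: eq_Rintegral => w _; rewrite -/(D n.+1 w) DS; ring.
have bc c : bmeas (fun _ : Omega => c : R) by exact: bmeas_cst.
have b1 : bmeas (fun w => D n w * Tn n w) by exact: bmeasM.
rewrite Rint_D; [|by apply: bmeasD; [exact: bmeasX|exact: bmeasM]|exact: bmeasX].
rewrite Rint_D; [|exact: bmeasX|exact: bmeasM].
rewrite Rint_Zl// (_ : \int[P]_w (D n w * Tn n w) = 0).
  have Tn2 : \int[P]_w Tn n w ^+ 2 <= n%:R * tau.
    apply: le_trans (kernel_sum_moment2 n n).
    rewrite le_eqVlt; apply/orP; left; apply/eqP; apply: eq_Rintegral => w _.
    by congr (_ ^+ 2); apply: eq_bigl => j; rewrite neq_ltn ltn_ord.
  have n0 : 0 <= n%:R :> R by [].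
  have h1 := mulr_ge0 n0 tau0.
  rewrite mulr0 addr0 (le_trans (lerD IH Tn2))// -natr1.
  have t0 := tau0; nra.
have bF : bmeas (fun z : T1 * other n => D n z.2 * \sum_(j < n) Z (z.1, X j z.2)).
  by apply: bmeasM => //; apply: (bmeas_comp (bD n)); exact: measurable_snd.
apply: (cross_moment0 bF) => w' /=.
rewrite Rint_Zl.
  rewrite Rint_sum; first by rewrite big1 ?mulr0// => j _; exact: Z0'.
  by move=> j _; apply: (bmeas_comp2 bZ) => //; exact: measurable_cst.
apply: bmeas_sum => j _.
by apply: (bmeas_comp2 bZ) => //; exact: measurable_cst.
Qed.

End kernel.
End sums.
End moments.

(** * The standard normal law *)

Section standard_normal.
Context {R : realType}.
Local Notation lam := (@lebesgue_measure R).

Definition stdpdf (t : R) : R := normal_pdf 0 1 t.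

Lemma stdpdfE t : stdpdf t = normal_peak 1 * expR (- (t ^+ 2 / 2)).
Proof.
rewrite /stdpdf normal_pdfE// /normal_fun subr0 expr1n mulNr.
by rewrite -mulr_natr mul1r.
Qed.

Lemma stdpdf_ge0 t : 0 <= stdpdf t. Proof. exact: normal_pdf_ge0. Qed.

Lemma measurable_stdpdf : measurable_fun setT stdpdf.
Proof. exact: measurable_normal_pdf. Qed.

Let idR : measurableTypeR R -> R := idfun.
#[local] HB.instance Definition _ :=
  @isMeasurableFun.Build _ _ _ _ idR (@measurable_id _ _ setT).

(** The witness is the image of [normal_prob 0 1] under the identity between the two measurable
    structures; only its integration formula is kept visible. *)
Let ex_stdnormal : {stdnormal : probability R R | forall F : R -> \bar R,
  measurable_fun setT F -> (forall t, 0 <= F t)%E ->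
  (\int[stdnormal]_t F t = \int[lam]_t (F t * (stdpdf t)%:E))%E}.
Proof.
exists (distribution (normal_prob (0 : R) 1) (idR : {mfun measurableTypeR R >-> R})).
move=> F mF F0.
rewrite (@ge0_integral_distribution _ _ _ _ _ _ (idR : {mfun measurableTypeR R >-> R}))//.
apply: (@ge0_integral_density _ (measurableTypeR R) R lam) => //.
- exact: measurable_stdpdf.
- exact: stdpdf_ge0.
Qed.

(* [normal_prob 0 1] is a law on [measurableTypeR R]; this is the same law on [R]
   with its canonical measurable structure. *)
Definition stdnormal : probability R R := sval ex_stdnormal.

Lemma stdnormalE (F : R -> \bar R) : measurable_fun setT F -> (forall t, 0 <= F t)%E ->
  (\int[stdnormal]_t F t = \int[lam]_t (F t * (stdpdf t)%:E))%E.
Proof. exact: (svalP ex_stdnormal). Qed.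

Lemma normal_prob_stdnormal (s : R) (F : R -> \bar R) : 0 < s ->
  measurable_fun setT F -> (forall t, 0 <= F t)%E ->
  (\int[normal_prob 0 s]_x F x = \int[stdnormal]_t F (s * t)%R)%E.
Proof.
move=> s0 mF F0.
rewrite (@ge0_integral_density _ (measurableTypeR R) R lam _ (normal_pdf 0 s))//.
- have mFs : measurable_fun setT (fun t : R => F (s * t)).
    by apply: (measurableT_comp mF); apply: measurable_funM.
  have -> := stdnormalE mFs (fun t => F0 (s * t)).
  have <- := @lebesgue_integral_affine R 0 s (fun x => F x * (normal_pdf 0 s x)%:E)%E s0; last 2 first.
  + apply: emeasurable_funM => //.
    by apply/measurable_EFinP; exact: measurable_normal_pdf.
  + by move=> x; rewrite mule_ge0// lee_fin normal_pdf_ge0.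
  rewrite -ge0_integralZl//; last 3 first.
  + apply: emeasurable_funM; first by under eq_fun do rewrite add0r.
    apply/measurable_EFinP; apply: (measurableT_comp (@measurable_normal_pdf R 0 s)).
    by apply: measurable_funD => //; apply: measurable_funM.
  + by move=> x _; rewrite mule_ge0// lee_fin normal_pdf_ge0.
  + by rewrite lee_fin ltW.
  apply: eq_integral => t _; rewrite add0r muleCA -EFinM; congr (_ * _%:E)%E.
  have s1 : s != 0 by rewrite gt_eqF.
  rewrite stdpdfE normal_pdfE// mulrA /normal_fun; congr (_ * expR _).
    rewrite /normal_peak expr1n mul1r -mulrnAr sqrtrM ?sqr_ge0//.
    by rewrite sqrtr_sqr gtr0_norm// invfM mulrA divff// mul1r.
  by rewrite subr0 -mulr_natr; field.
- exact: measurable_normal_pdf.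
- by move=> x; exact: normal_pdf_ge0.
Qed.

Lemma stdnormal_integral_le (F : R -> \bar R) b : 0 < b ->
  measurable_fun setT F -> (forall t, 0 <= F t)%E ->
  (b%:E * \int[lam]_t (F t * (stdpdf (b * t))%:E) = \int[stdnormal]_t F (b^-1 * t)%R)%E.
Proof.
move=> b0 mF F0.
have mFs : measurable_fun setT (fun t : R => F (b^-1 * t)).
  by apply: (measurableT_comp mF); apply: measurable_funM.
have -> := stdnormalE mFs (fun t => F0 (b^-1 * t)).
have <- := @lebesgue_integral_affine R 0 b (fun x => F (b^-1 * x)%R * (stdpdf x)%:E)%E b0; last 2 first.
+ by apply: emeasurable_funM => //; apply/measurable_EFinP; exact: measurable_stdpdf.
+ by move=> x; rewrite mule_ge0// lee_fin stdpdf_ge0.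
apply: (congr1 (fun z => b%:E * z)%E); apply: eq_integral => t _.
by rewrite add0r mulKf// gt_eqF.
Qed.

Lemma integral_stdpdfZ b : 0 < b -> (\int[lam]_t (stdpdf (b * t))%:E = (b^-1)%:E)%E.
Proof.
move=> b0; have := @stdnormal_integral_le (cst 1%E) b b0 (@measurable_cst _ _ _ _ _ _) (fun=> lee01).
under eq_integral do rewrite mul1e.
rewrite /= integral_cst//= probability_setT mul1e => h.
have : ((b^-1)%:E * (b%:E * \int[lam]_t (stdpdf (b * t))%:E) = (b^-1)%:E)%E.
  by rewrite h mule1.
by rewrite muleA -EFinM mulVf ?gt_eqF// mul1e.
Qed.

Lemma integrable_stdpdfZ b : 0 < b -> lam.-integrable setT (fun t => (stdpdf (b * t))%:E).
Proof.
move=> b0; apply/integrableP; split.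
  apply/measurable_EFinP; apply: (measurableT_comp measurable_stdpdf).
  exact: measurable_funM.
under eq_integral do rewrite gee0_abs ?lee_fin ?stdpdf_ge0//.
by rewrite integral_stdpdfZ// ltry.
Qed.

(* [stdpdf (b * t)] integrates to [b^-1]; its difference quotient in [b] at [1] tends
   to [t ^+ 2 * stdpdf t]. *)
Lemma stdnormal_moment2 : (\int[stdnormal]_t (t ^+ 2)%:E = 1)%E.
Proof.
rewrite stdnormalE; last 2 first.
- by apply/measurable_EFinP; exact: measurable_funX.
- by move=> t; rewrite lee_fin sqr_ge0.
pose del n : R := n.+1%:R^-1.
have del0 n : 0 < del n by rewrite invr_gt0.
(* This is [((1 + del n)^2 - 1) / 2], so that [stdpdf ((1 + del n) * t)] is
   [stdpdf t * expR (- (eps n * t ^+ 2))]. *)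
pose eps n : R := (2 * del n + del n ^+ 2) / 2.
have eps0 n : 0 < eps n by rewrite divr_gt0// addr_gt0// ?mulr_gt0// exprn_gt0.
pose hn n (t : R) := (stdpdf t - stdpdf ((1 + del n) * t)) / eps n.
have hnE n t : hn n t = (stdpdf t) * ((1 - expR (- (eps n * t ^+ 2))) / eps n).
  rewrite /hn mulrA; congr (_ / _).
  rewrite !stdpdfE mulrBr mulr1; congr (_ - _).
  rewrite -[RHS]mulrA -expRD; congr (_ * expR _).
  by rewrite /eps; field.
(* Applied at [z = eps n * t ^+ 2], these bounds squeeze the difference quotient between two
   functions with the same limit. *)
have ineq (z : R) : z * expR (- z) <= 1 - expR (- z) /\ 1 - expR (- z) <= z.
  split.
    have := expR_ge1Dx z; have := expR_gt0 (- z).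
    have : expR z * expR (- z) = 1 by rewrite -expRD subrr expR0.
    by set a := expR z; set b := expR (- z) => h1 h2 h3; nra.
  have := expR_ge1Dx (- z); lra.
have hn0 n t : 0 <= hn n t.
  rewrite hnE mulr_ge0 ?stdpdf_ge0// divr_ge0 ?(ltW (eps0 n))// subr_ge0.
  by rewrite -expR0 ler_expR oppr_le0 mulr_ge0 ?sqr_ge0// ltW.
have hnle n t : hn n t <= stdpdf t * t ^+ 2.
  rewrite hnE ler_wpM2l ?stdpdf_ge0// ler_pdivrMr// [leRHS]mulrC.
  by have [_] := ineq (eps n * t ^+ 2).
have hnge n t : stdpdf t * (t ^+ 2 * expR (- (eps n * t ^+ 2))) <= hn n t.
  rewrite hnE ler_wpM2l ?stdpdf_ge0// ler_pdivlMr// [leLHS]mulrC mulrA.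
  by have [] := ineq (eps n * t ^+ 2).
have del_cvg : del @ \oo --> (0 : R) by exact: cvg_harmonic.
have eps_cvg : eps @ \oo --> (0 : R).
  rewrite (_ : 0 = (2 * 0 + 0 ^+ 2) / 2 :> R); last by rewrite expr0n mulr0 addr0 mul0r.
  apply: cvgMr_tmp; apply: cvgD; first by apply: cvgMl_tmp.
  by rewrite expr2; apply: cvgM.
have hn_cvg t : hn n t @[n --> \oo] --> stdpdf t * t ^+ 2.
  apply: (squeeze_cvgr (f := fun n => stdpdf t * (t ^+ 2 * expR (- (eps n * t ^+ 2))))
    (h := fun=> stdpdf t * t ^+ 2)).
  - by apply: nearW => n; rewrite hnge hnle.
  - rewrite -[X in _ --> X](_ : stdpdf t * (t ^+ 2 * 1) = _); last by rewrite mulr1.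
    apply: cvgMl_tmp; apply: cvgMl_tmp.
    rewrite -expR0 -oppr0 -[in X in _ --> X](mul0r (t ^+ 2)).
    apply: (@cvg_comp _ _ _ (fun n => - (eps n * t ^+ 2)) expR); last exact: continuous_expR.
    by apply: cvgN; apply: cvgMr_tmp.
  - exact: cvg_cst.
(* From [1 + y <= expR y] at [y = 3/8 t^2] one gets [t^2 <= 8/3 expR y]; the exponent
   [1/8 = 1/2 - 3/8] that is left is that of [stdpdf (t / 2)]. *)
have dom t : stdpdf t * t ^+ 2 <= 8 / 3 * stdpdf (2^-1 * t).
  rewrite !stdpdfE -[leLHS]mulrA [leRHS]mulrCA ler_wpM2l ?normal_peak_ge0//.
  have -> : expR (- (t ^+ 2 / 2)) = expR (- (3 / 8 * t ^+ 2)) * expR (- ((2^-1 * t) ^+ 2 / 2)).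
    by rewrite -expRD; congr expR; field.
  rewrite mulrAC ler_wpM2r ?expR_ge0//.
  have := expR_ge1Dx (3 / 8 * t ^+ 2).
  have : expR (3 / 8 * t ^+ 2) * expR (- (3 / 8 * t ^+ 2)) = 1 by rewrite -expRD subrr expR0.
  have := expR_gt0 (- (3 / 8 * t ^+ 2)); have := sqr_ge0 t.
  set a := expR _; set b := expR _; set y := t ^+ 2 => h0 h1 h2 h3; nra.
have mphi : measurable_fun setT stdpdf := measurable_stdpdf.
have mphiZ c : measurable_fun setT (fun t : R => stdpdf (c * t)).
  by apply: (measurableT_comp mphi); apply: measurable_funM.
(* This is [(1 - (1 + del)^-1) / eps] with [eps = del * (2 + del) / 2]. *)
have I n : (\int[lam]_t (hn n t)%:E = (((2 + del n) * (1 + del n) / 2)^-1)%:E)%E.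
  have d1 : 0 < 1 + del n by rewrite addr_gt0.
  have i1 : lam.-integrable setT (EFin \o stdpdf).
    by have := integrable_stdpdfZ (b := 1) ltr01; under eq_fun do rewrite mul1r.
  under eq_integral do rewrite /hn mulrC EFinM.
  rewrite ge0_integralZl//; last 3 first.
  + apply/measurable_EFinP; apply: measurable_funB; [exact: mphi|exact: mphiZ].
  + move=> t _; have := mulr_ge0 (hn0 n t) (ltW (eps0 n)).
    by rewrite /hn divfK ?gt_eqF// lee_fin.
  + by rewrite lee_fin invr_ge0 ltW.
  under eq_integral do rewrite EFinB.
  rewrite integralB//; last exact: integrable_stdpdfZ.
  have -> : (\int[lam]_t (stdpdf t)%:E = 1)%E.
    by have := integral_stdpdfZ (b := 1) ltr01; rewrite invr1; under eq_integral do rewrite mul1r.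
  rewrite integral_stdpdfZ// -EFinB -EFinM; congr EFin.
  by rewrite /eps; field; rewrite !gt_eqF//=; have := del0 n; nra.
have C1 : (\int[lam]_t (hn n t)%:E)%E @[n --> \oo] --> (\int[lam]_t (stdpdf t * t ^+ 2)%:E)%E.
  apply: (@dominated_cvg _ _ _ lam setT measurableT (fun n t => (hn n t)%:E)
    (fun t => (stdpdf t * t ^+ 2)%:E) (fun t => (8 / 3 * stdpdf (2^-1 * t))%:E)) => //.
  + move=> n; apply/measurable_EFinP; rewrite /hn; apply: measurable_funM => //.
    by apply: measurable_funB; [exact: mphi|exact: mphiZ].
  + move=> t _; apply: cvg_EFin; last exact: hn_cvg.
    by apply: nearW.
  + under eq_fun do rewrite EFinM.
    by apply: integrableZl => //; exact: integrable_stdpdfZ.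
  + by move=> n t _; rewrite gee0_abs ?lee_fin// (le_trans (hnle n t)).
have C2 : (\int[lam]_t (hn n t)%:E)%E @[n --> \oo] --> (1 : \bar R)%E.
  under eq_fun do rewrite I.
  apply: cvg_EFin; first exact: nearW.
  rewrite -[X in _ --> X]invr1; apply: cvgV; first exact: oner_neq0.
  rewrite [X in _ --> X](_ : _ = (2 + 0) * (1 + 0) / 2); last by rewrite !addr0 mulr1 divff.
  apply: cvgMr_tmp; apply: cvgM; apply: cvgD => //; exact: cvg_cst.
rewrite -(cvg_unique _ C1 C2)//; apply: eq_integral => t _.
by rewrite -EFinM mulrC.
Qed.

End standard_normal.

Section stdnormal_semigroup.
Context {R : realType}.
Local Notation lam := (@lebesgue_measure R).
Local Notation stdnormal := (@stdnormal R).

Let mlin (a b : R) : measurable_fun setT (fun t : R => a + b * t).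
Proof. by apply: measurable_funD => //; apply: measurable_funM. Qed.

Let phi_sq (x y : R) : x ^+ 2 = y ^+ 2 -> stdpdf x = stdpdf y.
Proof. by move=> xy; rewrite !stdpdfE xy. Qed.

Let phiM (x y z t : R) : x ^+ 2 + y ^+ 2 = z ^+ 2 + t ^+ 2 ->
  stdpdf x * stdpdf y = stdpdf z * stdpdf t.
Proof.
move=> e; rewrite !stdpdfE mulrACA -expRD [RHS]mulrACA -expRD; congr (_ * expR _).
by rewrite -!opprD -!mulrDl e.
Qed.

Let int_phi_affine (m k : R) : 0 < k ->
  (\int[lam]_s (stdpdf (m + k * s))%:E = (k^-1)%:E)%E.
Proof.
move=> k0.
have mphiE : measurable_fun setT (fun x : R => (stdpdf x)%:E).
  by apply/measurable_EFinP; exact: measurable_stdpdf.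
have h := @lebesgue_integral_affine R m k (fun x => (stdpdf x)%:E) k0 mphiE
  (fun x => ltac:(by rewrite lee_fin stdpdf_ge0)).
have := integral_stdpdfZ (R := R) ltr01; rewrite invr1.
under eq_integral do rewrite mul1r.
move=> h1; rewrite h1 in h.
have : ((k^-1)%:E * (k%:E * \int[lam]_s (stdpdf (m + k * s))%:E) = (k^-1)%:E)%E.
  by rewrite h mule1.
by rewrite muleA -EFinM mulVf ?gt_eqF// mul1e.
Qed.

(* Completes the square: with [z = a * s + b * t] fixed, the product density in
   [(s, t)] becomes a density in [z / c] times an affine Gaussian in [s]. *)
Let rotation (a b c s z : R) : c ^+ 2 = a ^+ 2 + b ^+ 2 -> b != 0 -> c != 0 ->
  s ^+ 2 + ((z - a * s) / b) ^+ 2 =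
  (z / c) ^+ 2 + (- (a * z / (b * c)) + c / b * s) ^+ 2.
Proof.
move=> cab b0 c0; apply/eqP; rewrite -subr_eq0; apply/eqP.
transitivity ((c ^+ 2 - (a ^+ 2 + b ^+ 2)) * (z ^+ 2 - c ^+ 2 * s ^+ 2) / (b ^+ 2 * c ^+ 2)).
  by field; rewrite b0 c0.
by rewrite cab subrr !mul0r.
Qed.

(** The inner integral is rewritten in [z = a * s + b * t], Tonelli exchanges the order, and
    [rotation] lets [s] be integrated out. *)
Lemma stdnormal_semigroup_ge0 (a b c : R) (F : R -> \bar R) :
  0 <= a -> 0 <= b -> 0 <= c -> c ^+ 2 = a ^+ 2 + b ^+ 2 ->
  measurable_fun setT F -> (forall t, 0 <= F t)%E ->
  (\int[stdnormal]_s \int[stdnormal]_t F (a * s + b * t)%R = \int[stdnormal]_z F (c * z)%R)%E.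
Proof.
move=> a0 b0 c0 cab mF F0.
(* The substitution in [t] divides by [b]; for [b = 0] the inner integrand does not depend on [t]
   and [c = a]. *)
have [b00|bn0] := eqVneq b 0.
  have ca : c = a.
    by apply/eqP; rewrite -(eqrXn2 (n := 2))// cab b00 expr0n addr0.
  rewrite ca; apply: eq_integral => s _.
  transitivity (\int[stdnormal]_t (cst (F (a * s)%R) t))%E.
    by apply: eq_integral => t _; rewrite b00 mul0r addr0.
  by rewrite integral_cst// [X in (_ * X)%E](@probability_setT _ _ _ stdnormal) mule1.
have bp : 0 < b by rewrite lt_neqAle eq_sym bn0.
have cp : 0 < c.
  rewrite lt_neqAle eq_sym c0 andbT; apply/eqP => c00.
  move: cab; rewrite c00 expr0n/= => /esym/eqP.
  by rewrite paddr_eq0 ?sqr_ge0// !sqrf_eq0 (negbTE bn0) andbF.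
have cn0 : c != 0 by rewrite gt_eqF.
have mphiE g : measurable_fun setT g -> measurable_fun setT (fun x : R => (stdpdf (g x))%:E).
  move=> mg; apply/measurable_EFinP.
  exact: (measurableT_comp measurable_stdpdf mg).
have mphiE2 (g : R * R -> R) : measurable_fun setT g -> measurable_fun setT (fun x => (stdpdf (g x))%:E).
  move=> mg; apply/measurable_EFinP.
  exact: (measurableT_comp measurable_stdpdf mg).
have phi0 x : (0 <= (@stdpdf R x)%:E)%E by rewrite lee_fin stdpdf_ge0.
have mG s : measurable_fun setT (fun z => (F z * (stdpdf ((z - a * s) / b))%:E)%E).
  apply: emeasurable_funM => //; apply: mphiE.
  by apply: measurable_funM => //; apply: measurable_funB.
have inner s : (\int[stdnormal]_t F (a * s + b * t)%R =
    \int[lam]_z ((b^-1)%:E * (F z * (stdpdf ((z - a * s) / b))%:E)))%E.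
  have mFs : measurable_fun setT (fun t => F (a * s + b * t)).
    exact: (measurableT_comp mF (mlin _ _)).
  rewrite ge0_integralZl//; last 3 first.
  - exact: mG.
  - by move=> z _; rewrite mule_ge0.
  - by rewrite lee_fin invr_ge0.
  have <- := @lebesgue_integral_affine R (a * s) b _ bp (mG s)
    (fun z => mule_ge0 (F0 z) (phi0 _)).
  rewrite muleA -EFinM mulVf// mul1e.
  have -> := stdnormalE mFs (fun t => F0 (a * s + b * t)).
  by apply: eq_integral => t _; rewrite addrAC subrr add0r [_ / b]mulrC mulKf.
have mF2 : measurable_fun setT (fun z : R * R => F z.2).
  exact: (measurableT_comp mF measurable_snd).
have mK : measurable_fun setT
   (fun z : R * R => ((b^-1)%:E * (F z.2 * (stdpdf ((z.2 - a * z.1) / b))%:E) * (stdpdf z.1)%:E)%E).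
  apply: emeasurable_funM; last by apply: mphiE2; exact: measurable_fst.
  apply: emeasurable_funM; first exact: measurable_cst.
  apply: emeasurable_funM; first exact: mF2.
  apply: mphiE2; apply: measurable_funM; last exact: measurable_cst.
  apply: measurable_funB; first exact: measurable_snd.
  by apply: measurable_funM; [exact: measurable_cst|exact: measurable_fst].
have K0 (z : R * R) : (0 <= (b^-1)%:E * (F z.2 * (stdpdf ((z.2 - a * z.1) / b))%:E) * (stdpdf z.1)%:E)%E.
  by rewrite !mule_ge0// lee_fin invr_ge0.
transitivity (\int[lam]_s \int[lam]_z
   ((b^-1)%:E * (F z * (stdpdf ((z - a * s) / b))%:E) * (stdpdf s)%:E))%E.
  have mI : measurable_fun setT (fun s => \int[stdnormal]_t F (a * s + b * t)%R)%E.
    apply: (@measurable_fun_fubini_tonelli_F _ _ R R R stdnormal (fun z => F (a * z.1 + b * z.2))) => //.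
    apply: (measurableT_comp mF); apply: measurable_funD; apply: measurable_funM => //.
  have -> := stdnormalE mI (fun s => ltac:(by apply: integral_ge0)).
  apply: eq_integral => s _; rewrite inner -ge0_integralZr//.
  - by apply: emeasurable_funM; [exact: measurable_cst|exact: mG].
  - by move=> z _; rewrite !mule_ge0// lee_fin invr_ge0.
have -> := @fubini_tonelli _ _ _ _ R lam lam (fun z : R * R => ((b^-1)%:E * (F z.2 * (stdpdf ((z.2 - a * z.1) / b))%:E) * (stdpdf z.1)%:E)%E) mK K0.
transitivity (\int[lam]_z ((c^-1)%:E * (F z * (stdpdf (z / c))%:E)))%E.
  apply: eq_integral => z _ /=.
  under eq_integral => s _.
    rewrite -muleA -muleA -EFinM mulrC.
    rewrite (@phiM s ((z - a * s) / b) (z / c) (- (a * z / (b * c)) + c / b * s)); last first.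
      exact: rotation.
    rewrite EFinM muleA muleA.
    over.
  rewrite ge0_integralZl//.
  - rewrite int_phi_affine ?divr_gt0// invf_div.
    rewrite -!muleA (muleC (stdpdf _)%:E) (muleCA (F z)) [LHS]muleA -EFinM.
    by rewrite mulrA mulVf// mul1r.
  - by apply: mphiE; exact: mlin.
  - by rewrite !mule_ge0// lee_fin invr_ge0.
have mFc : measurable_fun setT (fun z => F (c * z)).
  by apply: (measurableT_comp mF); apply: measurable_funM.
have -> := stdnormalE mFc (fun z => F0 (c * z)).
have mH : measurable_fun setT (fun z => (F z * (stdpdf (z / c))%:E)%E).
  by apply: emeasurable_funM => //; apply: mphiE; apply: measurable_funM.
rewrite ge0_integralZl//; last 2 first.
- by move=> z _; rewrite mule_ge0.
- by rewrite lee_fin invr_ge0.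
have <- := @lebesgue_integral_affine R 0 c _ cp mH (fun z => mule_ge0 (F0 z) (phi0 _)).
rewrite muleA -EFinM mulVf// mul1e; apply: eq_integral => z _.
by rewrite add0r [X in stdpdf X]mulrC mulKf.
Qed.

Lemma stdnormal_semigroup (a b c : R) (u : R -> R) :
  0 <= a -> 0 <= b -> 0 <= c -> c ^+ 2 = a ^+ 2 + b ^+ 2 -> bmeas u ->
  \int[stdnormal]_s (\int[stdnormal]_t u (a * s + b * t)) = \int[stdnormal]_z u (c * z).
Proof.
move=> a0 b0 c0 cab bu; have [M [buM uM]] := bmeas_ge0 bu.
have mM (k : R) : measurable_fun setT (fun t : R => k * t) by apply: measurable_funM.
have b1 s : bmeas (fun t => u (a * s + b * t) + M) by apply: (bmeas_comp buM); exact: mlin.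
have b1' s : bmeas (fun t => u (a * s + b * t)) by apply: (bmeas_comp bu); exact: mlin.
have b2 : bmeas (fun z => u (c * z) + M) by apply: (bmeas_comp buM).
have b2' : bmeas (fun z => u (c * z)) by apply: (bmeas_comp bu).
have m2 : measurable_fun setT (fun z : R * R => a * z.1 + b * z.2).
  by apply: measurable_funD; apply: measurable_funM.
have b3 : bmeas (fun s => \int[stdnormal]_t (u (a * s + b * t) + M)).
  apply: (bmeas_fubini stdnormal (F := fun z : R * R => u (a * z.1 + b * z.2) + M)).
  exact: (bmeas_comp buM m2).
have b3' : bmeas (fun s => \int[stdnormal]_t u (a * s + b * t)).
  apply: (bmeas_fubini stdnormal (F := fun z : R * R => u (a * z.1 + b * z.2))).
  exact: (bmeas_comp bu m2).
have bM : bmeas (fun _ : R => M) by exact: bmeas_cst.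
have E : \int[stdnormal]_s (\int[stdnormal]_t (u (a * s + b * t) + M)) = \int[stdnormal]_z (u (c * z) + M).
  apply: EFin_inj; rewrite !Rint_EFin//.
  have mu : measurable_fun setT (fun x => (u x + M)%:E).
    by apply/measurable_EFinP; exact: buM.1.
  rewrite -(stdnormal_semigroup_ge0 a0 b0 c0 cab mu)//.
  by apply: eq_integral => s _; rewrite Rint_EFin.
apply: (@addIr _ M).
have <- : \int[stdnormal]_z (u (c * z) + M) = \int[stdnormal]_z u (c * z) + M.
  by have := Rint_D stdnormal b2' bM; rewrite Rintegral_prob_cst.
rewrite -E; have := Rint_D stdnormal b3' bM; rewrite Rintegral_prob_cst => <-.
apply: eq_Rintegral => s _.
by have := Rint_D stdnormal (b1' s) bM; rewrite Rintegral_prob_cst => <-.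
Qed.

Lemma stdnormalN (F : R -> \bar R) : measurable_fun setT F -> (forall t, 0 <= F t)%E ->
  (\int[stdnormal]_t F (- t)%R = \int[stdnormal]_t F t)%E.
Proof.
move=> mF F0.
have mFN : measurable_fun setT (fun t : R => F (- t)) by exact: (measurableT_comp mF).
have -> := stdnormalE mFN (fun t => F0 (- t)).
have -> := stdnormalE mF F0.
have mG : measurable_fun setT (fun t => F t * (stdpdf t)%:E)%E.
  by apply: emeasurable_funM => //; apply/measurable_EFinP; exact: measurable_stdpdf.
have G0 t : (0 <= F t * (stdpdf t)%:E)%E by rewrite mule_ge0// lee_fin stdpdf_ge0.
transitivity (\int[pushforward lam (-%R : R -> measurableTypeR R)]_t (F t * (stdpdf t)%:E))%E.
  have mN : measurable_fun setT (-%R : measurableTypeR R -> measurableTypeR R).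
    exact: oppr_measurable.
  have -> := @ge0_integral_pushforward _ _ _ _ R _ mN lam setT _ measurableT mG
    (fun t _ => G0 t).
  by apply: eq_integral => t _ /=; rewrite (@phi_sq t (- t)) ?sqrrN.
by apply: eq_measure_integral => A mA _; exact: lebesgue_measureN.
Qed.

Lemma stdnormal_integrable2 : stdnormal.-integrable setT (fun t => (t ^+ 2)%:E).
Proof.
apply/integrableP; split; first by apply/measurable_EFinP; exact: measurable_funX.
under eq_integral do rewrite gee0_abs ?lee_fin ?sqr_ge0//.
by rewrite stdnormal_moment2 ltry.
Qed.

Lemma stdnormal_integrable1 : stdnormal.-integrable setT (fun t => t%:E).
Proof.
apply: (@le_integrable _ _ _ stdnormal _ measurableT _ (fun t => (1 + t ^+ 2)%:E)).
- by apply/measurable_EFinP.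
- move=> t _; rewrite lee_fin [leRHS]ger0_norm ?addr_ge0 ?sqr_ge0//.
  by rewrite ler_norml; apply/andP; split; have := sqr_ge0 (t - 1); have := sqr_ge0 (t + 1); nra.
- under eq_fun do rewrite EFinD.
  apply: integrableD => //; last exact: stdnormal_integrable2.
  exact: (bmeas_integrable stdnormal (bmeas_cst 1)).
Qed.

(** By symmetry the positive and negative parts have the same, finite, integral. *)
Lemma stdnormal_moment1 : \int[stdnormal]_t t = 0.
Proof.
rewrite /Rintegral integralE.
have mid : measurable_fun setT (fun t : R => t%:E) by exact/measurable_EFinP.
have -> : (\int[stdnormal]_t (fun t : R => t%:E)^\- t = \int[stdnormal]_t (fun t : R => t%:E)^\+ t)%E.
  rewrite -(stdnormalN (measurable_funepos mid))//.
  by apply: eq_integral => t _; rewrite funeposE funenegE.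
rewrite subee//; apply: integrable_fin_num => //.
by apply: integrable_funepos => //; exact: stdnormal_integrable1.
Qed.

End stdnormal_semigroup.

(** * Central limit theorem for smooth test functions *)

Lemma cvg_sqrtn (R : realType) : Num.sqrt n%:R @[n --> \oo] --> (+oo%R : set_system R).
Proof.
apply/cvgryPge => M; near=> n.
have Mn : M ^+ 2 <= n%:R by near: n; exact: nbhs_infty_ger.
by rewrite (le_trans (ler_norm _))// -sqrtr_sqr ler_wsqrtr.
Unshelve. all: by end_near. Qed.

Section taylor_class.
Context {R : realType}.
Variables (A B : R).
Hypotheses (A0 : 0 <= A) (B0 : 0 <= B).

(* Cubic near [0] and quadratic at infinity: a second-order expansion with this
   remainder only needs a finite second moment. *)
Definition taylor2_rem (y : R) : R := Num.min (A * `|y| ^+ 3) (B * y ^+ 2).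

Definition taylor2 (u u1 u2 : R -> R) := forall x y,
  `|u (x + y) - (u x + u1 x * y + u2 x / 2 * y ^+ 2)| <= taylor2_rem y.

Lemma taylor2_rem_ge0 y : 0 <= taylor2_rem y.
Proof.
rewrite /taylor2_rem le_min; apply/andP; split; apply: mulr_ge0 => //.
exact: sqr_ge0.
Qed.

Lemma taylor2_rem_le y : taylor2_rem y <= B * y ^+ 2.
Proof. by rewrite /taylor2_rem ge_min lexx orbT. Qed.

Lemma measurable_taylor2_rem : measurable_fun setT taylor2_rem.
Proof.
apply: measurable_minr.
  apply: measurable_funM => //; apply: measurable_funX.
  exact: normr_measurable.
by apply: measurable_funM => //; exact: measurable_funX.
Qed.

Section one_variable.
Context {d} {T : measurableType d} (P : probability T R) (Y : T -> R).
Hypothesis mY : measurable_fun setT Y.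
Hypothesis iY2 : P.-integrable setT (fun w => (Y w ^+ 2)%:E).

Lemma integrable_of_sqr : P.-integrable setT (fun w => (Y w)%:E).
Proof.
apply: (@le_integrable _ _ _ P _ measurableT _ (fun w => (1 + Y w ^+ 2)%:E)).
- by apply/measurable_EFinP.
- move=> w _; rewrite lee_fin [leRHS]ger0_norm ?addr_ge0 ?sqr_ge0//.
  rewrite ler_norml; apply/andP; split; have := sqr_ge0 (Y w - 1);
    have := sqr_ge0 (Y w + 1); nra.
- apply: integrable_realD => //.
  exact: (bmeas_integrable P (bmeas_cst 1)).
Qed.

Lemma integrable_taylor2_rem k : P.-integrable setT (fun w => (taylor2_rem (k * Y w))%:E).
Proof.
apply: (@le_integrable _ _ _ P _ measurableT _ (fun w => (B * k ^+ 2)%:E * (Y w ^+ 2)%:E)%E).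
- apply/measurable_EFinP; apply: (measurableT_comp measurable_taylor2_rem).
  exact: measurable_funM.
- move=> w _; rewrite -EFinM lee_fin ger0_norm ?taylor2_rem_ge0// ger0_norm.
    by rewrite (le_trans (taylor2_rem_le _))// exprMn mulrA.
  by rewrite mulr_ge0 ?sqr_ge0// mulr_ge0 ?sqr_ge0.
- exact: integrableZl.
Qed.

(** The first-order term has mean zero and the second-order term sees only the variance; two
    centered variables of equal variance therefore differ, under [u], by their remainders alone. *)
Lemma taylor2_expectation (u u1 u2 : R -> R) (k x : R) :
  \int[P]_w Y w = 0 -> bmeas u -> taylor2 u u1 u2 ->
  `|\int[P]_w u (x + k * Y w) -
    (u x + u2 x / 2 * (k ^+ 2 * \int[P]_w Y w ^+ 2))| <= \int[P]_w taylor2_rem (k * Y w).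
Proof.
move=> Y0 bu ut.
have iY := integrable_of_sqr.
have bu' : bmeas (fun w => u (x + k * Y w)).
  by apply: (bmeas_comp bu); apply: measurable_funD => //; apply: measurable_funM.
have i0 : P.-integrable setT (EFin \o (fun _ : T => u x)).
  exact: (bmeas_integrable P (bmeas_cst _)).
have i1 : P.-integrable setT (EFin \o (fun w => u1 x * k * Y w)).
  exact: integrable_realZ.
have i2 : P.-integrable setT (EFin \o (fun w => u2 x / 2 * k ^+ 2 * Y w ^+ 2)).
  exact: integrable_realZ.
have i01 : P.-integrable setT (EFin \o (fun w => u x + u1 x * k * Y w)).
  exact: integrable_realD.
have i012 : P.-integrable setT
    (EFin \o (fun w => u x + u1 x * k * Y w + u2 x / 2 * k ^+ 2 * Y w ^+ 2)).
  exact: integrable_realD.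
have E : \int[P]_w (u x + u1 x * k * Y w + u2 x / 2 * k ^+ 2 * Y w ^+ 2) =
    u x + u2 x / 2 * (k ^+ 2 * \int[P]_w Y w ^+ 2).
  rewrite RintegralD// RintegralD// Rintegral_prob_cst.
  by rewrite RintegralZl// RintegralZl// Y0 mulr0 addr0 mulrA.
rewrite -E -RintegralB//; last exact: bmeas_integrable.
have iB : P.-integrable setT (EFin \o (fun w => u (x + k * Y w) -
   (u x + u1 x * k * Y w + u2 x / 2 * k ^+ 2 * Y w ^+ 2))).
  by apply: integrable_realB => //; exact: bmeas_integrable.
apply: (le_trans (le_normr_Rintegral measurableT iB)).
apply: le_Rintegral => //.
- exact: (integrable_abse iB).
- exact: integrable_taylor2_rem.
- move=> w _; apply: le_trans (ut x (k * Y w)).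
  by rewrite exprMn !mulrA.
Qed.

(** Dominated convergence, in place of a Lindeberg condition: the quadratic branch of the remainder
    gives the bound [B * Y^2], the cubic branch the pointwise rate [n * n^(-3/2)]. *)
Lemma taylor2_rem_cvg0 :
  (fun n : nat => n%:R * \int[P]_w taylor2_rem ((Num.sqrt n%:R)^-1 * Y w)) @ \oo --> 0.
Proof.
have E n : n%:R * \int[P]_w taylor2_rem ((Num.sqrt n%:R)^-1 * Y w) =
    \int[P]_w (n%:R * taylor2_rem ((Num.sqrt n%:R)^-1 * Y w)).
  by rewrite RintegralZl//; exact: integrable_taylor2_rem.
under eq_fun do rewrite E.
have dom n w : n%:R * taylor2_rem ((Num.sqrt n%:R)^-1 * Y w) <= B * Y w ^+ 2.
  case: n => [|n]; first by rewrite mul0r mulr_ge0// sqr_ge0.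
  apply: (le_trans (ler_wpM2l _ (taylor2_rem_le _))) => //.
  by rewrite exprMn exprVn sqr_sqrtr// mulrCA mulVKf.
have cv w : n%:R * taylor2_rem ((Num.sqrt n%:R)^-1 * Y w) @[n --> \oo] --> (0 : R).
  apply: (squeeze_cvgr (f := fun=> 0)
    (h := fun n => A * `|Y w| ^+ 3 * (Num.sqrt n%:R)^-1)).
  - near=> n.
    have n0 : (0 < n)%N by near: n; exact: nbhs_infty_gt.
    have s0 : 0 < Num.sqrt n%:R :> R by rewrite sqrtr_gt0 ltr0n.
    rewrite mulr_ge0 ?taylor2_rem_ge0//=.
    apply: (@le_trans _ _ (n%:R * (A * `|(Num.sqrt n%:R)^-1 * Y w| ^+ 3))).
      by rewrite ler_wpM2l// /taylor2_rem ge_min lexx.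
    rewrite normrM gtr0_norm ?invr_gt0// exprMn.
    rewrite -[X in X * (A * _)](@sqr_sqrtr R n%:R)//.
    rewrite le_eqVlt; apply/orP; left; apply/eqP.
    by field; rewrite gt_eqF.
  - exact: cvg_cst.
  - rewrite -[X in _ --> X](mulr0 (A * `|Y w| ^+ 3)).
    apply: cvgMl_tmp; apply/gtr0_cvgV0.
      near=> n; rewrite sqrtr_gt0 ltr0n; near: n; exact: nbhs_infty_gt.
    exact: cvg_sqrtn.
have H : (\int[P]_w (n%:R * taylor2_rem ((Num.sqrt n%:R)^-1 * Y w))%:E)%E @[n --> \oo]
    --> (\int[P]_w 0%:E)%E.
  apply: (@dominated_cvg _ _ _ P setT measurableT
    (fun n w => (n%:R * taylor2_rem ((Num.sqrt n%:R)^-1 * Y w))%:E) (fun=> 0%:E)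
    (fun w => (B%:E * (Y w ^+ 2)%:E)%E)) => //.
  - move=> n; apply/measurable_EFinP; apply: measurable_funM => //.
    apply: (measurableT_comp measurable_taylor2_rem); exact: measurable_funM.
  - by move=> w _; apply: cvg_EFin; [exact: nearW|exact: cv].
  - exact: integrableZl.
  - move=> n w _; rewrite gee0_abs ?lee_fin ?mulr_ge0 ?taylor2_rem_ge0//.
rewrite integral0 in H; have /fine_cvgP[_] := H; exact.
Unshelve. all: by end_near. Qed.

End one_variable.
End taylor_class.

(** * One-variable Taylor bounds and logistic test functions *)

Section taylor_one.
Context {R : realType}.
Implicit Types (a : nat -> R) (t x : R).

Definition tpoly (k : nat) a t : R := \sum_(j < k) a j / j`!%:R * t ^+ j.

Lemma tpolyS k a t : tpoly k.+1 a t = tpoly k a t + a k / k`!%:R * t ^+ k.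
Proof. by rewrite /tpoly big_ord_recr. Qed.

Lemma tpoly0 k a : tpoly k.+1 a 0 = a 0%N.
Proof.
rewrite /tpoly big_ord_recl expr0 fact0 divr1 mulr1 big1 ?addr0// => j _.
by rewrite expr0n mulr0.
Qed.

Lemma is_derive_tpoly k a t :
  is_derive t 1 (tpoly k.+1 a) (tpoly k (fun j => a j.+1) t).
Proof.
elim: k => [|k IH].
  rewrite (_ : tpoly 1 a = cst (a 0%N)).
    by apply: is_derive_eq; rewrite /tpoly big_ord0.
  apply/funext => s; rewrite tpolyS /tpoly big_ord0 add0r expr0 mulr1.
  by rewrite fact0 divr1.
rewrite (_ : tpoly k.+2 a = tpoly k.+1 a +
    (fun s : R => (a k.+1 / k.+1`!%:R) *: (s ^+ k.+1))); last first.
  by apply/funext => s; rewrite tpolyS.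
have h : is_derive t 1 (fun s : R => s ^+ k.+1) (k.+1%:R * t ^+ k).
  apply: DeriveDef; first exact: exprn_derivable.
  by rewrite exp_derive /GRing.scale/= mulr1.
have h2 := @is_deriveZ R R R (fun s => s ^+ k.+1) (a k.+1 / k.+1`!%:R) t 1 _ h.
suff <- : tpoly k (fun j => a j.+1) t + a k.+1 / k.+1`!%:R *: (k.+1%:R * t ^+ k) =
    tpoly k.+1 (fun j => a j.+1) t by exact: is_deriveD.
rewrite tpolyS; congr (_ + _).
rewrite /GRing.scale/= factS natrM mulrA; congr (_ * _).
by rewrite invfM [_ * k.+1%:R]mulrC mulrCA mulVKf// pnatr_eq0.
Qed.

(** The derivative of the remainder is the remainder of the shifted family [F j.+1], so the mean
    value theorem gains one factor [|t|] per induction step. The constant lacks the usual [1 / k!];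
    only the order in [t] matters. *)
Lemma taylor_bound (k : nat) (F : nat -> R -> R) (M x t : R) :
  (forall j (y : R), (j < k)%N -> is_derive y 1 (F j) (F j.+1 y)) ->
  (forall y, `|F k y| <= M) ->
  `|F 0%N (x + t) - tpoly k (F ^~ x) t| <= M * `|t| ^+ k.
Proof.
elim: k F t => [|k IH] F t dF FM.
  by rewrite /tpoly big_ord0 subr0 expr0 mulr1.
pose G s := F 0%N (x + s) - tpoly k.+1 (F ^~ x) s.
pose G' s := F 1%N (x + s) - tpoly k (fun j => F j.+1 x) s.
have M0 : 0 <= M by rewrite (le_trans _ (FM 0)).
have dG (s : R) : is_derive s 1 G (G' s).
  have d1 : is_derive s 1 (fun s => F 0%N (x + s)) (F 1%N (x + s)).
    have h1 : is_derive s 1 (fun s : R => x + s) 1.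
      rewrite -[X in is_derive _ _ _ X]add0r.
      exact: (@is_deriveD _ _ _ (cst x) id).
    have h0 := dF 0%N (x + s) isT.
    by have := is_derive1_comp h0 h1; rewrite mulr1.
  have d2 := is_derive_tpoly k (F ^~ x) s.
  exact: is_deriveB.
have G'b s : `|G' s| <= M * `|s| ^+ k.
  by apply: (IH (fun j => F j.+1)) => // j y jk; exact: dF.
have G0 : G 0 = 0 by rewrite /G tpoly0 addr0 subrr.
have cG : continuous G.
  by move=> s; apply/differentiable_continuous/derivable1_diffP; by case: (dG s).
(* Stated on an ordered segment so as to serve both signs of [t]. *)
have key (p q : R) : p <= q -> `|p| <= `|t| -> `|q| <= `|t| ->
    q - p = `|t| -> `|G q - G p| <= M * `|t| ^+ k.+1.
  move=> pq pt qt qp.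
  have [c cpq ->] := MVT_segment pq (fun y _ => dG y) (continuous_subspaceT cG).
  rewrite normrM qp normr_id exprSr mulrA ler_wpM2r//.
  apply: (le_trans (G'b c)); rewrite ler_wpM2l// lerXn2r ?nnegrE//.
  move: cpq; rewrite in_itv/= ler_norml => /andP[pc cq].
  move: pt qt; rewrite !ler_norml => /andP[pt _] /andP[_ qt].
  by apply/andP; split; [exact: le_trans pc|exact: le_trans qt].
rewrite -/(G t); case: (leP 0 t) => t0.
  have := key 0 t t0; rewrite normr0 G0 !subr0; apply => //.
  by rewrite ger0_norm.
have := key t 0 (ltW t0); rewrite normr0 G0 !sub0r normrN; apply => //.
by rewrite ltr0_norm.
Qed.

End taylor_one.

Section logistic.
Context {R : realType}.

(** Decreasing from [1] to [0], unlike the usual convention: rescaled, it approximates the indicator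
    of a left half-line, that is, a distribution function. *)
Definition logistic (x : R) : R := (1 + expR x)^-1.

Let den_gt0 (x : R) : 0 < 1 + expR x.
Proof. by rewrite addr_gt0// expR_gt0. Qed.

Lemma logistic_gt0 x : 0 < logistic x. Proof. by rewrite invr_gt0. Qed.

Lemma logistic_lt1 x : logistic x < 1.
Proof. by rewrite invf_lt1// ltrDl expR_gt0. Qed.

Let is_derive_logistic (x : R) : is_derive x 1 logistic (logistic x ^+ 2 - logistic x).
Proof.
have h : is_derive x 1 (fun y => 1 + expR y) (expR x).
  rewrite -[X in is_derive _ _ _ X]add0r.
  exact: (is_deriveD (is_derive_cst (1 : R) x 1) (is_derive_expR x)).
have h0 : 1 + expR x != 0 by rewrite gt_eqF.
have h1 := @is_deriveV R (fun y => 1 + expR y) x _ 1 h0 h.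
rewrite (_ : _ - _ = - (1 + expR x) ^- 2 *: expR x) //.
by rewrite /logistic /GRing.scale/=; field.
Qed.

(* The derivatives of the logistic function are polynomials in it. *)
Let q (j : nat) : {poly R} := iter j (fun p : {poly R} => p^`() * ('X^2 - 'X)) 'X.

Let logistic_deriv (eps a : R) (j : nat) (x : R) : R :=
  eps^-1 ^+ j * (q j).[logistic (eps^-1 * (x - a))].

Let is_derive_logistic_deriv eps a j (x : R) :
  is_derive x 1 (logistic_deriv eps a j) (logistic_deriv eps a j.+1 x).
Proof.
rewrite /logistic_deriv.
pose z := eps^-1 * (x - a).
have h1 : is_derive x 1 (fun x : R => eps^-1 * (x - a)) eps^-1.
  have h : is_derive x 1 (fun x : R => x - a) 1.
    by apply: is_derive_eq; rewrite subr0.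
  rewrite -[X in is_derive _ _ _ X]mulr1.
  exact: (@is_deriveZ R R R (fun x : R => x - a) eps^-1 x 1 1 h).
have h2 := @is_derive1_comp R logistic (fun y => eps^-1 * (y - a)) x _ _ (is_derive_logistic z) h1.
have h3 := @is_derive1_comp R (horner (q j)) (logistic \o (fun y => eps^-1 * (y - a))) x _ _
  (is_derive_poly (q j) (logistic z)) h2.
have h4 := @is_deriveZ R R R _ (eps^-1 ^+ j) x 1 _ h3.
rewrite (_ : eps^-1 ^+ j.+1 * _ = eps^-1 ^+ j *: ((q j)^`().[logistic z] *
  ((logistic z ^+ 2 - logistic z) * eps^-1))) //.
rewrite /GRing.scale/= /q/= hornerM hornerD hornerN hornerXn hornerX exprS -/(q j).
by rewrite -/z; ring.
Qed.

Let logistic_deriv_bound eps a j : exists M : R, forall x, `|logistic_deriv eps a j x| <= M.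
Proof.
exists (`|eps^-1 ^+ j| * \sum_(i < size (q j)) `|(q j)`_i|) => x.
rewrite /logistic_deriv normrM ler_wpM2l//.
rewrite horner_coef (le_trans (ler_norm_sum _ _ _))//.
apply: ler_sum => i _; rewrite normrM normrX -[leRHS]mulr1 ler_wpM2l//.
rewrite exprn_ile1// ger0_norm ?ltW ?logistic_gt0//; exact: logistic_lt1.
Qed.

Lemma logistic_taylor2 (eps a : R) : exists A B u1 u2, [/\ 0 <= A, 0 <= B &
  taylor2 A B (fun x => logistic (eps^-1 * (x - a))) u1 u2] /\ (bmeas u1 /\ bmeas u2).
Proof.
have [M3 b3] := logistic_deriv_bound eps a 3.
have [M2 b2] := logistic_deriv_bound eps a 2.
have M30 : 0 <= M3 by rewrite (le_trans _ (b3 0)).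
have M20 : 0 <= M2 by rewrite (le_trans _ (b2 0)).
(* The cubic constant bounds the third derivative. For the quadratic one, the first-order remainder
   costs [M2] and the second-order term at most [M2 / 2], rounded up to [M2]. *)
exists M3, (2 * M2), (logistic_deriv eps a 1), (logistic_deriv eps a 2).
have mF j : measurable_fun setT (logistic_deriv eps a j).
  apply: continuous_measurable_fun => x.
  apply/differentiable_continuous/derivable1_diffP.
  by case: (is_derive_logistic_deriv eps a j x).
split; last first.
  by split; split => //; exact: logistic_deriv_bound.
split => //; first by rewrite mulr_ge0.
have u0 x : logistic_deriv eps a 0 x = logistic (eps^-1 * (x - a)).
  by rewrite /logistic_deriv /q /= hornerX expr0 mul1r.
move=> x y; rewrite -!u0.
have t3 := @taylor_bound R 3 (logistic_deriv eps a) M3 x y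
  (fun j y _ => is_derive_logistic_deriv eps a j y) b3.
have t2 := @taylor_bound R 2 (logistic_deriv eps a) M2 x y
  (fun j y _ => is_derive_logistic_deriv eps a j y) b2.
have e2 : tpoly 2 (fun j => logistic_deriv eps a j x) y =
    logistic_deriv eps a 0 x + logistic_deriv eps a 1 x * y.
  by rewrite /tpoly !big_ord_recr big_ord0/= add0r expr0 expr1 !divr1 mulr1.
have e3 : tpoly 3 (fun j => logistic_deriv eps a j x) y =
    logistic_deriv eps a 0 x + logistic_deriv eps a 1 x * y +
    logistic_deriv eps a 2 x / 2 * y ^+ 2.
  by rewrite tpolyS e2.
rewrite e3 in t3; rewrite e2 in t2.
rewrite /taylor2_rem le_min t3/=; rewrite -normrX in t2.
rewrite opprD addrA (le_trans (ler_normB _ _))//.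
have -> : 2 * M2 * y ^+ 2 = M2 * `|y ^+ 2| + M2 * y ^+ 2.
  by rewrite ger0_norm ?sqr_ge0//; ring.
rewrite lerD// normrM (ger0_norm (sqr_ge0 y)) ler_wpM2r ?sqr_ge0//.
rewrite normrM (@ger0_norm _ (2^-1))// ler_pdivrMr// (le_trans (b2 x))//.
by rewrite ler_peMr// ler1n.
Qed.

Lemma bmeas_logistic (eps a : R) : bmeas (fun x : R => logistic (eps^-1 * (x - a))).
Proof.
split; last first.
  by exists 1 => x; rewrite ger0_norm ?ltW ?logistic_gt0 ?logistic_lt1.
have -> : (fun x : R => logistic (eps^-1 * (x - a))) = logistic_deriv eps a 0.
  by apply/funext => x; rewrite /logistic_deriv /q /= hornerX expr0 mul1r.
apply: continuous_measurable_fun => x.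
apply/differentiable_continuous/derivable1_diffP.
by case: (is_derive_logistic_deriv eps a 0 x).
Qed.

Lemma logistic_lipschitz (eps a : R) : exists2 L : R, 0 <= L & forall x y,
  `|logistic (eps^-1 * (x - a)) - logistic (eps^-1 * (y - a))| <= L * `|x - y|.
Proof.
have [M1 b1] := logistic_deriv_bound eps a 1.
exists M1; first by rewrite (le_trans _ (b1 0)).
move=> x y; have t1 := @taylor_bound R 1 (logistic_deriv eps a) M1 y (x - y)
  (fun j y _ => is_derive_logistic_deriv eps a j y) b1.
move: t1; rewrite (_ : y + (x - y) = x); last by rewrite addrC subrK.
rewrite /tpoly big_ord1 fact0 divr1 expr0 mulr1 expr1.
by rewrite /logistic_deriv /q /= !hornerX !expr0 !mul1r.
Qed.

End logistic.

Lemma cvg_dist_le (R : realType) (f e : nat -> R) (l : R) :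
  (\forall n \near \oo, `|f n - l| <= e n) -> e @ \oo --> 0 -> f @ \oo --> l.
Proof.
move=> fe /cvgrPdist_le e0; apply/cvgrPdist_le => eps eps0; near=> n.
rewrite distrC (@le_trans _ _ (e n))//; first by near: n.
rewrite (le_trans (ler_norm _))// -normrN -sub0r.
by near: n; exact: e0.
Unshelve. all: by end_near. Qed.

(** * Gaussian averages and the exchange of summands *)

Section gaussian_average.
Context {R : realType}.
Local Notation stdnormal := (@stdnormal R).
Implicit Types (u : R -> R) (s x : R).

(** The heat semigroup, indexed by the standard deviation, so that composition adds the squares of
    the parameters. *)
Definition gavg s u x := \int[stdnormal]_t u (x + s * t).

Let mlin (a b : R) : measurable_fun setT (fun t : R => a + b * t).
Proof. by apply: measurable_funD => //; apply: measurable_funM. Qed.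

Let bshift u (a b : R) : bmeas u -> bmeas (fun t : R => u (a + b * t)).
Proof. by move=> bu; exact: (bmeas_comp bu (mlin a b)). Qed.

Lemma bmeas_gavg s u : bmeas u -> bmeas (gavg s u).
Proof.
move=> bu; apply: (bmeas_fubini stdnormal (F := fun z : R * R => u (z.1 + s * z.2))).
apply: (bmeas_comp bu); apply: measurable_funD; first exact: measurable_fst.
by apply: measurable_funM => //; exact: measurable_snd.
Qed.

Lemma gavg0 u : gavg 0 u = u.
Proof.
apply/funext => x; rewrite /gavg -[RHS](Rintegral_prob_cst stdnormal).
by apply: eq_Rintegral => t _; rewrite mul0r addr0.
Qed.

Lemma gavg_semigroup a b c u : 0 <= a -> 0 <= b -> 0 <= c ->
  c ^+ 2 = a ^+ 2 + b ^+ 2 -> bmeas u -> gavg a (gavg b u) = gavg c u.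
Proof.
move=> a0 b0 c0 cab bu; apply/funext => x.
have bux : bmeas (fun y : R => u (x + y)).
  by have := bshift x 1 bu; under eq_fun do rewrite mul1r.
apply: etrans (@stdnormal_semigroup R a b c _ a0 b0 c0 cab bux).
apply: eq_Rintegral => s _; apply: eq_Rintegral => t _.
by rewrite addrA.
Qed.

(** The class is invariant under translation and under averaging, with the same [A] and [B]; the
    error of each exchange is thus uniform in the number of Gaussian steps already averaged. *)
Lemma gavg_taylor2 A B s u u1 u2 : bmeas u -> bmeas u1 -> bmeas u2 ->
  taylor2 A B u u1 u2 -> taylor2 A B (gavg s u) (gavg s u1) (gavg s u2).
Proof.
move=> bu bu1 bu2 ut x y.
have b0 := bshift (x + y) s bu; have b1 := bshift x s bu.
have b2 := bshift x s bu1; have b3 := bshift x s bu2.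
have b2' : bmeas (fun t => u1 (x + s * t) * y) by apply: bmeasM => //; exact: bmeas_cst.
have b3' : bmeas (fun t => u2 (x + s * t) * (2^-1 * y ^+ 2)).
  by apply: bmeasM => //; exact: bmeas_cst.
have b12 : bmeas (fun t => u (x + s * t) + u1 (x + s * t) * y) by exact: bmeasD.
have -> : gavg s u (x + y) - (gavg s u x + gavg s u1 x * y + gavg s u2 x / 2 * y ^+ 2) =
  \int[stdnormal]_t (u (x + y + s * t) - (u (x + s * t) + u1 (x + s * t) * y +
     u2 (x + s * t) * (2^-1 * y ^+ 2))).
  by rewrite Rint_B ?Rint_D ?Rint_Zr//; [rewrite /gavg !mulrA|exact: bmeasD].
apply: Rint_norm_le; first by apply: bmeasB => //; exact: bmeasD.
by move=> t; rewrite addrAC mulrA; exact: ut.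
Qed.

End gaussian_average.

Section trotter.
Context {dO : measure_display} {Omega : measurableType dO} {R : realType}.
Context (P : probability Omega R).
Variables (S : nat -> Omega -> R) (Z : Omega -> R).
Hypothesis mS : forall n, measurable_fun setT (S n).
Hypothesis S0 : forall w, S 0 w = 0.
Hypothesis mZ : measurable_fun setT Z.
Hypothesis iZ2 : P.-integrable setT (fun w => (Z w ^+ 2)%:E).
Hypothesis Z0 : \int[P]_w Z w = 0.
Hypothesis stepS : forall m (u : R -> R), bmeas u ->
  \int[P]_w u (S m.+1 w) = \int[P]_w' (\int[P]_w u (S m w' + Z w)).
Variables (A B : R) (u u1 u2 : R -> R).
Hypotheses (A0 : 0 <= A) (B0 : 0 <= B).
Hypotheses (bu : bmeas u) (bu1 : bmeas u1) (bu2 : bmeas u2).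
Hypothesis ut : taylor2 A B u u1 u2.

Let v := \int[P]_w Z w ^+ 2.
Let a := Num.sqrt v.

Let v0 : 0 <= v.
Proof. by apply: Rintegral_ge0 => w _; exact: sqr_ge0. Qed.

Let mat : measurable_fun setT (fun t : R => a * t).
Proof. exact: measurable_funM. Qed.

Let iat : (@stdnormal R).-integrable setT (fun t => ((a * t) ^+ 2)%:E).
Proof.
have := integrable_realZ (a ^+ 2) (@stdnormal_integrable2 R).
by congr (_.-integrable _ _); apply/funext => t /=; rewrite exprMn.
Qed.

Let delta (c : R) := \int[P]_w taylor2_rem A B (c * Z w) + \int[@stdnormal R]_t taylor2_rem A B (c * (a * t)).

(** [Z] and [a] times a standard Gaussian share mean [0] and variance [v], hence their second-order
    expansions; the two remainders add up to [delta]. *)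
Let one_step (c x : R) (g g1 g2 : R -> R) : bmeas g -> taylor2 A B g g1 g2 ->
  `|\int[P]_w g (x + c * Z w) - gavg (c * a) g x| <= delta c.
Proof.
move=> bg gt.
have h1 := taylor2_expectation A0 B0 mZ iZ2 c x Z0 bg gt.
have g0 : \int[@stdnormal R]_t (a * t) = 0.
  by rewrite RintegralZl// ?stdnormal_moment1 ?mulr0//; exact: stdnormal_integrable1.
have h2 := taylor2_expectation A0 B0 mat iat c x g0 bg gt.
have gv : \int[@stdnormal R]_t (a * t) ^+ 2 = v.
  under eq_Rintegral do rewrite exprMn.
  rewrite RintegralZl//; last exact: stdnormal_integrable2.
  by rewrite sqr_sqrtr// /Rintegral stdnormal_moment2/= mulr1.
rewrite gv in h2.
have e : \int[@stdnormal R]_t g (x + c * (a * t)) = gavg (c * a) g x.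
  by apply: eq_Rintegral => t _; rewrite mulrA.
rewrite e in h2.
rewrite -(subrKA (g x + g2 x / 2 * (c ^+ 2 * v))) (le_trans (ler_normD _ _))//.
by rewrite lerD// distrC.
Qed.

(* Replaces the summands by Gaussians one at a time; the semigroup property
   turns the Gaussian average over the remaining steps into a test function of
   the same Taylor class. *)
Lemma trotter_bound (n : nat) : (0 < n)%N ->
  `|\int[P]_w u ((Num.sqrt n%:R)^-1 * S n w) - gavg a u 0| <=
  n%:R * delta (Num.sqrt n%:R)^-1.
Proof.
move=> n0; set c := _^-1.
have c0 : 0 <= c by rewrite invr_ge0.
have a0 : 0 <= a by exact: sqrtr_ge0.
(* [s k] is the standard deviation of [k] normalized Gaussian steps. In [T m] the first [m] summands
   are genuine and the other [n - m] Gaussian, so [T n] and [T 0] are the two quantities to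
   compare. *)
pose s (k : nat) := c * Num.sqrt k%:R * a.
pose T m := \int[P]_w gavg (s (n - m)%N) u (c * S m w).
have bc k (g : R -> R) : bmeas g -> bmeas (fun w => g (c * S k w)).
  by move=> bg; apply: (bmeas_comp bg); apply: measurable_funM.
have step m : (m < n)%N -> `|T m.+1 - T m| <= delta c.
  move=> mn; pose k := (n - m.+1)%N.
  have nm : (n - m)%N = k.+1 by rewrite /k subnSK.
  pose g := gavg (s k) u.
  have bg : bmeas g by exact: bmeas_gavg.
  have gt : taylor2 A B g (gavg (s k) u1) (gavg (s k) u2) by exact: gavg_taylor2.
  have E1 : T m.+1 = \int[P]_w' (\int[P]_w g (c * S m w' + c * Z w)).
    rewrite /T -/k (stepS m (u := fun y => g (c * y))); last first.
      by apply: (bmeas_comp bg); exact: measurable_funM.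
    by apply: eq_Rintegral => w' _; apply: eq_Rintegral => w _; rewrite mulrDr.
  have E2 : T m = \int[P]_w' gavg (c * a) g (c * S m w').
    apply: eq_Rintegral => w' _; rewrite nm /g.
    rewrite (@gavg_semigroup _ (c * a) (s k) (s k.+1)) ?mulr_ge0//.
    rewrite /s !exprMn !sqr_sqrtr// -natr1; ring.
  have b1 : bmeas (fun w' => \int[P]_w g (c * S m w' + c * Z w)).
    apply: (bmeas_fubini P (F := fun z : Omega * Omega => g (c * S m z.1 + c * Z z.2))).
    apply: (bmeas_comp bg); apply: measurable_funD; apply: measurable_funM => //.
      exact: (measurableT_comp (mS m) measurable_fst).
    exact: (measurableT_comp mZ measurable_snd).
  have b2 : bmeas (fun w' => gavg (c * a) g (c * S m w')).
    by apply: bc; exact: bmeas_gavg.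
  rewrite E1 E2 -Rint_B//; apply: Rint_norm_le; first exact: bmeasB.
  by move=> w'; exact: one_step gt.
have tel m : (m <= n)%N -> `|T m - T 0%N| <= m%:R * delta c.
  elim: m => [|m IH] mn; first by rewrite subrr normr0 mul0r.
  rewrite -(subrKA (T m)) (le_trans (ler_normD _ _))// -natr1 mulrDl mul1r.
  by rewrite [leRHS]addrC; apply: lerD; [exact: step|exact/IH/ltnW].
have := tel n (leqnn n).
have -> : T n = \int[P]_w u (c * S n w).
  by rewrite /T subnn /s sqrtr0 mulr0 mul0r gavg0.
suff -> : T 0%N = gavg a u 0 by [].
rewrite /T subn0 /s mulVf ?mul1r; last by rewrite sqrtr_eq0 -ltNge ltr0n.
rewrite -[RHS](Rintegral_prob_cst P); apply: eq_Rintegral => w _.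
by rewrite S0 mulr0.
Qed.

Lemma trotter_clt :
  \int[P]_w u ((Num.sqrt n%:R)^-1 * S n w) @[n --> \oo] --> gavg a u 0.
Proof.
have d0 : (fun n : nat => n%:R * delta (Num.sqrt n%:R)^-1) @ \oo --> 0.
  have H := cvgD (taylor2_rem_cvg0 A0 B0 mZ iZ2) (taylor2_rem_cvg0 A0 B0 mat iat).
  rewrite addr0 in H.
  rewrite (_ : (fun n => _) = (fun n : nat => n%:R * \int[P]_w taylor2_rem A B ((Num.sqrt n%:R)^-1 * Z w) +
    n%:R * \int[@stdnormal R]_t taylor2_rem A B ((Num.sqrt n%:R)^-1 * (a * t)))); first exact: H.
  by apply/funext => n; rewrite /delta mulrDr.
apply: (cvg_dist_le _ d0); near=> n; apply: trotter_bound.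
by near: n; exact: nbhs_infty_gt.
Unshelve. all: by end_near. Qed.

End trotter.

(** * Logistic functions and convergence in distribution *)

Section logistic_sandwich.
Context {R : realType}.

Lemma logistic_lower (x : R) : 1 - expR x <= logistic x.
Proof.
have x0 := expR_gt0 x; rewrite /logistic -[leLHS]mul1r.
rewrite -(@ler_pM2r _ (1 + expR x)) ?addr_gt0// mulVf ?gt_eqF ?addr_gt0//.
nra.
Qed.

Lemma logistic_upper (x : R) : logistic x <= expR (- x).
Proof.
have x0 := expR_gt0 x; rewrite /logistic expRN lef_pV2 ?posrE ?addr_gt0//.
by rewrite lerDr.
Qed.

Lemma expRN_small (eta : R) : 0 < eta -> expR (- eta^-1) <= eta.
Proof.
move=> e0; rewrite expRN -[leRHS]invrK lef_pV2 ?posrE ?expR_gt0 ?invr_gt0//.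
by rewrite (le_trans _ (expR_ge1Dx _))// lerDr.
Qed.

Variables (d eta a : R).
Hypotheses (d0 : 0 < d) (eta0 : 0 < eta).
Let L (x : R) := logistic ((d * eta)^-1 * (x - a)).

Let de0 : 0 < (d * eta)^-1. Proof. by rewrite invr_gt0 mulr_gt0. Qed.

Let deE : (d * eta)^-1 * d = eta^-1.
Proof. by rewrite invfM mulrAC mulVf ?mul1r// gt_eqF. Qed.

(** At distance [d] to the left of [a] the argument is at most [- eta^-1], where the logistic is
    within [expR (- eta^-1) <= eta] of [1]. *)
Lemma indic_le_logistic (x : R) : \1_(`]-oo, a - d] : set R) x <= L x + eta.
Proof.
rewrite indicE; case: (boolP (x \in _)) => [|_]; last first.
  by rewrite addr_ge0 ?ltW// logistic_gt0.
rewrite inE/= in_itv/= => xa; rewrite -lerBlDr.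
apply: le_trans (logistic_lower _); rewrite lerD2l lerN2.
apply: le_trans (expRN_small eta0); rewrite ler_expR -deE -mulrN ler_wpM2l ?(ltW de0)//.
by lra.
Qed.

Lemma logistic_le_indic (x : R) : L x <= \1_(`]-oo, a + d] : set R) x + eta.
Proof.
rewrite indicE; case: (boolP (x \in _)) => [_|]; last first.
  rewrite notin_setE/= in_itv/= => /negP; rewrite -ltNge => xa.
  rewrite add0r; apply: le_trans (logistic_upper _) _.
  apply: le_trans (expRN_small eta0); rewrite ler_expR lerN2 -deE ler_wpM2l ?(ltW de0)//.
  by lra.
by rewrite (le_trans (ltW (logistic_lt1 _)))// lerDl ltW.
Qed.

End logistic_sandwich.

Section criterion.
Context {dO : measure_display} {Omega : measurableType dO} {R : realType}.
Context (P : probability Omega R).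

Lemma Rintegral_prob_indic d (T : measurableType d) (Q : probability T R) (A : set T) :
  measurable A -> bmeas (\1_A : T -> R) /\ \int[Q]_x \1_A x = fine (Q A).
Proof.
move=> mA; split; last first.
  by rewrite /Rintegral integral_indic// setIT.
split; first exact: measurable_indic.
exists 1 => x; rewrite indicE.
by case: (x \in A); rewrite ?normr1 ?normr0.
Qed.

Let bmeasR (u : R -> R) : bmeas u -> @bmeas _ (measurableTypeR R) R u.
Proof. by case. Qed.

(** Logistics centered at [t + d] and [t - d] sandwich the distribution functions of [Z n] and of
    [nu]; passing back and forth costs a shift by [2 * d], harmless at a continuity point. *)
Lemma cvg_in_distribution_logistic (Z : nat -> Omega -> R)
    (nu : probability (measurableTypeR R) R) :
  (forall n, measurable_fun setT (Z n)) ->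
  (forall eps a : R, 0 < eps ->
    \int[P]_w logistic (eps^-1 * (Z n w - a)) @[n --> \oo] -->
    \int[nu]_x logistic (eps^-1 * (x - a))) ->
  cvg_in_distribution P Z nu.
Proof.
move=> mZ H; split => // t ct.
pose F (s : R) := fine (nu `]-oo, s]%classic).
pose p n := fine (P [set w | Z n w <= t]).
have mitv (s : R) : measurable (`]-oo, s]%classic : set R) by exact: measurable_itv.
have mpre n (s : R) : measurable [set w | Z n w <= s].
  rewrite -[X in measurable X]setTI (_ : [set w | _] = Z n @^-1` `]-oo, s]%classic).
    exact: mZ.
  by apply/seteqP; split => w /=; rewrite in_itv.
have nuF s : nu `]-oo, s]%classic = (F s)%:E.
  by rewrite /F fineK// fin_num_measure.
rewrite nuF (_ : (fun n => _) = (fun n => (p n)%:E)); last first.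
  by apply/funext => n; rewrite /p fineK// fin_num_measure.
apply: cvg_EFin; first exact: nearW.
have ctF : {for t, continuous F}.
  apply: fine_cvg => /=; rewrite /F fineK; last by rewrite fin_num_measure.
  exact: ct.
have nuI s : \int[nu]_x \1_(`]-oo, s] : set R) x = F s.
  by have [_ ->] := Rintegral_prob_indic nu (mitv s).
have nub s : @bmeas _ (measurableTypeR R) R (\1_(`]-oo, s] : set R)).
  by have [] := Rintegral_prob_indic nu (mitv s).
have PI n s : \int[P]_w \1_(`]-oo, s] : set R) (Z n w) = fine (P [set w | Z n w <= s]).
  have [_ <-] := Rintegral_prob_indic P (mpre n s).
  by apply: eq_Rintegral => w _; rewrite !indicE; congr (_%:R); apply/idP/idP;
    rewrite !inE/= in_itv.
have Pb n s : bmeas (fun w => \1_(`]-oo, s] : set R) (Z n w) : R).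
  apply: (bmeas_comp (F := \1_(`]-oo, s] : set R))) => //.
  by have [] := Rintegral_prob_indic nu (mitv s).
have bL eps a : bmeas (fun x : R => logistic (eps^-1 * (x - a))) := bmeas_logistic eps a.
have PbL n eps a : bmeas (fun w => logistic (eps^-1 * (Z n w - a))).
  exact: (bmeas_comp (bL eps a)).
have nubL eps a := bmeasR (bL eps a).
apply/cvgrPdist_le => e e0.
(* Error budget: [e / 8] for each of the two sandwich steps and for the assumed convergence, and
   [e / 4] for continuity at [t], in total [5 e / 8]. *)
have e8 : 0 < e / 8 by rewrite divr_gt0.
have e4 : 0 < e / 4 by rewrite divr_gt0.
move/cvgrPdist_le : (ctF) => /(_ _ e4) [r /= r0 rF].
pose d := r / 4; have d0 : 0 < d by rewrite divr_gt0.
have dF s : `|t - s| <= 2 * d -> `|F t - F s| <= e / 4.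
  by move=> ts; apply: rF; rewrite /= (le_lt_trans ts)// /d; lra.
have d20 : 0 <= 2 * d by rewrite mulr_ge0// ltW.
have dF1 : F (t + d + d) <= F t + e / 4.
  have h : `|t - (t + d + d)| <= 2 * d.
    by rewrite distrC (_ : t + d + d - t = 2 * d) ?ger0_norm//; ring.
  by have := dF _ h; rewrite ler_norml => /andP[h1 h2]; lra.
have dF2 : F t - e / 4 <= F (t - d - d).
  have h : `|t - (t - d - d)| <= 2 * d.
    by rewrite (_ : t - (t - d - d) = 2 * d) ?ger0_norm//; ring.
  by have := dF _ h; rewrite ler_norml => /andP[h1 h2]; lra.
(* The scale [d * eta] of the sandwich inequalities, with [eta = e / 8]. *)
pose eps := d * (e / 8).
have eps0 : 0 < eps by rewrite mulr_gt0.
have bc : @bmeas _ (measurableTypeR R) R (fun=> e / 8) by exact: bmeas_cst.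
have bcP : bmeas (fun _ : Omega => e / 8) by exact: bmeas_cst.
have addc (u : Omega -> R) : bmeas u ->
    \int[P]_w u w + e / 8 = \int[P]_w (u w + e / 8).
  by move=> bu; rewrite Rint_D// Rintegral_prob_cst.
have addcn (u : measurableTypeR R -> R) : @bmeas _ (measurableTypeR R) R u ->
    \int[nu]_w u w + e / 8 = \int[nu]_w (u w + e / 8).
  by move=> bu; rewrite Rint_D// Rintegral_prob_cst.
have up1 n : p n <= \int[P]_w logistic (eps^-1 * (Z n w - (t + d))) + e / 8.
  have -> : p n = \int[P]_w \1_(`]-oo, t + d - d] : set R) (Z n w).
    by rewrite PI addrK.
  rewrite addc//.
  apply: Rint_le => //; first exact: bmeasD.
  by move=> w; exact: indic_le_logistic.
have up2 : \int[nu]_x logistic (eps^-1 * (x - (t + d))) <= F (t + d + d) + e / 8.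
  rewrite -nuI addcn//.
  apply: Rint_le => //; first exact: bmeasD.
  by move=> w; exact: logistic_le_indic.
have lo1 n : \int[P]_w logistic (eps^-1 * (Z n w - (t - d))) <= p n + e / 8.
  have -> : p n = \int[P]_w \1_(`]-oo, t - d + d] : set R) (Z n w).
    by rewrite PI subrK.
  rewrite addc//.
  apply: Rint_le => //; first exact: bmeasD.
  by move=> w; exact: logistic_le_indic.
have lo2 : F (t - d - d) <= \int[nu]_x logistic (eps^-1 * (x - (t - d))) + e / 8.
  rewrite -nuI addcn//.
  apply: Rint_le => //; first exact: bmeasD.
  by move=> w; exact: indic_le_logistic.
have /cvgrPdist_le/(_ _ e8) c1 := H eps (t + d) eps0.
have /cvgrPdist_le/(_ _ e8) c2 := H eps (t - d) eps0.
apply: filterS2 c1 c2 => n.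
move: (up1 n) (lo1 n) up2 lo2 dF1 dF2; clear -e0.
set a1 := \int[nu]_x _; set b1 := \int[nu]_x _.
set a2 := \int[P]_w _; set b2 := \int[P]_w _.
move=> h7 h8 h1 h2 h9 h10.
rewrite !ler_norml => /andP[h3 h4] /andP[h5 h6].
by apply/andP; split; lra.
Qed.

End criterion.

Section normal_law.
Context {R : realType}.

Lemma normal_law_gavg (v : R) (u : R -> R) : 0 <= v -> bmeas u ->
  \int[normal_law 0 v]_x u x = gavg (Num.sqrt v) u 0.
Proof.
move=> v0 bu; rewrite /normal_law; case: eqVneq => [->|vn0].
  rewrite sqrtr0 gavg0 /Rintegral integral_dirac//=; last first.
    by apply/measurable_EFinP; exact: bu.1.
  by rewrite indicE in_setT mul1r.
have s0 : 0 < Num.sqrt v by rewrite sqrtr_gt0 lt_neqAle eq_sym vn0.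
have [M [buM uM]] := bmeas_ge0 bu.
have bu' : @bmeas _ (measurableTypeR R) R u by case: bu.
have buM' : @bmeas _ (measurableTypeR R) R (fun x => u x + M) by case: buM.
have bM : @bmeas _ (measurableTypeR R) R (fun=> M) by exact: bmeas_cst.
have bs : bmeas (fun t => u (Num.sqrt v * t)) by apply: (bmeas_comp bu); exact: measurable_funM.
have bsM : bmeas (fun t => u (Num.sqrt v * t) + M) by apply: (bmeas_comp buM); exact: measurable_funM.
have bM2 : bmeas (fun _ : R => M) by exact: bmeas_cst.
pose N : probability (measurableTypeR R) R := normal_prob 0 (Num.sqrt v).
rewrite -[LHS]/(\int[N]_x u x).
apply: (@addIr _ M).
have e1 := Rint_D N bu' bM; have e2 := Rint_D (@stdnormal R) bs bM2.
rewrite !Rintegral_prob_cst in e1 e2.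
have -> : gavg (Num.sqrt v) u 0 = \int[@stdnormal R]_t u (Num.sqrt v * t).
  by apply: eq_Rintegral => t _; rewrite add0r.
rewrite -e1 -e2; congr fine.
have mu : measurable_fun setT (fun x => (u x + M)%:E).
  by apply/measurable_EFinP; exact: buM.1.
exact: (normal_prob_stdnormal s0 mu).
Qed.

End normal_law.

(** * Taylor expansion and kernel smoothing *)

Section taylor_rV.
Context {R : realType} {d : nat}.
Implicit Types (F G P : 'rV[R]_d -> R) (x u y : 'rV[R]_d) (i : 'I_d).

(** Polynomials of degree less than [p], generated inductively so that integrals against the kernel
    are computed by induction. The strict bound matches a Taylor remainder of order [p]; for [p = 0]
    only the zero function is left. *)
Inductive polyf (p : nat) : ('rV[R]_d -> R) -> Prop :=
| polyf0 : polyf p (fun=> 0)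
| polyf_monomial (a : R) (m : 'I_d -> nat) : (\sum_i m i < p)%N ->
    polyf p (fun u => a * monomial m u)
| polyfD P Q : polyf p P -> polyf p Q -> polyf p (fun u => P u + Q u).

Lemma polyf_sum p n (Q : 'I_n -> 'rV[R]_d -> R) : (forall j, polyf p (Q j)) ->
  polyf p (fun u => \sum_(j < n) Q j u).
Proof.
elim: n Q => [|n IH] Q pQ.
  rewrite (_ : (fun u => _) = (fun=> 0)); first exact: polyf0.
  by apply/funext => u; rewrite big_ord0.
rewrite (_ : (fun u => _) = (fun u => \sum_(j < n) Q (widen_ord (leqnSn n) j) u + Q ord_max u)).
  by apply: polyfD => //; exact: IH.
by apply/funext => u; rewrite big_ord_recr.
Qed.

Lemma polyf_mulX p q (c : R) i j P : polyf p P -> (j + p <= q)%N ->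
  polyf q (fun u => c * u ord0 i ^+ j * P u).
Proof.
move=> pP jpq; elim: pP => [|a m mp|P1 P2 _ IH1 _ IH2].
- rewrite (_ : (fun u => _) = (fun=> 0)); first exact: polyf0.
  by apply/funext => u; rewrite mulr0.
- rewrite (_ : (fun u => _) = (fun u => (c * a) *
      monomial (fun l => m l + (l == i) * j)%N u)).
    apply: polyf_monomial; rewrite big_split/=.
    have -> : (\sum_(l < d) (l == i) * j)%N = j.
      by rewrite (bigD1 i)//= eqxx mul1n big1 ?addn0// => l /negbTE ->.
    by rewrite addnC (leq_trans _ jpq)// -addnS leq_add2l.
  apply/funext => u; rewrite /monomial.
  under [in RHS]eq_bigr do rewrite exprD.
  rewrite big_split/=.
  have -> : \prod_(l < d) u ord0 l ^+ ((l == i) * j) = u ord0 i ^+ j.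
    rewrite (bigD1 i)//= eqxx mul1n big1 ?mulr1// => l /negbTE ->.
    by rewrite mul0n expr0.
  by ring.
- rewrite (_ : (fun u => _) = (fun u => c * u ord0 i ^+ j * P1 u + c * u ord0 i ^+ j * P2 u)).
    exact: polyfD.
  by apply/funext => u; rewrite mulrDr.
Qed.

Lemma is_derive_line F x i (s : R) : derivable F (x + s *: std_basis i) (std_basis i) ->
  is_derive s 1 (fun s => F (x + s *: std_basis i)) ('D_(std_basis i) F (x + s *: std_basis i)).
Proof.
set e := std_basis i => dF.
have E : (fun h : R => h^-1 *: (((fun s => F (x + s *: e)) \o shift s) (h *: 1) - F (x + s *: e)))
  = (fun h : R => h^-1 *: ((F \o shift (x + s *: e)) (h *: e) - F (x + s *: e))).
  apply/funext => h /=; congr (_ *: (F _ - _)).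
  have -> : h *: (1 : R) = h by rewrite /GRing.scale/= mulr1.
  by rewrite scalerDl addrCA.
by apply: DeriveDef; rewrite /derivable /derive E.
Qed.

Lemma bounded_partials_nseq p F i j : (j <= p)%N -> bounded_partials p F ->
  bounded_partials (p - j) (iter_partial (nseq j i) F).
Proof.
have E s : iter_partial s (iter_partial (nseq j i) F) = iter_partial (s ++ nseq j i) F.
  by rewrite /iter_partial foldr_cat.
move=> jp [dF bF]; split => [s k x sp|s sp].
  by rewrite E; apply: dF; rewrite size_cat size_nseq addnC -ltn_subRL.
by rewrite E; apply: bF; rewrite size_cat size_nseq sp subnK.
Qed.

Lemma bounded_fun_le F : bounded_fun F -> exists2 M : R, 0 <= M & forall x, `|F x| <= M.
Proof.
move=> [M [Mr bM]]; exists (`|M| + 1); first by rewrite addr_ge0.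
by move=> x; apply: bM => //; rewrite (le_lt_trans (ler_norm _))// ltrDl.
Qed.

(* [taylor_trunc] expands along one coordinate at a time: [trunc k u] keeps the
   first [k] coordinates. *)
Definition trunc (k : nat) u : 'rV[R]_d := \row_i (if (i < k)%N then u ord0 i else 0).

Lemma truncS u i : trunc i.+1 u = trunc i u + u ord0 i *: std_basis i.
Proof.
apply/rowP => l; rewrite !mxE eqxx/= ltnS leq_eqVlt.
have [->|li] := eqVneq l i; first by rewrite eqxx/= ltnn add0r mulr1.
by rewrite (_ : (_ == _ :> nat) = false) ?mulr0 ?addr0//; apply/negbTE.
Qed.

Lemma le_norm_coord u i : `|u ord0 i| <= `|u|.
Proof.
rewrite [leRHS]/Num.norm/= mx_normrE.
by apply: (le_bigmax _ (fun ij : 'I_1 * 'I_d => `|u ij.1 ij.2|) (ord0, i)).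
Qed.

(** The one-variable expansion in coordinate [k] has as coefficients the [j]-th partial derivatives
    at the truncated point, which the induction hypothesis expands to order [p - j]; hence the
    generality in [F] and [p]. Only derivatives along coordinate lines enter, and [M] is uniform in
    [x]. *)
Lemma taylor_trunc (k : nat) : (k <= d)%N -> forall p F, bounded_partials p F ->
  exists2 M : R, 0 <= M & forall x, exists2 P, polyf p P &
    forall u, `|F (x + trunc k u) - P u| <= M * `|u| ^+ p.
Proof.
elim: k => [|k IH] kd p F bF.
  have t0 u : trunc 0 u = 0 by apply/rowP => i; rewrite !mxE.
  case: p bF => [[_ bF]|p bF].
    have [M M0 FM] := bounded_fun_le (bF [::] erefl).
    exists M => // x; exists (fun=> 0); first exact: polyf0.
    by move=> u; rewrite t0 addr0 subr0 expr0 mulr1.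
  exists 0 => // x; exists (fun u => F x * monomial (fun=> 0%N) u).
    by apply: polyf_monomial; rewrite big1.
  move=> u; rewrite t0 addr0 /monomial big1 ?mulr1 ?subrr ?normr0 ?mul0r// => i _.
pose i := Ordinal kd.
pose G j := iter_partial (nseq j i) F.
have [M1 M10 GM1] := bounded_fun_le (bF.2 (nseq p i) (size_nseq _ _)).
have /choice [Mj HMj] : forall j : 'I_p, exists M, 0 <= M /\ forall x, exists2 P, polyf (p - j) P &
    forall u, `|G j (x + trunc k u) - P u| <= M * `|u| ^+ (p - j).
  move=> j; have [M M0 HM] := IH (ltnW kd) _ _ (bounded_partials_nseq i (ltnW (ltn_ord j)) bF).
  by exists M.
exists (M1 + \sum_(j < p) Mj j / j`!%:R).
  by rewrite addr_ge0// sumr_ge0// => j _; rewrite divr_ge0// (HMj j).1.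
move=> x.
have /choice [Pj HPj] : forall j : 'I_p, exists P, polyf (p - j) P /\
    forall u, `|G j (x + trunc k u) - P u| <= Mj j * `|u| ^+ (p - j).
  by move=> j; have [P pP hP] := (HMj j).2 x; exists P.
exists (fun u => \sum_(j < p) j`!%:R^-1 * u ord0 i ^+ j * Pj j u).
  apply: polyf_sum => j; apply: (polyf_mulX _ _ (HPj j).1).
  by rewrite subnKC// ltnW.
move=> u; rewrite (truncS u i) addrA.
set y := x + trunc k u; set t := u ord0 i.
have tu : `|t| <= `|u| := le_norm_coord u i.
have dT j (s : R) : (j < p)%N ->
    is_derive s 1 (fun s => G j (y + s *: std_basis i)) (G j.+1 (y + s *: std_basis i)).
  by move=> jp; apply: is_derive_line; apply: bF.1; rewrite size_nseq.
have T1 := @taylor_bound R p (fun j s => G j (y + s *: std_basis i)) M1 0 t dT (fun s => GM1 _).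
rewrite add0r in T1.
rewrite mulrDl -(subrKA (tpoly p (fun j => G j (y + 0 *: std_basis i)) t)).
rewrite (le_trans (ler_normD _ _))// lerD//.
  rewrite (le_trans T1)// ler_wpM2l// lerXn2r ?nnegrE//.
rewrite /tpoly -sumrB (le_trans (ler_norm_sum _ _ _))// mulr_suml.
apply: ler_sum => j _; rewrite scale0r addr0.
have f0 : 0 < j`!%:R :> R by rewrite ltr0n fact_gt0.
rewrite (_ : _ - _ = t ^+ j / j`!%:R * (G j y - Pj j u)); last by rewrite /y; ring.
rewrite !normrM normrX normfV (gtr0_norm f0).
rewrite [leLHS]mulrAC [leRHS]mulrAC ler_wpM2r ?invr_ge0 ?(ltW f0)//.
have := (HPj j).2 u; rewrite -/y => h.
rewrite (@le_trans _ _ (`|u| ^+ j * (Mj j * `|u| ^+ (p - j))))//.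
  by rewrite ler_pM// lerXn2r ?nnegrE.
by rewrite mulrCA -exprD subnKC// ltnW.
Qed.

Lemma taylor_rV p F : bounded_partials p F ->
  exists2 M : R, 0 <= M & forall x, exists2 P, polyf p P &
    forall u, `|F (x + u) - P u| <= M * `|u| ^+ p.
Proof.
move=> bF; have [M M0 H] := taylor_trunc (leqnn d) bF.
exists M => // x; have [P pP hP] := H x; exists P => // u.
have E : trunc d u = u by apply/rowP => i; rewrite mxE ltn_ord.
by have := hP u; rewrite E.
Qed.

End taylor_rV.

(** * Real-valued integrals, affine substitution and densities *)

Section real_change_of_variables.
Context {R : realType} {d : nat}.
Local Notation lam := (@lebesgue_rV R d).

Lemma integrable_affine (a : 'rV[R]_d) (b : R) (F : 'rV[R]_d -> R) : 0 < b ->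
  lam.-integrable setT (EFin \o F) ->
  lam.-integrable setT (EFin \o (fun u => F (a + b *: u))).
Proof.
move=> b0 /integrableP[mF iF].
have mG : measurable_fun setT (EFin \o (fun u => F (a + b *: u))).
  exact: (measurableT_comp mF (measurable_affine_rV a b)).
apply/integrableP; split => //.
have mN : measurable_fun setT (fun x => `|(EFin \o F) x|)%E by exact: measurableT_comp.
have h := lebesgue_rV_integral_affine a b0 mN (fun x => abse_ge0 _).
have bd0 : 0 < b ^+ d by rewrite exprn_gt0.
have -> : (\int[lam]_u `|(EFin \o (fun u => F (a + b *: u)%R)) u| =
    ((b ^+ d)^-1)%:E * \int[lam]_x `|(EFin \o F) x|)%E.
  by rewrite -h muleA -EFinM mulVf ?mul1e// gt_eqF.
by rewrite lte_mul_pinfty// lee_fin invr_ge0 ltW.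
Qed.

Lemma Rint_affine (a : 'rV[R]_d) (b : R) (F : 'rV[R]_d -> R) : 0 < b ->
  lam.-integrable setT (EFin \o F) ->
  \int[lam]_x F x = b ^+ d * \int[lam]_u F (a + b *: u)%R.
Proof.
move=> b0 iF; have iG := integrable_affine a b0 iF.
have mF : measurable_fun setT (EFin \o F) by case/integrableP: iF.
have h1 := lebesgue_rV_integral_affine a b0 (measurable_funepos mF) (fun x => funepos_ge0 _ x).
have h2 := lebesgue_rV_integral_affine a b0 (measurable_funeneg mF) (fun x => funeneg_ge0 _ x).
have fp := integrable_fin_num measurableT (integrable_funepos measurableT iG).
have fn := integrable_fin_num measurableT (integrable_funeneg measurableT iG).
rewrite /Rintegral integralE [in RHS]integralE.
rewrite -[X in fine (X - _)]h1 -[X in fine (_ - X)]h2.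
have -> : (\int[lam]_u (EFin \o F)^\+ (a + b *: u)%R =
  \int[lam]_u (fun u => (F (a + b *: u)%R)%:E)^\+ u)%E.
  by apply: eq_integral => u _; rewrite !funeposE.
have -> : (\int[lam]_u (EFin \o F)^\- (a + b *: u)%R =
  \int[lam]_u (fun u => (F (a + b *: u)%R)%:E)^\- u)%E.
  by apply: eq_integral => u _; rewrite !funenegE.
have alg (k : R) (p n : \bar R) : p \is a fin_num -> n \is a fin_num ->
    fine (k%:E * p - k%:E * n)%E = k * fine (p - n)%E.
  by case: p => [p||] //; case: n => [n||] //= _ _; rewrite mulrBr.
exact: alg.
Qed.

Context {dO : measure_display} {Omega : measurableType dO} (P : probability Omega R).
Variables (X : {RV P >-> 'rV[R]_d}) (f : 'rV[R]_d -> R).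
Hypothesis Xf : has_density X f.

Let mf : measurable_fun setT f. Proof. by case: Xf. Qed.
Let f0 x : 0 <= f x. Proof. by case: Xf. Qed.

Lemma ge0_density (F : 'rV[R]_d -> \bar R) :
  measurable_fun setT F -> (forall x, 0 <= F x)%E ->
  (\int[P]_w F (X w) = \int[lam]_x (F x * (f x)%:E))%E.
Proof.
move=> mF F0; have <- := @ge0_integral_distribution _ _ _ _ _ P X F mF F0.
by apply: ge0_integral_density => //; case: Xf.
Qed.

Lemma integrable_density : lam.-integrable setT (EFin \o f).
Proof.
apply/integrableP; split; first exact/measurable_EFinP.
have := ge0_density (@measurable_cst _ _ _ _ setT 1%E) (fun=> lee01).
rewrite integral_cst// [X in (_ * X)%E](@probability_setT _ _ _ P) mul1e => h.
under eq_integral do rewrite /= ger0_norm// -[X in X%:E]mul1r EFinM.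
by rewrite -h ltry.
Qed.

Lemma integrable_mul_density (F : 'rV[R]_d -> R) : bmeas F ->
  lam.-integrable setT (EFin \o (fun x => F x * f x)).
Proof.
move=> bF; have [M M0 FM] := bmeas_bound bF.
apply: (@le_integrable _ _ _ lam _ measurableT _ (fun x => (M * f x)%:E)).
- by apply/measurable_EFinP; apply: measurable_funM => //; exact: bF.1.
- by move=> x _ /=; rewrite lee_fin !normrM (ger0_norm (f0 x)) ler_wpM2r// (gtr0_norm M0).
- exact: (integrable_realZ M integrable_density).
Qed.

Lemma Rint_density (F : 'rV[R]_d -> R) : bmeas F ->
  \int[P]_w F (X w) = \int[lam]_x (F x * f x).
Proof.
move=> bF; have mF : measurable_fun setT (EFin \o F) by apply/measurable_EFinP; exact: bF.1.
rewrite /Rintegral integralE [in RHS]integralE.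
have -> : (\int[P]_w (fun w => (F (X w))%:E)^\+ w = \int[P]_w (EFin \o F)^\+ (X w))%E.
  by apply: eq_integral => w _; rewrite !funeposE.
have -> : (\int[P]_w (fun w => (F (X w))%:E)^\- w = \int[P]_w (EFin \o F)^\- (X w))%E.
  by apply: eq_integral => w _; rewrite !funenegE.
have -> := ge0_density (measurable_funepos mF) (fun x => funepos_ge0 _ x).
have -> := ge0_density (measurable_funeneg mF) (fun x => funeneg_ge0 _ x).
congr (fine (_ - _)); apply: eq_integral => x _.
  by rewrite !funeposE -EFin_max -EFinM maxr_pMl// mul0r EFin_max.
by rewrite !funenegE -!EFinN -EFin_max -EFinM maxr_pMl// mul0r EFin_max mulNr.
Qed.

End real_change_of_variables.

Lemma continuous_measurable_rV (R : realType) (n : nat) (F : 'rV[R]_n -> R) :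
  continuous F -> measurable_fun setT F.
Proof.
move=> cF; apply: (measurability _ (RGenOInfty.measurableE R)) => //.
move=> _ [_ [a ->] <-]; rewrite setTI; apply: open_measurable_rV.
by apply: open_comp => // x _; exact: cF.
Qed.

(** * Bias of kernel smoothing *)

Section kernel_smoothing.
Context {R : realType} {d : nat}.
Local Notation lam := (@lebesgue_rV R d).
Implicit Types (u x : 'rV[R]_d) (m : 'I_d -> nat).

Lemma monomialZ m (c : R) u : monomial m (c *: u) = c ^+ (\sum_i m i) * monomial m u.
Proof.
rewrite /monomial -prodrXr -big_split/=.
by apply: eq_bigr => i _; rewrite mxE exprMn.
Qed.

Lemma monomial0 m : (0 < \sum_i m i)%N -> monomial m (0 : 'rV[R]_d) = 0.
Proof.
move=> m0; have := monomialZ m 0 0.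
by rewrite scale0r expr0n gtn_eqF// mul0r.
Qed.

Lemma monomial_le m u : `|monomial m u| <= `|u| ^+ (\sum_i m i).
Proof.
rewrite /monomial normr_prod -prodrXr; apply: ler_prod => i _.
by rewrite normr_ge0 normrX lerXn2r ?nnegrE// le_norm_coord.
Qed.

Lemma polyf_lip0 p P : polyf p P -> exists2 C : R, 0 <= C &
  forall u : 'rV[R]_d, `|u| <= 1 -> `|P u - P 0| <= C * `|u|.
Proof.
elim=> [|a m mp|P1 P2 _ [C1 C10 H1] _ [C2 C20 H2]].
- by exists 0 => // u _; rewrite subrr normr0 mul0r.
- exists `|a| => // u u1; have [m0|m0] := posnP (\sum_i m i)%N.
    have E v : monomial m v = 1 :> R.
      rewrite /monomial big1// => i _.
      move/eqP : m0; rewrite sum_nat_eq0 => /forallP/(_ i)/implyP/(_ isT)/eqP ->.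
      by rewrite expr0.
    by rewrite !E subrr normr0 mulr_ge0.
  rewrite monomial0// mulr0 subr0.
  rewrite normrM ler_wpM2l// (le_trans (monomial_le _ _))//.
  by rewrite -(prednK m0) exprSr ler_piMl// exprn_ile1.
- exists (C1 + C2); first by rewrite addr_ge0.
  move=> u u1; rewrite opprD addrACA (le_trans (ler_normD _ _))// mulrDl.
  by rewrite lerD ?H1 ?H2.
Qed.

Lemma norm_pow_le p u : (0 < p)%N -> `|u| ^+ p <= \sum_i `|u ord0 i| ^+ p.
Proof.
move=> p0; set S := \sum_i _.
have S0 : 0 <= S by apply: sumr_ge0.
have Si i : `|u ord0 i| ^+ p <= S by rewrite /S (bigD1 i)//= lerDl sumr_ge0.
rewrite /Num.norm/= mx_normrE.
apply: (big_ind (fun x : R => x ^+ p <= S)).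
- by rewrite expr0n gtn_eqF.
- by move=> x y xS yS; rewrite /Num.max; case: ifP.
- by move=> [i j] _ /=; rewrite ord1.
Qed.

Variables (r : nat) (K : 'rV[R]_d -> R).
Hypothesis r1 : (1 <= r)%N.
Hypothesis Kr : kernel_order r K.

Lemma kernel_integrable : lam.-integrable setT (EFin \o K).
Proof. by case: Kr. Qed.

Lemma kernel_measurable : measurable_fun setT K.
Proof. by apply/measurable_EFinP; case/integrableP: kernel_integrable. Qed.

(** Every non-constant monomial of degree less than [r] integrates to zero against [K], and [K] has
    integral [1]: only the constant term survives. *)
Lemma kernel_poly P (h : R) : polyf r P ->
  lam.-integrable setT (EFin \o (fun u => K u * P (h *: u))) /\
  \int[lam]_u (K u * P (h *: u)) = P 0.
Proof.
have [iK K1 Km] := Kr.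
elim=> [|a m mp|P1 P2 _ [i1 e1] _ [i2 e2]].
- have -> : (fun u => K u * 0) = (fun=> 0) by apply/funext => u; rewrite mulr0.
  split; first exact: integrable0.
  by rewrite /Rintegral integral0.
- have [m0|m0] := posnP (\sum_i m i)%N.
    have E v : monomial m v = 1 :> R.
      rewrite /monomial big1// => i _.
      move/eqP : m0; rewrite sum_nat_eq0 => /forallP/(_ i)/implyP/(_ isT)/eqP ->.
      by rewrite expr0.
    have -> : (fun u => K u * (a * monomial m (h *: u))) = (fun u => a * K u).
      by apply/funext => u; rewrite E mulr1 mulrC.
    split; first exact: integrable_realZ.
    by rewrite RintegralZl// K1 E.
  have [im em] := Km m (introT andP (conj m0 (ltnW mp))).
  have -> : (fun u => K u * (a * monomial m (h *: u))) =
      (fun u => (a * h ^+ (\sum_i m i)) * (monomial m u * K u)).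
    by apply/funext => u; rewrite monomialZ; ring.
  split; first exact: integrable_realZ.
  rewrite RintegralZl// em mulr0.
  by rewrite monomial0// mulr0.
- have -> : (fun u => K u * (P1 (h *: u) + P2 (h *: u))) =
     (fun u => K u * P1 (h *: u) + K u * P2 (h *: u)).
    by apply/funext => u; rewrite mulrDr.
  split; first exact: integrable_realD.
  by rewrite RintegralD// e1 e2.
Qed.

(** The [r]-th power of the sup norm is at most the sum of the [r]-th powers of the coordinates,
    pure monomials of degree [r] whose integrability against [K] is part of [kernel_order]. *)
Lemma kernel_norm_integrable :
  lam.-integrable setT (EFin \o (fun u => `|K u| * `|u| ^+ r)).
Proof.
have [iK K1 Km] := Kr.
pose mi (i l : 'I_d) := ((l == i) * r)%N.
have smi i : (\sum_l mi i l)%N = r.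
  by rewrite /mi (bigD1 i)//= eqxx mul1n big1 ?addn0// => l /negbTE ->.
have mmi i u : monomial (mi i) u = u ord0 i ^+ r.
  rewrite /monomial /mi (bigD1 i)//= eqxx mul1n big1 ?mulr1// => l /negbTE ->.
  by rewrite mul0n expr0.
have ii i : lam.-integrable setT (EFin \o (fun u => monomial (mi i) u * K u)).
  by apply: (proj1 (Km (mi i) _)); rewrite smi r1 leqnn.
apply: (@le_integrable _ _ _ lam _ measurableT _
  (fun u => \sum_i `|(monomial (mi i) u * K u)%:E|)%E).
- apply/measurable_EFinP; apply: measurable_funM.
    exact: (measurableT_comp (@normr_measurable _ setT) kernel_measurable).
  apply: measurable_funX; apply: continuous_measurable_rV.
  exact: norm_continuous.
- move=> u _ /=; rewrite sumEFin lee_fin normrM normr_id normrX normr_id.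
  rewrite [leRHS]ger0_norm; last by apply: sumr_ge0.
  apply: (@le_trans _ _ (\sum_i `|u ord0 i| ^+ r * `|K u|)).
    by rewrite -mulr_suml mulrC ler_wpM2r// norm_pow_le.
  by apply: ler_sum => i _; rewrite mmi normrM normrX.
- by apply: integrable_sum => // i _; exact: (integrable_abse (ii i)).
Qed.

Variables (f : 'rV[R]_d -> R) (F : R).
Hypothesis mf : measurable_fun setT f.
Hypothesis fF : forall x, `|f x| <= F.
Hypothesis bpf : bounded_partials r f.

(** Convolution with the rescaled kernel [h^-d K (./h)], after the substitution [y = x + h u], which
    leaves no negative power of [h]. *)
Definition smooth (G : 'rV[R]_d -> R) (h : R) (x : 'rV[R]_d) :=
  \int[lam]_u (K u * G (x + h *: u)).

Lemma integrable_kernel_mul (G : 'rV[R]_d -> R) (M : R) :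
  measurable_fun setT G -> (forall u, `|G u| <= M) ->
  lam.-integrable setT (EFin \o (fun u => K u * G u)).
Proof.
move=> mG GM.
apply: (@le_integrable _ _ _ lam _ measurableT _ (fun u => M%:E * `|(K u)%:E|)%E).
- by apply/measurable_EFinP; apply: measurable_funM => //; exact: kernel_measurable.
- move=> u _ /=; rewrite lee_fin !normrM normr_id mulrC ler_wpM2r//.
  by rewrite (le_trans (GM u))// ler_norm.
- by apply: integrableZl => //; exact: (integrable_abse kernel_integrable).
Qed.

Lemma measurable_line (G : 'rV[R]_d -> R) (h : R) (x : 'rV[R]_d) :
  measurable_fun setT G -> measurable_fun setT (fun u => G (x + h *: u)).
Proof. by move=> mG; exact: (measurableT_comp mG (measurable_affine_rV x h)). Qed.

(** The kernel integrates the Taylor polynomial to its value at [0], which is [f x] since the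
    remainder vanishes there; the remainder contributes [M * h^r] times the moment of
    [|K u| * |u|^r]. *)
Lemma smooth_bias : exists2 C : R, 0 <= C &
  forall (h : R) x, 0 <= h -> `|smooth f h x - f x| <= C * h ^+ r.
Proof.
have [M M0 HM] := taylor_rV bpf.
exists (M * \int[lam]_u (`|K u| * `|u| ^+ r)).
  by rewrite mulr_ge0// Rintegral_ge0// => u _; rewrite mulr_ge0// exprn_ge0.
move=> h x h0; have [P pP HP] := HM x.
have P0 : P 0 = f x.
  have := HP 0; rewrite addr0 normr0 expr0n gtn_eqF// mulr0 normr_le0 subr_eq0.
  by move/eqP.
have [iP eP] := kernel_poly h pP.
have iF : lam.-integrable setT (EFin \o (fun u => K u * f (x + h *: u))).
  by apply: (@integrable_kernel_mul _ F) => //; exact: measurable_line.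
have ifP : lam.-integrable setT (EFin \o (fun u => K u * f (x + h *: u) - K u * P (h *: u))).
  exact: integrable_realB.
rewrite -P0 -eP /smooth -RintegralB//.
apply: (le_trans (le_normr_Rintegral measurableT ifP)).
rewrite mulrAC -RintegralZl//; last exact: kernel_norm_integrable.
apply: le_Rintegral => //.
- exact: (integrable_abse ifP).
- exact: integrable_realZ kernel_norm_integrable.
- move=> u _ /=; rewrite -mulrBr normrM mulrCA ler_wpM2l//.
  apply: (le_trans (HP (h *: u))).
  by rewrite normrZ (ger0_norm h0) exprMn mulrA.
Qed.

(** The source of the continuity of [f], which existence of partial derivatives alone would not
    give: near [x] it is a polynomial up to [|u|^r <= |u|]. *)
Lemma bounded_partials_lip x : exists2 C : R, 0 <= C &
  forall u, `|u| <= 1 -> `|f (x + u) - f x| <= C * `|u|.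
Proof.
have [M M0 HM] := taylor_rV bpf; have [P pP HP] := HM x.
have P0 : P 0 = f x.
  have := HP 0; rewrite addr0 normr0 expr0n gtn_eqF// mulr0 normr_le0 subr_eq0.
  by move/eqP.
have [C C0 HC] := polyf_lip0 pP.
exists (M + C); first by rewrite addr_ge0.
move=> u u1; rewrite -P0 -(subrKA (P u)) (le_trans (ler_normD _ _))// mulrDl.
rewrite lerD ?HC// (le_trans (HP u))// ler_wpM2l//.
by rewrite -(prednK r1) exprSr ler_piMl// exprn_ile1.
Qed.

Lemma smooth_bounded (G : 'rV[R]_d -> R) (M h : R) x :
  measurable_fun setT G -> (forall u, `|G u| <= M) ->
  `|smooth G h x| <= M * \int[lam]_u `|K u|.
Proof.
move=> mG GM.
have iF : lam.-integrable setT (EFin \o (fun u => K u * G (x + h *: u))).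
  by apply: (@integrable_kernel_mul _ M) => //; exact: measurable_line.
apply: (le_trans (le_normr_Rintegral measurableT iF)).
have iK := integrable_abse kernel_integrable.
rewrite -RintegralZl//; apply: le_Rintegral => //.
- exact: (integrable_abse iF).
- exact: (integrable_realZ M iK).
- by move=> u _ /=; rewrite normrM mulrC ler_wpM2r.
Qed.

End kernel_smoothing.

(** * Continuity of translations *)

Lemma Rintegral_dct d (T : measurableType d) (R : realType)
    (mu : {measure set T -> \bar R}) (f_ : nat -> T -> R) (f g : T -> R) :
  (forall n, measurable_fun setT (f_ n)) ->
  (forall x, f_ n x @[n --> \oo] --> f x) ->
  (forall n x, `|f_ n x| <= g x) -> mu.-integrable setT (EFin \o g) ->
  \int[mu]_x f_ n x @[n --> \oo] --> \int[mu]_x f x.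
Proof.
move=> mf_ ff fg ig.
have mfE n : measurable_fun setT (EFin \o f_ n) by exact/measurable_EFinP.
have cfE x : (f_ n x)%:E @[n --> \oo] --> (f x)%:E.
  by apply: cvg_EFin; [exact: nearW|exact: ff].
have H := @dominated_cvg _ _ _ mu setT measurableT (fun n => EFin \o f_ n)
  (EFin \o f) (EFin \o g) mfE (fun x _ => cfE x) (fun x _ => isT) ig
  (fun n x _ => fg n x).
have mfl : measurable_fun setT (EFin \o f).
  apply: (@emeasurable_fun_cvg _ _ _ _ (fun n => EFin \o f_ n)) => //.
  by move=> x _; exact: cfE.
have fint : (\int[mu]_x (f x)%:E)%E \is a fin_num.
  apply: integrable_fin_num => //.
  apply: (le_integrable measurableT mfl _ ig) => x _ /=; rewrite lee_fin.
  rewrite [leRHS]ger0_norm; last by rewrite (le_trans _ (fg 0%N x)).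
  have cx : `|f_ n x| @[n --> \oo] --> `|f x| by apply: cvg_norm; exact: ff.
  rewrite -(cvg_lim _ cx)//; apply: limr_le; first by apply/cvg_ex; exists `|f x|.
  by apply: nearW => n; exact: fg.
by apply: fine_cvg; rewrite fineK.
Qed.

Section translation.
Context {R : realType} {d : nat}.
Local Notation lam := (@lebesgue_rV R d).
Implicit Types (u y t : 'rV[R]_d).

(** The norm is the sup norm, so the ball lies in a box of finite measure. *)
Lemma integrable_indic_ball (N : R) :
  lam.-integrable setT (EFin \o (\1_[set y : 'rV[R]_d | `|y| <= N] : _ -> R)) /\
  measurable [set y : 'rV[R]_d | `|y| <= N].
Proof.
set B := [set y | _].
have mB : measurable B.
  have h := continuous_measurable_rV (@norm_continuous _ 'rV[R]_d).
  rewrite (_ : B = setT `&` Num.norm @^-1` `]-oo, N]%classic); first exact: h.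
  by rewrite setTI; apply/seteqP; split => y /=; rewrite in_itv.
split => //.
pose A := [set v : 'rV[R]_d | forall i, `[- N, N]%classic (v ord0 i)].
have mA : measurable A.
  rewrite (_ : A = \bigcap_(i in [set: 'I_d]) (fun v : 'rV[R]_d => v ord0 i) @^-1` `[- N, N]%classic).
    apply: fin_bigcap_measurable => // i _; rewrite -[X in measurable X]setTI.
    by apply: measurable_rV_coord => //; exact: measurable_itv.
  by apply/seteqP; split=> [v Av i _|v Av i]; exact: Av.
have lA : (lam A < +oo)%E.
  have -> : lam A = _ := @lebesgue_rV_box R d (fun=> `[- N, N]%classic) (fun=> measurable_itv _).
  rewrite ltey_eq; apply/orP; left.
  apply: (big_ind (fun z : \bar R => z \is a fin_num)) => //.
    by move=> x y; exact: fin_numM.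
  by move=> i _; rewrite lebesgue_measure_itv/=; case: ifP.
have BA : B `<=` A.
  move=> y /= yN i; rewrite /= in_itv/= -ler_norml.
  exact: le_trans (le_norm_coord y i) yN.
apply/integrableP; split; first by apply/measurable_EFinP; exact: measurable_indic.
rewrite (eq_integral (fun y => (\1_B y)%:E)); last first.
  by move=> y _; rewrite /= ger0_norm// indicE.
rewrite integral_indic// setIT; apply: le_lt_trans lA.
by apply: le_measure; rewrite ?inE.
Qed.

Variables (Q : set 'rV[R]_d) (q : 'rV[R]_d -> R) (N M : R).
Hypothesis cQ : closed Q.
Hypothesis QN : forall y, Q y -> `|y| <= N.
Hypothesis mq : measurable_fun setT q.
Hypothesis qM : forall y, `|q y| <= M.
Hypothesis q0 : forall y, ~ Q y -> q y = 0.
Hypothesis qc : forall y, Q y -> forall e : R, 0 < e -> exists2 del : R, 0 < del &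
  forall u, `|u| < del -> Q (y + u) -> `|q (y + u) - q y| <= e.

Let mQ : measurable Q.
Proof. by rewrite -[Q]setCK; apply: measurableC; apply: open_measurable_rV; exact: closed_openC. Qed.

Let iQ : 'rV[R]_d -> R := \1_Q.

Let iQE y : (Q y /\ iQ y = 1) \/ (~ Q y /\ iQ y = 0).
Proof.
rewrite /iQ indicE; case: (boolP (y \in Q)) => [|]; first by rewrite inE; left.
by rewrite notin_setE; right.
Qed.

Let miQ : measurable_fun setT iQ.
Proof. exact: measurable_indic. Qed.

Let M0 : 0 <= M. Proof. by rewrite (le_trans _ (qM 0)). Qed.

Let int_ball N' := (integrable_indic_ball N').1.

Let ballE N' y : `|y| <= N' -> (\1_[set y : 'rV[R]_d | `|y| <= N'] y : R) = 1.
Proof. by move=> h; rewrite indicE mem_set. Qed.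

Let int_iQ : lam.-integrable setT (EFin \o iQ).
Proof.
apply: (le_integrable measurableT _ _ (int_ball N)); first exact/measurable_EFinP.
move=> y _ /=; rewrite lee_fin [leRHS]ger0_norm//.
have [[Qy ->]|[_ ->]] := iQE y; last by rewrite normr0.
by rewrite normr1 ballE// QN.
Qed.

(* No regularity of the boundary of [Q] is needed: by translation invariance the
   points leaving [Q] and those entering it have the same measure, and
   [1_Q (y + tt n) * (1 - 1_Q y)] tends to [0] pointwise because [Q] is closed. *)
Lemma translation_cvg (tt : nat -> 'rV[R]_d) :
  `|tt n| @[n --> \oo] --> (0 : R) ->
  \int[lam]_y `|q (y + tt n) - q y| @[n --> \oo] --> (0 : R).
Proof.
move=> t0.
have [T HT] : exists T : R, forall n, `|tt n| <= T.
  have /cvg_seq_bounded [T0 [_ HT]] : cvgn (fun n => `|tt n|) by apply/cvg_ex; exists 0.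
  exists (`|T0| + 1) => n; have := HT (`|T0| + 1).
  rewrite (le_lt_trans (ler_norm _)) ?ltrDl// => /(_ isT n I) /=.
  by rewrite normr_id.
have mtr (G : 'rV[R]_d -> R) n : measurable_fun setT G ->
    measurable_fun setT (fun y => G (y + tt n)).
  move=> mG; under eq_fun do rewrite addrC -[X in _ + X]scale1r.
  exact: (measurableT_comp mG (measurable_affine_rV (tt n) 1)).
have small (del : R) : 0 < del -> \forall n \near \oo, `|tt n| < del.
  move=> del0; have /cvgrPdist_lt/(_ _ del0) := t0.
  by apply: filterS => n; rewrite sub0r normrN normr_id.
(* [a] is the contribution of the points staying in [Q], where continuity of [q] within [Q] applies;
   [b] indicates the points entering [Q]. *)
pose a n y := iQ y * iQ (y + tt n) * `|q (y + tt n) - q y|.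
pose b n y := iQ (y + tt n) * (1 - iQ y).
have ma n : measurable_fun setT (a n).
  apply: measurable_funM.
    by apply: measurable_funM => //; exact: mtr.
  apply: measurableT_comp => //; apply: measurable_funB => //; exact: mtr.
have mb n : measurable_fun setT (b n).
  apply: measurable_funM; first exact: mtr.
  exact: measurable_funB.
have iQ01 y : 0 <= iQ y <= 1 by have [[_ ->]|[_ ->]] := iQE y; rewrite ?lexx ?ler01.
have ca : \int[lam]_y a n y @[n --> \oo] --> \int[lam]_y (0 : R).
  apply: (Rintegral_dct (g := fun y => 2 * M * iQ y)) => //; last exact: integrable_realZ.
    move=> y; have [[Qy e]|[_ e]] := iQE y; last first.
      rewrite (_ : (fun n => _) = (fun=> 0)); first exact: cvg_cst.
      by apply/funext => n; rewrite /a e !mul0r.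
    apply/cvgrPdist_le => eps eps0.
    have [del del0 Hdel] := qc Qy eps0.
    near=> n; rewrite sub0r normrN /a e mul1r normrM normr_id.
    have [[Qyt ->]|[_ ->]] := iQE (y + tt n); last by rewrite normr0 mul0r ltW.
    by rewrite normr1 mul1r; apply: Hdel => //; near: n; exact: small.
  move=> n y; rewrite /a !normrM normr_id.
  have /andP[h1 h2] := iQ01 y; have /andP[h3 h4] := iQ01 (y + tt n).
  rewrite (ger0_norm h1) (ger0_norm h3).
  rewrite [leLHS](_ : _ = (iQ (y + tt n) * `|q (y + tt n) - q y|) * iQ y); last by ring.
  rewrite ler_wpM2r// (@le_trans _ _ (`|q (y + tt n) - q y|)) ?ler_piMl//.
  rewrite (le_trans (ler_normB _ _))// mulrDl mul1r.
  by rewrite lerD.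
have cb : \int[lam]_y b n y @[n --> \oo] --> \int[lam]_y (0 : R).
  (* A point that a translation of length at most [T] brings into [Q] lies in the ball of radius
     [N + T]. *)
  apply: (Rintegral_dct (g := \1_[set y : 'rV[R]_d | `|y| <= N + T])) => //.
    move=> y; have [[Qy e]|[nQ e]] := iQE y.
      rewrite (_ : (fun n => _) = (fun=> 0)); first exact: cvg_cst.
      by apply/funext => n; rewrite /b e subrr mulr0.
    have /nbhs_ballP[del /= del0 Hdel] : nbhs y (~` Q).
      by apply: open_nbhs_nbhs; split => //; exact: closed_openC.
    apply: cvg_near_cst; near=> n.
    have nQt : ~ Q (y + tt n).
      apply: Hdel; rewrite -ball_normE /= opprD addrA subrr sub0r normrN.
      by near: n; exact: small.
    by rewrite /b; have [[]|[_ ->]] := iQE (y + tt n); rewrite ?mul0r.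
  move=> n y; rewrite /b; have [[Qyt ->]|[_ ->]] := iQE (y + tt n); last first.
    by rewrite mul0r normr0.
  have /andP[h1 h2] := iQ01 y.
  rewrite mul1r ballE; first by rewrite ger0_norm ?subr_ge0// lerBlDr lerDl.
  rewrite -(addrK (tt n) y) (le_trans (ler_normB _ _))// lerD ?HT// QN//.
have bound n : \int[lam]_y `|q (y + tt n) - q y| <= \int[lam]_y a n y + 2 * M * \int[lam]_y b n y.
  pose c y := iQ y * iQ (y + tt n).
  have ib0 : lam.-integrable setT (EFin \o (fun y => iQ (y + tt n))).
    have := integrable_affine (tt n) ltr01 int_iQ.
    by under eq_fun do rewrite scale1r addrC.
  have eb0 : \int[lam]_y iQ (y + tt n) = \int[lam]_y iQ y.
    rewrite (Rint_affine (tt n) ltr01 int_iQ) expr1n mul1r.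
    by apply: eq_Rintegral => y _; rewrite scale1r addrC.
  have ic : lam.-integrable setT (EFin \o c).
    apply: (le_integrable measurableT _ _ int_iQ).
      by apply/measurable_EFinP; apply: measurable_funM => //; exact: mtr.
    move=> y _ /=; rewrite lee_fin /c normrM.
    have /andP[h1 h2] := iQ01 y; have /andP[h3 h4] := iQ01 (y + tt n).
    by rewrite (ger0_norm h1) (ger0_norm h3) ler_piMr.
  have ia : lam.-integrable setT (EFin \o a n).
    apply: (le_integrable measurableT _ _ (integrable_realZ (2 * M) ic)).
      exact/measurable_EFinP.
    move=> y _ /=; rewrite lee_fin /a /c normrM normr_id mulrC [leRHS]normrM ler_wpM2r//.
    rewrite (le_trans (ler_normB _ _))// [leRHS]ger0_norm ?mulr_ge0// mulrDl mul1r.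
    by rewrite lerD.
  have bE : b n = (fun y => iQ (y + tt n) - c y).
    by apply/funext => y; rewrite /b /c; ring.
  have eB : \int[lam]_y b n y = \int[lam]_y iQ y - \int[lam]_y c y.
    by rewrite bE RintegralB// eb0.
  have eB' : \int[lam]_y (iQ y - c y) = \int[lam]_y b n y by rewrite eB RintegralB.
  have ib : lam.-integrable setT (EFin \o b n) by rewrite bE; exact: integrable_realB.
  have ic' : lam.-integrable setT (EFin \o (fun y => iQ y - c y)) by exact: integrable_realB.
  have iMb : lam.-integrable setT (EFin \o (fun y => M * b n y)) by exact: integrable_realZ.
  have iMc : lam.-integrable setT (EFin \o (fun y => M * (iQ y - c y))) by exact: integrable_realZ.
  have iab : lam.-integrable setT (EFin \o (fun y => a n y + M * b n y)) by exact: integrable_realD.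
  have -> : \int[lam]_y a n y + 2 * M * \int[lam]_y b n y =
      \int[lam]_y (a n y + M * b n y + M * (iQ y - c y)).
    by rewrite RintegralD// RintegralD// RintegralZl// RintegralZl// eB'; ring.
  have iall : lam.-integrable setT (EFin \o (fun y => a n y + M * b n y + M * (iQ y - c y))).
    exact: integrable_realD.
  have pw y : `|q (y + tt n) - q y| <= a n y + M * b n y + M * (iQ y - c y).
    rewrite /a /b /c.
    have [[Qy ->]|[nQ ->]] := iQE y; have [[Qyt ->]|[nQt ->]] := iQE (y + tt n).
    - by rewrite [leRHS](_ : _ = `|q (y + tt n) - q y|) //; ring.
    - by rewrite [leRHS](_ : _ = M) ?(q0 nQt) ?sub0r ?normrN//; ring.
    - by rewrite [leRHS](_ : _ = M) ?(q0 nQ) ?subr0//; ring.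
    - by rewrite [leRHS](_ : _ = 0) ?(q0 nQ) ?(q0 nQt) ?subrr ?normr0//; ring.
  apply: le_Rintegral => //.
  apply: (le_integrable measurableT _ _ iall).
    apply/measurable_EFinP; apply: measurableT_comp => //.
    by apply: measurable_funB => //; exact: mtr.
  move=> y _ /=; rewrite lee_fin normr_id (le_trans (pw y))//; exact: ler_norm.
have H0 : \int[lam]_y a n y + 2 * M * \int[lam]_y b n y @[n --> \oo] --> (0 : R).
  rewrite (_ : 0 = \int[lam]_y (0 : R) + 2 * M * \int[lam]_y (0 : R)).
    by apply: cvgD => //; apply: cvgMl_tmp.
  by rewrite /Rintegral integral0/= mulr0 addr0.
apply: (cvg_dist_le _ H0); apply: nearW => n.
by rewrite subr0 ger0_norm// Rintegral_ge0.
Unshelve. all: by end_near. Qed.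

End translation.

Lemma measurable_addZ_rV (R : realType) n d (T : measurableType d)
    (F G : T -> 'rV[R]_n) (h : R) :
  measurable_fun setT F -> measurable_fun setT G ->
  measurable_fun setT (fun z => F z + h *: G z).
Proof.
move=> /measurable_fun_rVP mF /measurable_fun_rVP mG.
apply/measurable_fun_rVP => i; under eq_fun do rewrite !mxE.
by apply: measurable_funD => //; apply: measurable_funM.
Qed.

(** * Mean-square convergence of the smoothing *)

Section smooth_cvg.
Context {R : realType} {d : nat}.
Local Notation lam := (@lebesgue_rV R d).
Context {dO : measure_display} {Omega : measurableType dO} (P : probability Omega R).
Variables (X : {RV P >-> 'rV[R]_d}) (f : 'rV[R]_d -> R) (Fb : R).
Hypothesis Xf : has_density X f.
Hypothesis fF : forall x, `|f x| <= Fb.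
Variables (r : nat) (K : 'rV[R]_d -> R).
Hypothesis Kr : kernel_order r K.
Variables (Q : set 'rV[R]_d) (q : 'rV[R]_d -> R) (N M : R).
Hypothesis cQ : closed Q.
Hypothesis QN : forall y, Q y -> `|y| <= N.
Hypothesis mq : measurable_fun setT q.
Hypothesis qM : forall y, `|q y| <= M.
Hypothesis q0 : forall y, ~ Q y -> q y = 0.
Hypothesis qc : forall y, Q y -> forall e : R, 0 < e -> exists2 del : R, 0 < del &
  forall u, `|u| < del -> Q (y + u) -> `|q (y + u) - q y| <= e.
Variable h : nat -> R.
Hypothesis h0 : h @ \oo --> 0.
Hypothesis bS : forall n, bmeas (smooth K q (h n)).

Let M0 : 0 <= M. Proof. by rewrite (le_trans _ (qM 0)). Qed.

Let bq : bmeas q. Proof. by split => //; exists M. Qed.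

Let mK := kernel_measurable Kr.
Let iK := integrable_abse (kernel_integrable Kr).

Let iq : lam.-integrable setT (EFin \o q).
Proof.
apply: (le_integrable measurableT _ _ (integrable_realZ M (integrable_indic_ball N).1)).
  exact/measurable_EFinP.
move=> y _ /=; rewrite lee_fin indicE.
have [Qy|/q0 ->] := pselect (Q y); last by rewrite normr0.
by rewrite mem_set ?mulr1 ?(le_trans (qM y))// ?ler_norm//=; exact: QN.
Qed.

Let z n := fun p : 'rV[R]_d * Omega => `|q (X p.2 + h n *: p.1) - q (X p.2)|.

Let mX2 : measurable_fun setT (fun p : 'rV[R]_d * Omega => X p.2).
Proof. exact: (measurableT_comp (measurable_funP X) measurable_snd). Qed.

Let bz n : bmeas (z n).
Proof.
apply: bmeas_norm; apply: bmeasB; last exact: (bmeas_comp bq).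
apply: (bmeas_comp bq); apply: measurable_addZ_rV => //; exact: measurable_fst.
Qed.

Let z2M n p : z n p <= 2 * M.
Proof. by rewrite /z (le_trans (ler_normB _ _))// mulrDl mul1r lerD. Qed.

Let e n u := \int[P]_w z n (u, w).

Let be n : bmeas (e n).
Proof. exact: bmeas_fubini. Qed.

Let e_ge0 n u : 0 <= e n u.
Proof. by apply: Rintegral_ge0 => w _; exact: normr_ge0. Qed.

Let bzu n u : bmeas (fun w => z n (u, w)).
Proof. by apply: (bmeas_comp (bz n)); exact: measurable_pair1. Qed.

(** The bounded density turns the expectation into at most [Fb] times a Lebesgue integral, to which
    continuity of translations applies with the vector [h n *: u]. *)
Let e_cvg u : e n u @[n --> \oo] --> (0 : R).
Proof.
have ht : `|h n *: u| @[n --> \oo] --> (0 : R).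
  under eq_fun do rewrite normrZ.
  rewrite -(mul0r `|u|); apply: cvgMr_tmp.
  by rewrite -(normr0 R); apply: cvg_norm.
have := translation_cvg cQ QN mq qM q0 qc ht => T.
have FT : Fb * \int[lam]_y `|q (y + h n *: u) - q y| @[n --> \oo] --> (0 : R).
  by rewrite -(mulr0 Fb); apply: cvgMl_tmp.
apply: (cvg_dist_le _ FT); apply: nearW => n.
rewrite subr0 ger0_norm//.
pose G (y : 'rV[R]_d) := `|q (y + h n *: u) - q y|.
have mtr : measurable_fun setT (fun y : 'rV[R]_d => q (y + h n *: u)).
  under eq_fun do rewrite addrC -[X in _ + X]scale1r.
  exact: (measurableT_comp mq (measurable_affine_rV _ 1)).
have iqt : lam.-integrable setT (EFin \o (fun y : 'rV[R]_d => q (y + h n *: u))).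
  have := integrable_affine (h n *: u) ltr01 iq.
  by under eq_fun do rewrite scale1r addrC.
have iG : lam.-integrable setT (EFin \o G).
  exact: (integrable_abse (integrable_realB iqt iq)).
have bG : bmeas G.
  apply: bmeas_norm; apply: bmeasB => //; split => //.
  by exists M => y.
have -> : e n u = \int[lam]_y (G y * f y) by rewrite -(Rint_density Xf bG).
rewrite -RintegralZl//; apply: le_Rintegral => //.
- exact: (integrable_mul_density Xf bG).
- exact: (integrable_realZ Fb iG).
- move=> y _; rewrite mulrC ler_wpM2r ?normr_ge0//.
  exact: le_trans (ler_norm _) (fF y).
Qed.

Let J n := \int[lam]_u (`|K u| * e n u).

Let J_cvg : J n @[n --> \oo] --> (0 : R).
Proof.
rewrite (_ : 0 = \int[lam]_u (0 : R)); last by rewrite /Rintegral integral0.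
apply: (Rintegral_dct (g := fun u => 2 * M * `|K u|)) => //.
- move=> n; apply: measurable_funM; last by have [] := be n.
  exact: (measurableT_comp (@normr_measurable _ setT) mK).
- move=> u; rewrite -(mulr0 `|K u|); apply: cvgMl_tmp; exact: e_cvg.
- move=> n u; rewrite normrM normr_id mulrC ler_wpM2r//.
  by apply: Rint_norm_le => // w; rewrite /z normr_id; exact: (z2M n (u, w)).
- exact: integrable_realZ.
Qed.

Let ptw n x : (`|smooth K q (h n) x - q x|%:E <=
  \int[lam]_u (`|K u| * `|q (x + h n *: u) - q x|)%:E)%E.
Proof.
have i1 : lam.-integrable setT (EFin \o (fun u => K u * q (x + h n *: u))).
  by apply: (integrable_kernel_mul Kr (M := M)) => //; exact: measurable_line.
have i2 : lam.-integrable setT (EFin \o (fun u => q x * K u)).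
  by apply: integrable_realZ; exact: kernel_integrable Kr.
have -> : smooth K q (h n) x - q x =
    \int[lam]_u (K u * q (x + h n *: u) - q x * K u).
  rewrite RintegralB// RintegralZl//; last exact: kernel_integrable Kr.
  by case: Kr => _ -> _; rewrite mulr1.
have i12 : lam.-integrable setT (EFin \o (fun u => K u * q (x + h n *: u) - q x * K u)).
  exact: integrable_realB.
rewrite EFin_normr_Rintegral//.
apply: (le_trans (le_abse_integral lam measurableT (measurable_int _ i12))).
rewrite le_eqVlt; apply/orP; left; apply/eqP; apply: eq_integral => u _ /=.
by rewrite -normrM mulrBr [q x * _]mulrC.
Qed.

(** As [K] has integral [1], the smoothing error is an average of increments of [q]; Tonelli moves
    the expectation inside the integral over [u]. *)
Let L1 n : \int[P]_w `|smooth K q (h n) (X w) - q (X w)| <= J n.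
Proof.
have bs : bmeas (fun w => smooth K q (h n) (X w)) by exact: (bmeas_comp (bS n)).
have bqX : bmeas (fun w => q (X w)) by exact: (bmeas_comp bq).
have bsq : bmeas (fun w => `|smooth K q (h n) (X w) - q (X w)|).
  by apply: bmeas_norm; exact: bmeasB.
pose Z (p : 'rV[R]_d * Omega) := (`|K p.1| * z n p)%:E.
have mZ : measurable_fun setT Z.
  apply/measurable_EFinP; apply: measurable_funM; last by have [] := bz n.
  apply: (measurableT_comp (@normr_measurable _ setT)).
  exact: (measurableT_comp mK measurable_fst).
have Z0 p : (0 <= Z p)%E by rewrite /Z lee_fin; apply: mulr_ge0; exact: normr_ge0.
have iKe : lam.-integrable setT (EFin \o (fun u => `|K u| * e n u)).
  apply: (le_integrable measurableT _ _ (integrable_realZ (2 * M) iK)).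
    apply/measurable_EFinP; apply: measurable_funM; last by have [] := be n.
    exact: (measurableT_comp (@normr_measurable _ setT) mK).
  move=> u _ /=; rewrite lee_fin normrM normr_id mulrC [leRHS]normrM normr_id ler_wpM2r//.
  rewrite (@ger0_norm _ (2 * M)) ?mulr_ge0//.
  by apply: Rint_norm_le => // w; rewrite /z normr_id; exact: (z2M n (u, w)).
rewrite -lee_fin Rint_EFin//.
apply: (@le_trans _ _ (\int[P]_w \int[lam]_u Z (u, w))%E).
  apply: ge0_le_integral => //.
  - by apply/measurable_EFinP; case: bsq.
  - exact: (@measurable_fun_fubini_tonelli_G _ _ _ _ R lam Z).
have <- := @fubini_tonelli _ _ _ _ R lam P Z mZ Z0.
rewrite /J /Rintegral fineK; last exact: integrable_fin_num.
rewrite le_eqVlt; apply/orP; left; apply/eqP; apply: eq_integral => u _.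
rewrite EFinM Rint_EFin// -ge0_integralZl//.
- by apply/measurable_EFinP; case: (bzu n u).
- by move=> w _; rewrite lee_fin; exact: normr_ge0.
Qed.

(** Both functions are bounded, so the square is at most [B] times the absolute value, and the mean
    tends to zero by dominated convergence in the kernel variable [u]. *)
Lemma smooth_L2_cvg :
  \int[P]_w (smooth K q (h n) (X w) - q (X w)) ^+ 2 @[n --> \oo] --> (0 : R).
Proof.
pose B := M * \int[lam]_u `|K u| + M.
have B0 : 0 <= B by rewrite addr_ge0// mulr_ge0// Rintegral_ge0.
have BJ : B * J n @[n --> \oo] --> (0 : R).
  by rewrite -(mulr0 B); apply: cvgMl_tmp.
apply: (cvg_dist_le _ BJ); apply: nearW => n.
have bs : bmeas (fun w => smooth K q (h n) (X w)) by exact: (bmeas_comp (bS n)).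
have bqX : bmeas (fun w => q (X w)) by exact: (bmeas_comp bq).
have bsq : bmeas (fun w => smooth K q (h n) (X w) - q (X w)) by exact: bmeasB.
have bsq' : bmeas (fun w => `|smooth K q (h n) (X w) - q (X w)|) by exact: bmeas_norm.
rewrite subr0 ger0_norm; last by apply: Rintegral_ge0 => w _; exact: sqr_ge0.
apply: (le_trans _ (ler_wpM2l B0 (L1 n))).
rewrite -Rint_Zl//; apply: Rint_le.
- exact: bmeasX.
- by apply: bmeasM => //; exact: bmeas_cst.
- move=> w; rewrite -(real_normK (num_real _)) expr2 ler_wpM2r//.
  rewrite (le_trans (ler_normB _ _))// lerD//.
  exact: (smooth_bounded Kr _ _ mq qM).
Qed.

End smooth_cvg.

(** * Functions continuous on a compact set *)

Section closed_support.
Context {R : realType} {d : nat}.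
Implicit Types (G : 'rV[R]_d -> R) (Q : set 'rV[R]_d).

(** Continuity relative to [Q]: jumps across the boundary are allowed, as for a function extended by
    zero outside [Q]. *)
Definition within_cvg Q G := forall x, Q x -> G @ within Q (nbhs x) --> G x.

Lemma within_cvgP Q G : within_cvg Q G <->
  (forall y, Q y -> forall e : R, 0 < e -> exists2 del : R, 0 < del &
    forall u, `|u| < del -> Q (y + u) -> `|G (y + u) - G y| <= e).
Proof.
split=> [wG y Qy e e0|H y Qy].
  have /cvgrPdist_le /(_ e e0) := wG y Qy.
  rewrite near_withinE => /nbhs_ballP[del /= del0 Hd].
  exists del => // u ud Qu; rewrite distrC; apply: Hd => //.
  by rewrite -ball_normE /= opprD addNKr normrN.
apply/cvgrPdist_le => e e0; rewrite near_withinE.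
have [del del0 Hd] := H y Qy e e0.
apply/nbhs_ballP; exists del => //= z; rewrite -ball_normE /= => zd Qz.
by have := Hd (z - y); rewrite subrKC distrC [in X in _ -> _ -> X]distrC => ->.
Qed.

(** A superlevel set is the trace on [Q] of an open set, together with all or none of the complement
    according to the sign of [a]; boundedness comes from the compact image of [Q]. *)
Lemma within_cvg_bmeas Q G : compact Q -> within_cvg Q G ->
  (forall x, ~ Q x -> G x = 0) -> bmeas G.
Proof.
move=> cQ wG G0; have clQ : closed Q by apply: compact_closed => //; exact: norm_hausdorff.
split; last first.
  have /compact_bounded [M [_ HM]] : compact (G @` Q).
    by apply: continuous_compact => //; apply/subspace_continuousP.
  exists (`|M| + 1) => x; have [Qx|/G0 ->] := pselect (Q x).
    by apply: HM; [rewrite (le_lt_trans (ler_norm _)) ?ltrDl//|exists x].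
  by rewrite normr0.
apply: (measurability _ (RGenOInfty.measurableE R)).
move=> _ [_ [a ->] <-]; rewrite setTI.
pose U := \bigcup_(O in [set O : set 'rV[R]_d | open O /\ O `&` Q `<=` [set z | a < G z]]) O.
have oU : open U by apply: bigcup_open => O [].
have -> : G @^-1` `]a, +oo[%classic = (Q `&` U) `|` (~` Q `&` [set _ | a < 0]).
  apply/seteqP; split=> [y|y [[Qy [V [_ VQ] Vy]] | [nQ a0]]]; rewrite /= in_itv/= andbT.
  - move=> ay; have [Qy|nQ] := pselect (Q y); last by right; split; rewrite //= -(G0 y nQ).
    left; split => //.
    have /cvgrPdist_lt /(_ (G y - a)) := wG y Qy.
    rewrite subr_gt0 => /(_ ay); rewrite near_withinE => nO.
    exists (interior [set z | Q z -> `|G y - G z| < G y - a]); last by rewrite /interior.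
    split; first exact: open_interior.
    move=> z [/interior_subset /= Hz Qz]; have := le_lt_trans (ler_norm _) (Hz Qz).
    by rewrite ltrD2l ltrN2.
  - exact: VQ.
  - by rewrite (G0 y nQ).
have mQ : measurable Q.
  by rewrite -(setCK Q); apply: measurableC; apply: open_measurable_rV; exact: closed_openC.
apply: measurableU; apply: measurableI.
- exact: mQ.
- exact: open_measurable_rV.
- by apply: open_measurable_rV; exact: closed_openC.
- by have [a0|a0] := boolP (a < 0); [rewrite (_ : [set _ | _] = setT)//; apply/seteqP; split|
    rewrite (_ : [set _ | _] = set0)//; apply/seteqP; split].
Qed.

Lemma enorm_le (u : 'rV[R]_d) : enorm u <= Num.sqrt d%:R * `|u|.
Proof.
have -> : Num.sqrt d%:R * `|u| = Num.sqrt (d%:R * `|u| ^+ 2) :> R.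
  by rewrite sqrtrM// sqrtr_sqr ger0_norm.
apply: ler_wsqrtr; rewrite -[X in X%:R]card_ord mulr_natl -sumr_const; apply: ler_sum => i _.
rewrite -(real_normK (num_real (u ord0 i))) lerXn2r ?nnegrE//.
exact: le_norm_coord.
Qed.

Lemma holder_within_cvg Q G : holder_on Q G -> within_cvg Q G.
Proof.
move=> [al [C [al0 al1 H]]]; apply/within_cvgP => y Qy e e0.
pose t := e / (`|C| + 1).
have C1 : 0 < `|C| + 1 by rewrite ltr_wpDl.
have t0 : 0 < t by rewrite divr_gt0.
exists (t `^ al^-1 / (Num.sqrt d%:R + 1)).
  by rewrite divr_gt0 ?powR_gt0// ltr_wpDl.
move=> u; rewrite ltr_pdivlMr ?ltr_wpDl// => ud Qu.
apply: (le_trans (H _ _ Qu Qy)); rewrite addrC addKr.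
have ent : enorm u `^ al <= t.
  rewrite (le_trans (y := (t `^ al^-1) `^ al))//; last first.
    by rewrite -powRrM mulVf ?gt_eqF// powRr1// ltW.
  apply: ge0_ler_powR; rewrite ?nnegrE ?sqrtr_ge0 ?powR_ge0 ?(ltW al0)//.
  apply: (le_trans (enorm_le u)); apply: ltW; apply: le_lt_trans ud.
  by rewrite mulrC ler_wpM2l// lerDl.
apply: (@le_trans _ _ (`|C| * t)).
  rewrite (le_trans (ler_wpM2r (powR_ge0 _ _) (ler_norm C)))// ler_wpM2l//.
by rewrite /t mulrCA ger_pMr// ler_pdivrMr// mul1r lerDl.
Qed.

Lemma within_cvgM Q G1 G2 : within_cvg Q G1 -> within_cvg Q G2 ->
  within_cvg Q (fun x => G1 x * G2 x).
Proof. by move=> c1 c2 x Qx; apply: cvgM; [exact: c1|exact: c2]. Qed.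

Lemma within_cvgV Q G : (forall x, Q x -> G x != 0) -> within_cvg Q G ->
  within_cvg Q (fun x => (G x)^-1).
Proof. by move=> G0 c x Qx; apply: cvgV; [exact: G0|exact: c]. Qed.

Lemma bounded_partials_within_cvg r Q f : (1 <= r)%N -> bounded_partials r f ->
  within_cvg Q f.
Proof.
move=> r1 bf; apply/within_cvgP => y _ e e0.
have [C C0 HC] := bounded_partials_lip r1 bf y.
exists (Num.min 1 (e / (C + 1))); first by rewrite lt_min ltr01 divr_gt0// ltr_wpDl.
move=> u; rewrite lt_min => /andP[u1 ue] _; rewrite (le_trans (HC u (ltW u1)))//.
rewrite ltr_pdivlMr ?ltr_wpDl// in ue.
by rewrite mulrC (le_trans _ (ltW ue))// ler_wpM2l// lerDl.
Qed.

End closed_support.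

(** * The leave-one-out estimator *)

Lemma sum_other_const (R : realType) n i (c : R) : (i < n)%N ->
  \sum_(j < n | (j : nat) != i) c = n.-1%:R * c.
Proof.
move=> ni; rewrite (eq_bigl (fun j => j \in predC1 (Ordinal ni))).
  by rewrite sumr_const cardC1 card_ord mulr_natl.
by move=> j; rewrite !inE -val_eqE.
Qed.

Section kernel_moments.
Context {R : realType} {d : nat}.
Local Notation lam := (@lebesgue_rV R d).
Context {dO : measure_display} {Omega : measurableType dO} (P : probability Omega R).
Variables (X : nat -> {RV P >-> 'rV[R]_d}) (e : nat -> {RV P >-> R}).
Hypotheses (iidX : iid X) (iide : iid e) (XeI : independent_sequences X e).
Variables (f : 'rV[R]_d -> R) (Fb : R).
Hypothesis Xf : has_density (X 0%N) f.
Hypothesis fF : forall x, `|f x| <= Fb.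
Variables (r : nat) (K : 'rV[R]_d -> R) (C1 : R).
Hypothesis Kr : kernel_order r K.
Hypothesis KC : forall u, `|K u| <= C1.
Variable h : R.
Hypothesis h0 : 0 < h.

(** The first component is the evaluation point, the second the sample point. *)
Definition kern (z : 'rV[R]_d * 'rV[R]_d) : R := K (h^-1 *: (z.2 - z.1)).

Let mf : measurable_fun setT f. Proof. by case: Xf. Qed.
Let f0 x : 0 <= f x. Proof. by case: Xf. Qed.

Lemma bmeas_kern : bmeas kern.
Proof.
split; last by exists C1 => z; exact: KC.
apply: (measurableT_comp (kernel_measurable Kr)).
apply/measurable_fun_rVP => i; under eq_fun do rewrite !mxE.
apply: measurable_funM => //; apply: measurable_funB.
- exact: (measurableT_comp (measurable_rV_coord i) measurable_snd).
- exact: (measurableT_comp (measurable_rV_coord i) measurable_fst).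
Qed.

Lemma bmeas_kern1 x : bmeas (fun y => kern (x, y)).
Proof. by apply: (bmeas_comp bmeas_kern); exact: measurable_pair1. Qed.

Let bX0 (F : 'rV[R]_d -> R) : bmeas F -> bmeas (fun w => F (X 0%N w)).
Proof. by move=> bF; apply: (bmeas_comp bF). Qed.

Lemma kern_line x u : kern (x, x + h *: u) = K u.
Proof. by rewrite /kern /= addrC addKr scalerA mulVf ?gt_eqF// scale1r. Qed.

(** The substitution [y = x + h u] in the integral against the density; this is where the factor
    [h ^+ d] and [smooth] come from. *)
Lemma Rint_kern (G : 'rV[R]_d -> R) x : bmeas G ->
  \int[P]_w (G (X 0%N w) * kern (x, X 0%N w)) =
  h ^+ d * smooth K (fun y => G y * f y) h x.
Proof.
move=> bG; pose F y := G y * kern (x, y).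
have bF : bmeas F by apply: bmeasM => //; exact: bmeas_kern1.
rewrite -[LHS]/(\int[P]_w F (X 0%N w)) (Rint_density Xf bF).
have -> := Rint_affine x h0 (integrable_mul_density Xf bF).
congr (_ * _); apply: eq_Rintegral => u _.
by rewrite /F kern_line -mulrA mulrCA mulrA.
Qed.

Lemma kern_mean x :
  \int[P]_w kern (x, X 0%N w) = h ^+ d * smooth K f h x.
Proof.
have := Rint_kern x (bmeas_cst 1).
under eq_Rintegral do rewrite mul1r; move=> ->; congr (_ * _).
by apply: eq_Rintegral => u _; rewrite mul1r.
Qed.

Let kap := \int[lam]_u `|K u|.
Let iK := integrable_abse (kernel_integrable Kr).

Let Fb0 : 0 <= Fb. Proof. by rewrite (le_trans _ (fF 0)). Qed.
Let C10 : 0 <= C1. Proof. by rewrite (le_trans _ (KC 0)). Qed.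
Let kap0 : 0 <= kap. Proof. exact: Rintegral_ge0. Qed.

Lemma kern_abs_mean x : \int[P]_w `|kern (x, X 0%N w)| <= h ^+ d * (Fb * kap).
Proof.
pose F y := `|kern (x, y)|.
have bF : bmeas F by apply: bmeas_norm; exact: bmeas_kern1.
have iF := integrable_mul_density Xf bF.
rewrite -[leLHS]/(\int[P]_w F (X 0%N w)) (Rint_density Xf bF).
have -> := Rint_affine x h0 iF.
rewrite ler_wpM2l ?exprn_ge0 ?(ltW h0)// /kap -RintegralZl//.
apply: le_Rintegral => //.
- exact: (integrable_affine x h0 iF).
- exact: (integrable_realZ Fb iK).
- move=> u _; rewrite /F kern_line mulrC ler_wpM2r//.
  exact: le_trans (ler_norm _) (fF _).
Qed.

(** One factor is bounded by [C1] and the other averaged, so the second moment keeps the order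
    [h ^+ d] of the first. *)
Lemma kern_sqr_mean x :
  \int[P]_w kern (x, X 0%N w) ^+ 2 <= h ^+ d * (C1 * (Fb * kap)).
Proof.
have bk : bmeas (fun w => kern (x, X 0%N w)) by exact: (bX0 (bmeas_kern1 x)).
rewrite mulrCA (le_trans _ (ler_wpM2l C10 (kern_abs_mean x)))//.
rewrite -Rint_Zl; last exact: bmeas_norm.
apply: Rint_le; [exact: bmeasX|by apply: bmeasM; [exact: bmeas_cst|exact: bmeas_norm]|].
by move=> w; rewrite -(real_normK (num_real _)) expr2 ler_wpM2r//; exact: KC.
Qed.

(** Measurability and boundedness are read off the representation of the smoothing as an
    expectation, through Fubini. *)
Lemma bmeas_smooth (G : 'rV[R]_d -> R) : bmeas G -> 
  bmeas (smooth K (fun y => G y * f y) h).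
Proof.
move=> bG; rewrite (_ : smooth _ _ _ = (fun x => (h ^+ d)^-1 *
    \int[P]_w (G (X 0%N w) * kern (x, X 0%N w)))); last first.
  by apply/funext => x; rewrite Rint_kern// mulKf// gt_eqF// exprn_gt0.
apply: bmeasM; first exact: bmeas_cst.
apply: (bmeas_fubini P (F := fun z => G (X 0%N z.2) * kern (z.1, X 0%N z.2))).
apply: bmeasM; first by exact: (@bmeas_snd _ _ _ _ _ (fun w => G (X 0%N w)) (bX0 bG)).
apply: (bmeas_comp2 bmeas_kern); first exact: measurable_fst.
exact: (measurableT_comp (measurable_funP (X 0%N)) measurable_snd).
Qed.

Let sm := smooth K f h.

Lemma bmeas_smooth_density : bmeas sm.
Proof.
have := bmeas_smooth (bmeas_cst 1).
by rewrite (_ : (fun y => 1 * f y) = f)//; apply/funext => y; rewrite mul1r.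
Qed.

Lemma smooth_density_le x : `|sm x| <= Fb * kap.
Proof. exact: (smooth_bounded Kr _ _ mf fF). Qed.

(** Centered in the sample point for a fixed evaluation point, as [kernel_sum_moment2] and
    [kernel_sum_moment4] require. *)
Definition ckern (z : 'rV[R]_d * 'rV[R]_d) := kern z - h ^+ d * sm z.1.

Lemma bmeas_ckern : bmeas ckern.
Proof.
apply: bmeasB; first exact: bmeas_kern.
by apply: bmeasM; [exact: bmeas_cst|exact: (@bmeas_fst _ _ _ _ _ sm bmeas_smooth_density)].
Qed.

Lemma ckern_mean x : \int[P]_w ckern (x, X 0%N w) = 0.
Proof.
rewrite /ckern /= Rint_B; [|exact: (bX0 (bmeas_kern1 x))|exact: bmeas_cst].
by rewrite kern_mean Rintegral_prob_cst subrr.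
Qed.

Lemma ckern_sqr x :
  \int[P]_w ckern (x, X 0%N w) ^+ 2 <= h ^+ d * (C1 * (Fb * kap)).
Proof.
apply: (le_trans _ (kern_sqr_mean x)).
have bk : bmeas (fun w => kern (x, X 0%N w)) by exact: (bX0 (bmeas_kern1 x)).
set m := h ^+ d * sm x.
have E w : ckern (x, X 0%N w) ^+ 2 =
    (kern (x, X 0%N w) ^+ 2 - (2 * m) * kern (x, X 0%N w)) + m ^+ 2.
  by rewrite /ckern /= -/m; ring.
under eq_Rintegral do rewrite E.
have b1 : bmeas (fun w => kern (x, X 0%N w) ^+ 2) by exact: bmeasX.
have b2 : bmeas (fun w => (2 * m) * kern (x, X 0%N w)).
  by apply: bmeasM => //; exact: bmeas_cst.
rewrite Rint_D; [|exact: bmeasB|exact: bmeas_cst].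
rewrite Rint_B// Rint_Zl// kern_mean -/sm -/m Rintegral_prob_cst.
have := sqr_ge0 m; lra.
Qed.

Lemma ckern_le z : `|ckern z| <= 2 * C1.
Proof.
rewrite /ckern (le_trans (ler_normB _ _))// mulrDl mul1r lerD//; first exact: KC.
rewrite -kern_mean; apply: Rint_norm_le; first exact: (bX0 (bmeas_kern1 _)).
by move=> w; exact: KC.
Qed.

Variable n : nat.
Hypothesis n0 : (0 < n)%N.

Let nh := n%:R * h ^+ d.
Let nh0 : 0 < nh. Proof. by rewrite mulr_gt0 ?ltr0n// exprn_gt0. Qed.
Let T := C1 * (Fb * kap).

(** Divided by [n * h ^+ d], this is the leave-one-out estimator minus its conditional mean given
    [X i]. *)
Definition kern_dev i w := \sum_(j < n | (j : nat) != i) ckern (X i w, X j w).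

Lemma bmeas_kern_dev i : bmeas (kern_dev i).
Proof. by apply: bmeas_sum => j _; apply: (bmeas_comp2 bmeas_ckern). Qed.

Lemma kern_dev2 i : \int[P]_w kern_dev i w ^+ 2 <= nh * T.
Proof.
apply: (le_trans (kernel_sum_moment2 iidX iide XeI bmeas_ckern ckern_mean ckern_sqr i n)).
by rewrite mulrA.
Qed.

(** The constant [12 * C1 ^+ 2] is [3 * B ^+ 2] for the bound [B = 2 * C1] of [ckern_le]. *)
Lemma kern_dev4 i : \int[P]_w kern_dev i w ^+ 4 <=
  8 * (nh * T) ^+ 2 + 12 * C1 ^+ 2 * (nh * T).
Proof.
apply: (le_trans (kernel_sum_moment4 iidX iide XeI bmeas_ckern ckern_mean ckern_sqr ckern_le i n)).
by rewrite le_eqVlt; apply/orP; left; apply/eqP; rewrite /nh /T; ring.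
Qed.

Variable Cb : R.
Hypothesis bias : forall x, `|smooth K f h x - f x| <= Cb * h ^+ r.

Let fhat i w := loo_kde K h n (fun j => X j w) i (X i w).
Let bet := Cb * h ^+ r + Fb * kap / n%:R.

Lemma bmeas_loo d' (T' : measurableType d') (Y : nat -> T' -> 'rV[R]_d) i :
  (forall j, measurable_fun setT (Y j)) ->
  bmeas (fun w => loo_kde K h n (fun j => Y j w) i (Y i w)).
Proof.
move=> mY; apply: bmeasM; first exact: bmeas_cst.
by apply: bmeas_sum => j _; apply: (bmeas_comp2 bmeas_kern).
Qed.

Lemma loo_dev i w : (i < n)%N ->
  `|fhat i w - f (X i w)| <= `|kern_dev i w| / nh + bet.
Proof.
(* There are [n - 1] summands but the normalization is by [n]: the conditional mean falls short of
   the smoothed density by [sm / n], which is the second term of [bet]. *)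
move=> ni; have -> : fhat i w = kern_dev i w / nh + (n%:R - 1) / n%:R * sm (X i w).
  rewrite /fhat /loo_kde /kern_dev /ckern /kern /= sumrB.
  rewrite sum_other_const//.
  rewrite -subn1 natrB// /nh.
  have hd : h ^+ d != 0 by rewrite gt_eqF// exprn_gt0.
  have nn : n%:R != 0 :> R by rewrite pnatr_eq0 -lt0n.
  set A := \sum_(j < n | _) K _.
  by field; rewrite nn hd.
rewrite -addrA (le_trans (ler_normD _ _))// lerD//.
  by rewrite normrM normfV (gtr0_norm nh0).
have nn : 0 < n%:R :> R by rewrite ltr0n.
rewrite (_ : _ - f _ = (sm (X i w) - f (X i w)) - sm (X i w) / n%:R); last first.
  by field; rewrite gt_eqF.
rewrite (le_trans (ler_normB _ _))// lerD//.
by rewrite normrM normfV (gtr0_norm nn) ler_wpM2r ?invr_ge0 ?(ltW nn)// smooth_density_le.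
Qed.

Lemma loo_dev2 i : (i < n)%N ->
  \int[P]_w (fhat i w - f (X i w)) ^+ 2 <= 2 * T / nh + 2 * bet ^+ 2.
Proof.
move=> ni.
have bf : bmeas f by split => //; exists Fb.
have bfX : bmeas (fun w => f (X i w)) by apply: (bmeas_comp bf).
have bS := bmeas_kern_dev i.
pose G w := (2 / nh ^+ 2) * kern_dev i w ^+ 2 + 2 * bet ^+ 2.
have bG1 : bmeas (fun w => (2 / nh ^+ 2) * kern_dev i w ^+ 2).
  by apply: bmeasM; [exact: bmeas_cst|exact: bmeasX].
apply: (@le_trans _ _ (\int[P]_w G w)).
  apply: Rint_le.
  - by apply: bmeasX; apply: bmeasB => //; exact: (bmeas_loo (Y := X)).
  - by apply: bmeasD => //; exact: bmeas_cst.
  - move=> w; have := loo_dev w ni; set D := fhat i w - _; set S := kern_dev i w => H.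
    rewrite /G -(real_normK (num_real D)).
    apply: (@le_trans _ _ ((`|S| / nh + bet) ^+ 2)).
      by rewrite lerXn2r ?nnegrE//; apply: le_trans H.
    rewrite -/S -(real_normK (num_real S)).
    rewrite (_ : 2 / nh ^+ 2 * `|S| ^+ 2 = 2 * (`|S| / nh) ^+ 2); last first.
      by field; rewrite gt_eqF.
    set s := `|S| / nh; have := sqr_ge0 (s - bet); lra.
rewrite Rint_D//; last exact: bmeas_cst.
rewrite Rintegral_prob_cst lerD2r Rint_Zl; last exact: bmeasX.
apply: (le_trans (ler_wpM2l _ (kern_dev2 i))); first by rewrite divr_ge0// sqr_ge0.
by rewrite le_eqVlt; apply/orP; left; apply/eqP; field; rewrite gt_eqF.
Qed.

End kernel_moments.

Lemma Rint_sum_integrable d (T : measurableType d) (R : realType)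
    (mu : {measure set T -> \bar R}) I (s : seq I) (F : I -> T -> R) :
  (forall i, mu.-integrable setT (EFin \o F i)) ->
  mu.-integrable setT (EFin \o (fun w => \sum_(i <- s) F i w)) /\
  \int[mu]_w (\sum_(i <- s) F i w) = \sum_(i <- s) \int[mu]_w F i w.
Proof.
move=> iF; elim: s => [|i s [iS ES]].
  rewrite big_nil (_ : (fun w => _) = cst 0); last by apply/funext => w; rewrite big_nil.
  by split; [exact: integrable0|rewrite /Rintegral integral0].
rewrite (_ : (fun w => _) = fun w => F i w + \sum_(j <- s) F j w); last first.
  by apply/funext => w; rewrite big_cons.
by split; [exact: integrable_realD|rewrite RintegralD// ES big_cons].
Qed.

(** * Sums of the noise with weights depending on the design *)

Section noise.
Context {dO : measure_display} {Omega : measurableType dO} {R : realType}.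
Context (P : probability Omega R).
Context {d1 : measure_display} {T1 : measurableType d1}.
Variables (X : nat -> {RV P >-> T1}) (e : nat -> {RV P >-> R}).
Hypotheses (iide : iid e) (XeI : independent_sequences X e).
Hypothesis Ee0 : \int[P]_w e 0%N w = 0.
Hypothesis Ee2 : P.-integrable setT (fun w => (e 0%N w ^+ 2)%:E).

(* [Omega] with the sigma-algebra generated by the whole sequence [Z]. *)
Definition seqT d (T : measurableType d) (Z : nat -> {RV P >-> T}) :=
  g_sigma_algebraType (\bigcup_i preimage_set_system setT (Z i) measurable).
HB.instance Definition _ d (T : measurableType d) (Z : nat -> {RV P >-> T}) :=
  Measurable.on (seqT Z).

Lemma measurable_seqT d (T : measurableType d) (Z : nat -> {RV P >-> T}) i :
  measurable_fun setT (fun w : seqT Z => Z i w).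
Proof.
move=> _ A mA; rewrite setTI; apply: sub_sigma_algebra; exists i => //.
by exists A => //; rewrite setTI.
Qed.

Lemma measurable_to_seqT d (T : measurableType d) (Z : nat -> {RV P >-> T}) :
  measurable_fun setT (fun w : Omega => w : seqT Z).
Proof.
move=> _ A sA; rewrite setTI.
have : <<s \bigcup_i preimage_set_system setT (Z i) measurable >> `<=`
    (measurable : set (set Omega)).
  apply: smallest_sub; first exact: sigma_algebra_measurable.
  move=> _ [i _ [B mB <-]]; exact: (measurable_funP (Z i)).
by apply.
Qed.

Arguments measurable_to_seqT {d T} Z.
Arguments measurable_seqT {d T} Z i.

Lemma noise_sqr_integrable i : P.-integrable setT (fun w => (e i w ^+ 2)%:E) /\
  \int[P]_w e i w ^+ 2 = \int[P]_w e 0%N w ^+ 2.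
Proof.
have mk : measurable_fun setT (fun x : R => (x ^+ 2)%:E).
  by apply/measurable_EFinP; exact: measurable_funX.
have k0 (x : R) : (0 <= (x ^+ 2)%:E)%E by rewrite lee_fin sqr_ge0.
have H := ge0_iid_law (P := P) i iide mk k0.
split; last by rewrite /Rintegral H.
apply/integrableP; split; first exact: (measurableT_comp mk).
rewrite (eq_integral (fun w => (e i w ^+ 2)%:E)); last by move=> w _; rewrite gee0_abs.
rewrite H; have /integrableP[_] := Ee2; apply: le_lt_trans.
by apply: ge0_le_integral => //; [exact: (measurableT_comp mk)|
  apply: measurableT_comp => //; exact: (measurableT_comp mk)|
  move=> w _; exact: lee_abs].
Qed.

Lemma noise_integrable i : P.-integrable setT (fun w => (e i w)%:E).
Proof. by apply: integrable_of_sqr => //; exact: (noise_sqr_integrable i).1. Qed.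

(** Equality of laws is transferred through nonnegative functions, hence separately for the positive
    and negative parts. *)
Lemma noise_mean i : (\int[P]_w (e i w)%:E = 0)%E.
Proof.
have mm (g : R -> R) : measurable_fun setT g ->
    measurable_fun setT (fun x : R => maxe (g x)%:E 0).
  by move=> mg; apply: measurable_maxe => //; exact/measurable_EFinP.
have E j : (\int[P]_w (e j w)%:E = \int[P]_w (maxe (e j w)%:E 0) -
    \int[P]_w (maxe (- e j w)%:E 0))%E.
  by rewrite integralE; congr (_ - _)%E; apply: eq_integral => w _; rewrite ?funeposE ?funenegE.
rewrite E (ge0_iid_law (P := P) (k := fun x : R => maxe x%:E 0%E) i iide); last 2 first.
- exact: (mm id).
- by move=> x; rewrite le_max lexx orbT.
rewrite (ge0_iid_law (P := P) (k := fun x : R => maxe (- x)%:E 0%E) i iide); last 2 first.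
- by apply: mm; exact: measurable_funN.
- by move=> x; rewrite le_max lexx orbT.
rewrite -E -[LHS]fineK ?integrable_fin_num//; last exact: noise_integrable.
by rewrite -[fine _]/(\int[P]_w e 0%N w) Ee0.
Qed.

Lemma noise_mul_integrable i j : P.-integrable setT (fun w => (e i w * e j w)%:E).
Proof.
have i1 := (noise_sqr_integrable i).1; have i2 := (noise_sqr_integrable j).1.
apply: (le_integrable measurableT _ _ (integrable_realD i1 i2)).
  by apply/measurable_EFinP; exact: measurable_funM.
move=> w _ /=; rewrite lee_fin [leRHS]ger0_norm ?addr_ge0 ?sqr_ge0//.
rewrite normrM -(real_normK (num_real (e i w))) -(real_normK (num_real (e j w))).
set a := `|e i w|; set b := `|e j w|; have := sqr_ge0 (a - b).
have := sqr_ge0 a; have := sqr_ge0 b; nra.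
Qed.

Lemma noise_orth i j : i != j -> \int[P]_w (e i w * e j w) = 0.
Proof.
move=> ij; have ind : indep_rv P (e i) (e j).
  move=> A B mA mB.
  pose C k := if k == i then A else if k == j then B else setT.
  have := iide.1 [fset i; j]%fset C; rewrite /C.
  have mC k : measurable (C k) by rewrite /C; case: eqP => // _; case: eqP.
  move=> /(_ mC); rewrite big_fsetU1 ?inE//= big_seq_fset1 eqxx eq_sym (negbTE ij) eqxx.
  move=> <-; congr (P _); apply/seteqP; split=> [w [Aw Bw] k|w Hw].
    by rewrite /= !inE => /orP[/eqP ->|/eqP ->]; rewrite ?eqxx// eq_sym (negbTE ij).
  split; first by have := Hw i; rewrite /= !inE eqxx /= => /(_ isT).
  by have := Hw j; rewrite /= !inE eqxx orbT /= eq_sym (negbTE ij) => /(_ isT).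
rewrite /Rintegral (@decouple0 _ _ _ P _ _ _ _ (e i) (e j) _ _ ind (fun z => z.1 * z.2))//.
- by apply: measurable_funM; [exact: measurable_fst|exact: measurable_snd].
- exact: noise_mul_integrable.
- move=> y /=; under eq_integral do rewrite EFinM.
  by rewrite integralZr ?noise_mean ?mul0e//; exact: noise_integrable.
Qed.

Variables (D : nat -> seqT X -> R) (tau : R) (n : nat).
Hypothesis bD : forall i, bmeas (D i).
Hypothesis D2 : forall i, (i < n)%N -> \int[P]_w D i w ^+ 2 <= tau.

Let bDP i : bmeas (fun w : Omega => D i w).
Proof. exact: (bmeas_comp (bD i) (measurable_to_seqT X)). Qed.

Let term (i j : nat) (w : Omega) := (e i w * e j w) * (D i w * D j w).

Let iterm i j : P.-integrable setT (EFin \o term i j).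
Proof.
have [M M0 HM] := bmeas_bound (bmeasM (bDP i) (bDP j)).
apply: (le_integrable measurableT _ _ (integrable_realZ M (integrable_abse (noise_mul_integrable i j)))).
  apply/measurable_EFinP; apply: measurable_funM; first exact: measurable_funM.
  by have [] := bmeasM (bDP i) (bDP j).
move=> w _ /=; rewrite lee_fin normrM [leRHS]normrM normr_id mulrC (gtr0_norm M0).
by rewrite ler_wpM2r.
Qed.

Let indD : indep_rv P (fun w : Omega => w : seqT e) (fun w : Omega => w : seqT X).
Proof. by move=> A B mA mB; rewrite setIC muleC; apply: XeI. Qed.

Let term0 i j : i != j -> \int[P]_w term i j w = 0.
Proof.
move=> ij; rewrite /Rintegral.
rewrite (@decouple0 _ _ _ P _ _ (seqT e) (seqT X) _ _ (measurable_to_seqT e)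
  (measurable_to_seqT X) indD (fun z : seqT e * seqT X => (e i z.1 * e j z.1) * (D i z.2 * D j z.2)))//.
- apply: measurable_funM; apply: measurable_funM.
  + exact: (measurableT_comp (measurable_seqT e i) measurable_fst).
  + exact: (measurableT_comp (measurable_seqT e j) measurable_fst).
  + exact: (measurableT_comp (bD i).1 measurable_snd).
  + exact: (measurableT_comp (bD j).1 measurable_snd).
- exact: iterm.
- move=> y /=; under eq_integral do rewrite EFinM.
  rewrite integralZr//; last exact: noise_mul_integrable.
  rewrite -[X in (X * _)%E]fineK ?integrable_fin_num//; last exact: noise_mul_integrable.
  by rewrite -[fine _]/(\int[P]_w (e i w * e j w)) noise_orth// mul0e.
Qed.

Let termE i : \int[P]_w term i i w = \int[P]_w e 0%N w ^+ 2 * \int[P]_w D i w ^+ 2.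
Proof.
pose F (z : seqT e * seqT X) := ((e i z.1 * e i z.1) * (D i z.2 * D i z.2))%:E.
have mF : measurable_fun setT F.
  apply/measurable_EFinP; apply: measurable_funM; apply: measurable_funM.
  + exact: (measurableT_comp (measurable_seqT e i) measurable_fst).
  + exact: (measurableT_comp (measurable_seqT e i) measurable_fst).
  + exact: (measurableT_comp (bD i).1 measurable_snd).
  + exact: (measurableT_comp (bD i).1 measurable_snd).
have F0 z : (0 <= F z)%E by rewrite lee_fin mulr_ge0// -expr2 sqr_ge0.
have := @ge0_decouple _ _ _ P _ _ (seqT e) (seqT X) _ _ (measurable_to_seqT e)
  (measurable_to_seqT X) indD F mF F0 => H.
rewrite /Rintegral /term H -[RHS]/(fine _ * _).
rewrite [X in fine X](_ : _ = \int[P]_w' ((\int[P]_w e 0%N w ^+ 2) * D i w' ^+ 2)%:E)%E.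
  rewrite -[fine _]/(\int[P]_w' ((\int[P]_w e 0%N w ^+ 2) * D i w' ^+ 2)).
  by rewrite Rint_Zl//; apply: bmeasX; exact: bDP.
apply: eq_integral => w' _; rewrite /F /=.
under eq_integral do rewrite EFinM -expr2.
rewrite integralZr//; last exact: (noise_sqr_integrable i).1.
rewrite -[X in (X * _)%E]fineK ?integrable_fin_num//; last exact: (noise_sqr_integrable i).1.
by rewrite -[fine _]/(\int[P]_w (e i w ^+ 2)) (noise_sqr_integrable i).2 -expr2 EFinM.
Qed.

(** The weights depend on the design alone; freezing it, the off-diagonal products of noises average
    to zero, although the weights may be strongly dependent among themselves. *)
Lemma sum_noise_moment2 :
  P.-integrable setT (EFin \o (fun w => (\sum_(i < n) e i w * D i w) ^+ 2)) /\
  \int[P]_w (\sum_(i < n) e i w * D i w) ^+ 2 <=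
    n%:R * (\int[P]_w e 0%N w ^+ 2 * tau).
Proof.
have E : (fun w => (\sum_(i < n) e i w * D i w) ^+ 2) =
    (fun w => \sum_(i < n) \sum_(j < n) term i j w).
  apply/funext => w; rewrite expr2 mulr_suml; apply: eq_bigr => i _.
  by rewrite mulr_sumr; apply: eq_bigr => j _; rewrite /term; ring.
have I1 i := Rint_sum_integrable (index_enum 'I_n) (fun j : 'I_n => iterm i j).
have [I2 EI2] := Rint_sum_integrable (index_enum 'I_n) (fun i : 'I_n => (I1 i).1).
rewrite E; split => //; rewrite EI2.
have -> : n%:R * (\int[P]_w e 0%N w ^+ 2 * tau) =
    \sum_(i < n) (\int[P]_w e 0%N w ^+ 2 * tau).
  by rewrite sumr_const card_ord mulr_natl.
apply: ler_sum => i _; rewrite (I1 i).2 (bigD1 i)//= big1 ?addr0; last first.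
  by move=> j ji; rewrite term0// eq_sym.
rewrite termE ler_wpM2l ?D2//.
by apply: Rintegral_ge0 => w _; exact: sqr_ge0.
Qed.

End noise.
Arguments measurable_to_seqT {dO Omega R P d T} Z.
Arguments measurable_seqT {dO Omega R P d T} Z i.

Lemma Rint_swap d1 d2 (T1 : measurableType d1) (T2 : measurableType d2) (R : realType)
    (P1 : probability T1 R) (P2 : probability T2 R) (F : T1 * T2 -> R) : bmeas F ->
  \int[P1]_x (\int[P2]_y F (x, y)) = \int[P2]_y (\int[P1]_x F (x, y)).
Proof.
move=> bF; have [M [bG G0]] := bmeas_ge0 bF.
pose G z := F z + M.
have bF1 x : bmeas (fun y => F (x, y)) by apply: (bmeas_comp bF); exact: measurable_pair1.
have bF2 y : bmeas (fun x => F (x, y)) by apply: (bmeas_comp bF); exact: measurable_pair2.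
have bG1 x : bmeas (fun y => G (x, y)) by apply: (bmeas_comp bG); exact: measurable_pair1.
have bG2 y : bmeas (fun x => G (x, y)) by apply: (bmeas_comp bG); exact: measurable_pair2.
have bsw : bmeas (fun z : T2 * T1 => F (z.2, z.1)).
  by apply: (bmeas_comp2 bF); [exact: measurable_snd|exact: measurable_fst].
have bsG : bmeas (fun z : T2 * T1 => G (z.2, z.1)).
  by apply: (bmeas_comp2 bG); [exact: measurable_snd|exact: measurable_fst].
have bI1 : bmeas (fun x => \int[P2]_y F (x, y)) by exact: bmeas_fubini.
have bI2 : bmeas (fun y => \int[P1]_x F (x, y)) by exact: (bmeas_fubini P1 bsw).
have bJ1 : bmeas (fun x => \int[P2]_y G (x, y)) by exact: bmeas_fubini.
have bJ2 : bmeas (fun y => \int[P1]_x G (x, y)) by exact: (bmeas_fubini P1 bsG).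
have E1 : \int[P1]_x (\int[P2]_y G (x, y)) = \int[P1]_x (\int[P2]_y F (x, y)) + M.
  rewrite -(Rintegral_prob_cst P1 M) -Rint_D//; last exact: bmeas_cst.
  apply: eq_Rintegral => x _; rewrite /G Rint_D//; last exact: bmeas_cst.
  by rewrite !Rintegral_prob_cst.
have E2 : \int[P2]_y (\int[P1]_x G (x, y)) = \int[P2]_y (\int[P1]_x F (x, y)) + M.
  rewrite -(Rintegral_prob_cst P2 M) -Rint_D//; last exact: bmeas_cst.
  apply: eq_Rintegral => x _; rewrite /G Rint_D//; last exact: bmeas_cst.
  by rewrite !Rintegral_prob_cst.
apply: (addIr M); rewrite -E1 -E2; apply: EFin_inj.
have mG : measurable_fun setT (EFin \o G) by apply/measurable_EFinP; case: bG.
have := @fubini_tonelli _ _ _ _ R P1 P2 (EFin \o G) mG (fun z => G0 z) => H.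
rewrite (Rint_EFin _ bJ1) (Rint_EFin _ bJ2).
transitivity (\int[P1]_x \int[P2]_y (G (x, y))%:E)%E.
  by apply: eq_integral => x _; rewrite Rint_EFin.
rewrite H; apply: eq_integral => y _; by rewrite Rint_EFin.
Qed.

(** Grouping ordered pairs into unordered ones produces the symmetrized kernel required by
    [degenerate_ustat_moment2]. *)
Lemma sum_off_diagonal (R : realType) (A : nat -> nat -> R) n :
  \sum_(i < n) \sum_(j < n | (j : nat) != i) A i j =
  \sum_(i < n) \sum_(j < i) (A i j + A j i).
Proof.
elim: n => [|n IH]; first by rewrite !big_ord0.
rewrite !big_ord_recr /= -IH.
have -> : \sum_(i < n) \sum_(j < n.+1 | (j : nat) != i) A i j =
    \sum_(i < n) \sum_(j < n | (j : nat) != i) A i j + \sum_(i < n) A i n.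
  rewrite -big_split; apply: eq_bigr => i _ /=.
  by rewrite big_mkcond big_ord_recr /= -big_mkcond/= gtn_eqF.
rewrite -addrA; congr (_ + _).
rewrite big_split/= addrC; congr (_ + _).
rewrite big_mkcond big_ord_recr /= -big_mkcond/= eqxx addr0.
by apply: eq_bigl => j; rewrite ltn_eqF.
Qed.

(** * The U-statistic in the linear part *)

Section ustatistic.
Context {R : realType} {d : nat}.
Local Notation lam := (@lebesgue_rV R d).
Context {dO : measure_display} {Omega : measurableType dO} (P : probability Omega R).
Variables (X : nat -> {RV P >-> 'rV[R]_d}) (e : nat -> {RV P >-> R}).
Hypotheses (iidX : iid X) (iide : iid e) (XeI : independent_sequences X e).
Variables (f : 'rV[R]_d -> R) (Fb : R).
Hypothesis Xf : has_density (X 0%N) f.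
Hypothesis fF : forall x, `|f x| <= Fb.
Variables (r : nat) (K : 'rV[R]_d -> R) (C1 : R).
Hypothesis Kr : kernel_order r K.
Hypothesis KC : forall u, `|K u| <= C1.
Hypothesis Ksym : symmetric_kernel K.
Variable h : R.
Hypothesis h0 : 0 < h.
Variable n : nat.
Hypothesis n0 : (0 < n)%N.
Variable Cb : R.
Hypothesis bias : forall x, `|smooth K f h x - f x| <= Cb * h ^+ r.
Variables (wt : 'rV[R]_d -> R) (Mw : R).
Hypothesis bw : bmeas wt.
Hypothesis wM : forall x, `|wt x| <= Mw.

Let sm := smooth K f h.
Let q x := wt x * f x.
(** [alp] and [bet] are the projections of [kk] on its first and second argument. [alp] smooths only
    the density and has bias [O(h^r)]; [bet] smooths [q], which may be discontinuous. *)
Let alp x := wt x * sm x.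
Let bet := smooth K q h.
Let kap := \int[lam]_u `|K u|.
Let hd := h ^+ d.
Let hd0 : 0 < hd. Proof. exact: exprn_gt0. Qed.
Let Fb0 : 0 <= Fb. Proof. by rewrite (le_trans _ (fF 0)). Qed.
Let C10 : 0 <= C1. Proof. by rewrite (le_trans _ (KC 0)). Qed.
Let Mw0 : 0 <= Mw. Proof. by rewrite (le_trans _ (wM 0)). Qed.
Let kap0 : 0 <= kap. Proof. exact: Rintegral_ge0. Qed.
Let T := C1 * (Fb * kap).
Let Mc := Mw * (Fb * kap).
Let nn : 0 < n%:R :> R. Proof. by rewrite ltr0n. Qed.

Let mf : measurable_fun setT f. Proof. by case: Xf. Qed.
Let bf : bmeas f. Proof. by split => //; exists Fb. Qed.
Let bq : bmeas q. Proof. exact: bmeasM. Qed.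
Let bsm : bmeas sm. Proof. exact: (bmeas_smooth_density Xf Kr KC h0). Qed.
Let balp : bmeas alp. Proof. exact: bmeasM. Qed.
Let bbet : bmeas bet. Proof. exact: (bmeas_smooth Xf Kr KC h0 bw). Qed.

Let alpM x : `|alp x| <= Mc.
Proof. by rewrite normrM ler_pM//; exact: (smooth_density_le Xf fF Kr). Qed.

Let betM x : `|bet x| <= Mc.
Proof.
rewrite /Mc mulrA; apply: (smooth_bounded Kr); first by case: bq.
by move=> y; rewrite normrM ler_pM.
Qed.

Let kk (z : 'rV[R]_d * 'rV[R]_d) := wt z.1 * kern K h z / hd.

Let bkern := bmeas_kern Kr KC h.
Let bkk : bmeas kk.
Proof.
apply: bmeasM; last exact: bmeas_cst.
by apply: bmeasM => //; exact: (@bmeas_fst _ _ _ _ _ wt bw).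
Qed.

Let bX0 (F : 'rV[R]_d -> R) : bmeas F -> bmeas (fun w => F (X 0%N w)).
Proof. by move=> bF; apply: (bmeas_comp bF). Qed.

Let bX1 (F : 'rV[R]_d * 'rV[R]_d -> R) x : bmeas F -> bmeas (fun w => F (x, X 0%N w)).
Proof. by move=> bF; apply: (bmeas_comp2 bF). Qed.

Let bX2 (F : 'rV[R]_d * 'rV[R]_d -> R) x : bmeas F -> bmeas (fun w => F (X 0%N w, x)).
Proof. by move=> bF; apply: (bmeas_comp2 bF). Qed.

Let kernC x y : kern K h (x, y) = kern K h (y, x).
Proof. by rewrite /kern /= -Ksym -scalerN opprB. Qed.

Let kk_meanr x : \int[P]_w kk (x, X 0%N w) = alp x.
Proof.
rewrite /kk /=; have bk : bmeas (fun w => kern K h (x, X 0%N w)) by exact: bX1.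
under eq_Rintegral do rewrite mulrAC.
by rewrite Rint_Zl// (kern_mean Xf Kr KC h0) /alp -/sm -/hd; field; rewrite gt_eqF.
Qed.

Let kk_meanl y : \int[P]_w kk (X 0%N w, y) = bet y.
Proof.
rewrite /kk /=; under eq_Rintegral do rewrite kernC.
rewrite Rint_Zr; last by apply: bmeasM; [exact: bX0|exact: bX1].
by rewrite (Rint_kern Xf Kr KC h0 y bw) -/q -/bet -/hd; field; rewrite gt_eqF.
Qed.

Let th := \int[P]_w alp (X 0%N w).

(** Both projections integrate to the double mean of [kk], so the mean of [bet] inherits the rate of
    [alp], which no direct estimate of the smoothing of [q] would give. *)
Let betE : \int[P]_w bet (X 0%N w) = th.
Proof.
rewrite /th.
have bF : bmeas (fun z : Omega * Omega => kk (X 0%N z.1, X 0%N z.2)).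
  apply: (bmeas_comp2 bkk).
    exact: (measurableT_comp (measurable_funP (X 0%N)) measurable_fst).
  exact: (measurableT_comp (measurable_funP (X 0%N)) measurable_snd).
transitivity (\int[P]_y (\int[P]_x kk (X 0%N x, X 0%N y))).
  by apply: eq_Rintegral => y _; exact: esym (kk_meanl (X 0%N y)).
apply: etrans (esym (Rint_swap P P bF)) _.
by apply: eq_Rintegral => x _; exact: (kk_meanr (X 0%N x)).
Qed.

Let thM : `|th| <= Mc.
Proof. by apply: Rint_norm_le => [|w]; [exact: bX0|exact: alpM]. Qed.

(* Hoeffding decomposition: [kk (x, y) = a (x, y) + alp x + bet y - th], where
   [a] has zero mean in each variable. *)
Let a (z : 'rV[R]_d * 'rV[R]_d) := kk z - alp z.1 - bet z.2 + th.

Let ba : bmeas a.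
Proof.
apply: bmeasD; last exact: bmeas_cst.
apply: bmeasB; last exact: (@bmeas_snd _ _ _ _ _ bet bbet).
by apply: bmeasB => //; exact: (@bmeas_fst _ _ _ _ _ alp balp).
Qed.

Let a_meanr x : \int[P]_w a (x, X 0%N w) = 0.
Proof.
rewrite /a /=; have b1 := bX1 x bkk; have b2 := bX0 bbet.
have b3 := bmeas_cst (T := Omega) (alp x); have b4 := bmeas_cst (T := Omega) th.
have b5 := bmeasB b1 b3; have b6 := bmeasB b5 b2.
by rewrite (Rint_D P b6 b4) (Rint_B P b5 b2) (Rint_B P b1 b3) kk_meanr betE !Rintegral_prob_cst; ring.
Qed.

Let a_meanl x : \int[P]_w a (X 0%N w, x) = 0.
Proof.
rewrite /a /=; have b1 := bX2 x bkk; have b2 := bX0 balp.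
have b3 := bmeas_cst (T := Omega) (bet x); have b4 := bmeas_cst (T := Omega) th.
have b5 := bmeasB b1 b2; have b6 := bmeasB b5 b3.
by rewrite (Rint_D P b6 b4) (Rint_B P b5 b3) (Rint_B P b1 b2) kk_meanl -/th !Rintegral_prob_cst; ring.
Qed.

(** The second moment of [kern] is at most [hd * T], and [kk] divides by [hd] before squaring. *)
Let tau1 := Mw ^+ 2 * T / hd.

Let kk_sqrr x : \int[P]_w kk (x, X 0%N w) ^+ 2 <= tau1.
Proof.
have bk : bmeas (fun w => kern K h (x, X 0%N w)) by exact: bX1.
have E w : kk (x, X 0%N w) ^+ 2 = (wt x ^+ 2 / hd ^+ 2) * kern K h (x, X 0%N w) ^+ 2.
  by rewrite /kk /=; field; rewrite gt_eqF.
under eq_Rintegral do rewrite E.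
rewrite Rint_Zl; last exact: bmeasX.
have w2 : wt x ^+ 2 <= Mw ^+ 2 by rewrite -(real_normK (num_real _)) lerXn2r ?nnegrE.
have := kern_sqr_mean Xf fF Kr KC h0 x; rewrite -/hd -/kap -/T => H.
have -> : tau1 = Mw ^+ 2 / hd ^+ 2 * (hd * T) by rewrite /tau1; field; rewrite gt_eqF.
apply: ler_pM => //; first by rewrite divr_ge0 ?sqr_ge0.
  by apply: Rintegral_ge0 => w _; exact: sqr_ge0.
by rewrite ler_wpM2r// invr_ge0 sqr_ge0.
Qed.

Let kk_sqrl y : \int[P]_w kk (X 0%N w, y) ^+ 2 <= tau1.
Proof.
have bk : bmeas (fun w => kern K h (y, X 0%N w)) by exact: bX1.
have := kern_sqr_mean Xf fF Kr KC h0 y; rewrite -/hd -/kap -/T => H.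
have -> : tau1 = Mw ^+ 2 / hd ^+ 2 * (hd * T) by rewrite /tau1; field; rewrite gt_eqF.
have c0 : 0 <= Mw ^+ 2 / hd ^+ 2 by rewrite divr_ge0 ?sqr_ge0.
apply: (le_trans _ (ler_wpM2l c0 H)).
have bk2 : bmeas (fun w => kern K h (y, X 0%N w) ^+ 2) by exact: bmeasX.
rewrite -Rint_Zl//; apply: Rint_le.
- by apply: bmeasX; exact: bX2.
- by apply: bmeasM => //; exact: bmeas_cst.
- move=> w; rewrite /kk /= kernC !exprMn exprVn mulrAC ler_wpM2r ?sqr_ge0//.
  rewrite ler_wpM2r ?invr_ge0 ?sqr_ge0//.
  by rewrite -(real_normK (num_real _)) lerXn2r ?nnegrE.
Qed.

Let sqrM (x M : R) : `|x| <= M -> x ^+ 2 <= M ^+ 2.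
Proof. by move=> xM; rewrite -(real_normK (num_real _)) lerXn2r ?nnegrE// (le_trans _ xM). Qed.

(** The square of a sum of four terms is at most four times the sum of squares, and three of the
    terms are bounded by [Mc]. *)
Let a2 z : a z ^+ 2 <= 4 * kk z ^+ 2 + 12 * Mc ^+ 2.
Proof.
have := sqrM (alpM z.1); have := sqrM (betM z.2); have := sqrM thM.
rewrite /a; set x := kk z; set y := alp _; set u := bet _; set t := th.
have := sqr_ge0 (x + y); have := sqr_ge0 (x + u); have := sqr_ge0 (x - t).
have := sqr_ge0 (y - u); have := sqr_ge0 (y + t); have := sqr_ge0 (u + t).
lra.
Qed.

Let Z (z : 'rV[R]_d * 'rV[R]_d) := a z + a (z.2, z.1).

Let bZ : bmeas Z.
Proof.
apply: bmeasD => //; apply: (bmeas_comp2 ba); [exact: measurable_snd|exact: measurable_fst].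
Qed.

Let Zr x : \int[P]_w Z (x, X 0%N w) = 0.
Proof.
by rewrite /Z /= Rint_D; [rewrite a_meanr a_meanl addr0|exact: bX1|exact: bX2].
Qed.

Let Zl x : \int[P]_w Z (X 0%N w, x) = 0.
Proof.
by rewrite /Z /= Rint_D; [rewrite a_meanr a_meanl addr0|exact: bX2|exact: bX1].
Qed.

(** By [a2], the square of a sum of two values of [a] is at most [8] times the two squares of [kk]
    plus [48 * Mc ^+ 2]; each square averages to at most [tau1]. *)
Let tau3 := 16 * (tau1 + 3 * Mc ^+ 2).

Let Z2 x : \int[P]_w Z (x, X 0%N w) ^+ 2 <= tau3.
Proof.
have b1 : bmeas (fun w => kk (x, X 0%N w) ^+ 2) by apply: bmeasX; exact: bX1.
have b2 : bmeas (fun w => kk (X 0%N w, x) ^+ 2) by apply: bmeasX; exact: bX2.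
have b3 := bmeasD b1 b2.
have b4 := bmeasM (bmeas_cst (T := Omega) 8) b3.
have b5 := bmeas_cst (T := Omega) (48 * Mc ^+ 2).
apply: (@le_trans _ _ (\int[P]_w (8 * (kk (x, X 0%N w) ^+ 2 + kk (X 0%N w, x) ^+ 2) + 48 * Mc ^+ 2))).
  apply: Rint_le.
  - by apply: bmeasX; exact: bX1.
  - exact: bmeasD.
  - move=> w; have := a2 (x, X 0%N w); have := a2 (X 0%N w, x); rewrite /Z /=.
    set u := a _; set v := a _; have := sqr_ge0 (u - v); lra.
rewrite (Rint_D P b4 b5) (Rint_Zl P _ b3) (Rint_D P b1 b2) Rintegral_prob_cst /tau3.
by have := kk_sqrr x; have := kk_sqrl x; lra.
Qed.

Let U w := \sum_(i < n) \sum_(j < i) Z (X i w, X j w).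

Let EU : \int[P]_w U w ^+ 2 <= n%:R ^+ 2 * tau3.
Proof. exact: (degenerate_ustat_moment2 iidX iide XeI bZ Zr Z2 Zl). Qed.

Let fhat i w := loo_kde K h n (fun j => X j w) i (X i w).

Let weighted_sum w : \sum_(i < n) wt (X i w) * fhat i w =
  U w / n%:R + (n%:R - 1) / n%:R * (\sum_(i < n) (alp (X i w) + bet (X i w))) -
  (n%:R - 1) * th.
Proof.
have E1 : \sum_(i < n) wt (X i w) * fhat i w =
    n%:R^-1 * \sum_(i < n) \sum_(j < n | (j : nat) != i) kk (X i w, X j w).
  rewrite mulr_sumr; apply: eq_bigr => i _; rewrite /fhat /loo_kde -/hd.
  rewrite invfM !mulrA mulr_sumr [RHS]mulr_sumr; apply: eq_bigr => j _.
  by rewrite /kk /kern /=; ring.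
have E2 : \sum_(i < n) \sum_(j < n | (j : nat) != i) kk (X i w, X j w) =
    \sum_(i < n) \sum_(j < n | (j : nat) != i) a (X i w, X j w) +
    \sum_(i < n) \sum_(j < n | (j : nat) != i) (alp (X i w) + bet (X j w) - th).
  rewrite -big_split; apply: eq_bigr => i _ /=; rewrite -big_split.
  by apply: eq_bigr => j _ /=; rewrite /a /=; ring.
have E3 : \sum_(i < n) \sum_(j < n | (j : nat) != i) a (X i w, X j w) = U w.
  exact: (sum_off_diagonal (fun i j => a (X i w, X j w))).
have E4 : \sum_(i < n) \sum_(j < n | (j : nat) != i) (alp (X i w) + bet (X j w) - th) =
    (n%:R - 1) * (\sum_(i < n) (alp (X i w) + bet (X i w))) - n%:R * (n%:R - 1) * th.
  transitivity (\sum_(i < n) ((n%:R - 1) * (alp (X i w) - th) +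
      (\sum_(j < n) bet (X j w) - bet (X i w)))).
    apply: eq_bigr => i _.
    under eq_bigr => j _ do rewrite addrAC.
    rewrite big_split/= sum_other_const// -subn1 natrB//; congr (_ + _).
    rewrite [in RHS](bigD1 i)//= addrC addrK.
    by apply: eq_bigl => j; rewrite -val_eqE.
  rewrite big_split/= sumrB sumr_const card_ord -mulr_sumr sumrB sumr_const card_ord.
  by rewrite big_split/= -[th *+ _]mulr_natl -[(\sum_(_ < _) bet _) *+ _]mulr_natl; ring.
by rewrite E1 E2 E3 E4; field; rewrite gt_eqF.
Qed.

Let c := \int[P]_w q (X 0%N w).

(** To first order [1 / F] is [(2 f - F) / f^2]; multiplied by the numerator [wt * f^2] this gives
    [2 * q - wt * F]. The sum is centered at [n * c], with [c] the mean of [q]. *)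
Definition ustat_error w :=
  \sum_(i < n) (2 * q (X i w) - wt (X i w) * fhat i w) - n%:R * c.

(* The linear part: the projections [alp] and [bet] are both close to [q], so it
   cancels asymptotically. *)
Let gam0 x := 2 * q x - (n%:R - 1) / n%:R * (alp x + bet x).
Let gam1 x := gam0 x - \int[P]_w gam0 (X 0%N w).

Let bgam0 : bmeas gam0.
Proof.
apply: bmeasB; first by apply: bmeasM => //; exact: bmeas_cst.
by apply: bmeasM; [exact: bmeas_cst|exact: bmeasD].
Qed.

Let Egam0 : \int[P]_w gam0 (X 0%N w) = 2 * c - 2 * ((n%:R - 1) / n%:R) * th.
Proof.
have b1 := bX0 bq; have b2 := bX0 balp; have b3 := bX0 bbet.
have b4 := bmeasD b2 b3; have b5 := bmeasM (bmeas_cst (T := Omega) 2) b1.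
have b6 := bmeasM (bmeas_cst (T := Omega) ((n%:R - 1) / n%:R)) b4.
by rewrite /gam0 (Rint_B P b5 b6) (Rint_Zl P 2 b1) (Rint_Zl P _ b4) (Rint_D P b2 b3) betE -/th -/c; ring.
Qed.

Let ustat_errorE w : ustat_error w =
  \sum_(i < n) gam1 (X i w) - U w / n%:R + (n%:R * c - (n%:R - 1) * th).
Proof.
rewrite /ustat_error sumrB weighted_sum /gam1 sumrB sumr_const card_ord Egam0.
rewrite /gam0 sumrB -!mulr_sumr -mulr_natl.
by field; rewrite gt_eqF.
Qed.

Variable Vq : R.
Hypothesis smooth_q : \int[P]_w (bet (X 0%N w) - q (X 0%N w)) ^+ 2 <= Vq.

Let G := 3 * (Mw * (Cb * h ^+ r)) ^+ 2 + 3 * Vq + 12 * Mc ^+ 2 / n%:R ^+ 2.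

Let alpq x : `|alp x - q x| <= Mw * (Cb * h ^+ r).
Proof. by rewrite -mulrBr normrM ler_pM//; exact: bias. Qed.

Let gam0_sqr : \int[P]_w gam0 (X 0%N w) ^+ 2 <= G.
Proof.
have b1 : bmeas (fun w => (bet (X 0%N w) - q (X 0%N w)) ^+ 2).
  by apply: bmeasX; apply: bmeasB; exact: bX0.
have b2 := bmeasM (bmeas_cst (T := Omega) 3) b1.
pose G1 := 3 * (Mw * (Cb * h ^+ r)) ^+ 2 + 12 * Mc ^+ 2 / n%:R ^+ 2.
apply: (@le_trans _ _ (\int[P]_w (3 * (bet (X 0%N w) - q (X 0%N w)) ^+ 2 + G1))); last first.
  rewrite Rint_D//; last exact: bmeas_cst.
  by rewrite Rint_Zl// Rintegral_prob_cst /G /G1; have := smooth_q; lra.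
apply: Rint_le.
- by apply: bmeasX; exact: bX0.
- by apply: bmeasD => //; exact: bmeas_cst.
move=> w; set x := X 0%N w.
have H1 := sqrM (alpq x).
have H2 : ((alp x + bet x) / n%:R) ^+ 2 <= 4 * Mc ^+ 2 / n%:R ^+ 2.
  rewrite exprMn exprVn ler_wpM2r ?invr_ge0 ?sqr_ge0//.
  have := sqrM (alpM x); have := sqrM (betM x); have := sqr_ge0 (alp x - bet x); lra.
have -> : gam0 x = (bet x - q x) * -1 - (alp x - q x) + (alp x + bet x) / n%:R.
  by rewrite /gam0; field; rewrite gt_eqF.
rewrite /G1; move: H1 H2; set s := bet x - q x; set t := alp x - q x.
rewrite (_ : 12 * Mc ^+ 2 / n%:R ^+ 2 = 3 * (4 * Mc ^+ 2 / n%:R ^+ 2)); last by ring.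
set v := _ / n%:R; set V := 4 * _ / _ => H1 H2.
have := sqr_ge0 (s - t); have := sqr_ge0 (s + v); have := sqr_ge0 (t + v); lra.
Qed.

Let gam1_sqr : \int[P]_w gam1 (X 0%N w) ^+ 2 <= G.
Proof.
apply: (le_trans _ gam0_sqr); rewrite /gam1; set m := \int[P]_w gam0 (X 0%N w).
have b1 := bX0 bgam0; have b2 : bmeas (fun w => gam0 (X 0%N w) ^+ 2) by exact: bmeasX.
have b3 := bmeasM (bmeas_cst (T := Omega) (2 * m)) b1.
have E w : (gam0 (X 0%N w) - m) ^+ 2 =
    (gam0 (X 0%N w) ^+ 2 - (2 * m) * gam0 (X 0%N w)) + m ^+ 2 by ring.
have b4 := bmeas_cst (T := Omega) (m ^+ 2).
have b5 := bmeasB b2 b3.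
have -> := eq_Rintegral P (fun w _ => E w).
rewrite (Rint_D P b5 b4) (Rint_B P b2 b3) (Rint_Zl P _ b1) -/m Rintegral_prob_cst.
have := sqr_ge0 m; lra.
Qed.

Let gam1_mean : \int[P]_w gam1 (X 0%N w) = 0.
Proof.
rewrite /gam1 Rint_B; [|exact: bX0|exact: bmeas_cst].
by rewrite Rintegral_prob_cst subrr.
Qed.

Let bgam1 : bmeas gam1.
Proof. by apply: bmeasB => //; exact: bmeas_cst. Qed.

Let Egam1 := centered_sum_moment2 iidX iide XeI n bgam1 gam1_mean gam1_sqr.

Let Bn := n%:R * (Mw * (Cb * h ^+ r)) + Mc.

(** [n c - (n - 1) th = n (c - th) + th], where [c - th] is a mean of [q - alp], of order [h^r]. *)
Let mean_bias : `|n%:R * c - (n%:R - 1) * th| <= Bn.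
Proof.
rewrite (_ : _ - _ = n%:R * (c - th) + th); last by ring.
rewrite (le_trans (ler_normD _ _))// lerD// normrM (gtr0_norm nn) ler_wpM2l ?ler0n//.
have b1 := bX0 bq; have b2 := bX0 balp.
rewrite /c /th -Rint_B//; apply: Rint_norm_le; first exact: bmeasB.
by move=> w; rewrite distrC.
Qed.

Lemma bmeas_ustat_error : bmeas ustat_error.
Proof.
apply: bmeasB; last exact: bmeas_cst.
apply: bmeas_sum => i _; apply: bmeasB.
  by apply: bmeasM; [exact: bmeas_cst|exact: (bmeas_comp bq)].
by apply: bmeasM; [exact: (bmeas_comp bw)|apply: (bmeas_loo Kr KC)].
Qed.

(** Of the three parts, the i.i.d. sum costs [n * G], the degenerate one [tau3] after its division
    by [n], and the deterministic one [Bn ^+ 2]. *)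
Lemma ustat_error_moment2 :
  \int[P]_w ustat_error w ^+ 2 <= 3 * (n%:R * G + tau3 + Bn ^+ 2).
Proof.
have bS : bmeas (fun w => \sum_(i < n) gam1 (X i w)).
  by apply: bmeas_sum => i _; exact: (bmeas_comp bgam1).
have bU : bmeas U.
  by apply: bmeas_sum => i _; apply: bmeas_sum => j _; exact: (bmeas_comp2 bZ).
have bS2 := bmeasX 2 bS; have bU2 := bmeasX 2 bU.
have b1 := bmeasM (bmeas_cst (T := Omega) (3 / n%:R ^+ 2)) bU2.
have b2 := bmeasM (bmeas_cst (T := Omega) 3) bS2.
have b3 := bmeasD b2 b1.
have b4 := bmeas_cst (T := Omega) (3 * Bn ^+ 2).
apply: (@le_trans _ _ (\int[P]_w (3 * (\sum_(i < n) gam1 (X i w)) ^+ 2 +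
    3 / n%:R ^+ 2 * U w ^+ 2 + 3 * Bn ^+ 2))).
  apply: Rint_le.
  - by apply: bmeasX; exact: bmeas_ustat_error.
  - exact: bmeasD.
  - move=> w; rewrite ustat_errorE; have := sqrM mean_bias.
    rewrite (_ : 3 / n%:R ^+ 2 * U w ^+ 2 = 3 * (U w / n%:R) ^+ 2); last first.
      by field; rewrite gt_eqF.
    set s := \sum_(_ < _) _; set u := U w / _; set v := _ - _ * th.
    have := sqr_ge0 (s + u); have := sqr_ge0 (s - v); have := sqr_ge0 (u + v); lra.
rewrite (Rint_D P b3 b4) (Rint_D P b2 b1) (Rint_Zl P _ bS2) (Rint_Zl P _ bU2) Rintegral_prob_cst.
have H : 3 / n%:R ^+ 2 * (\int[P]_w U w ^+ 2) <= 3 * tau3.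
  have -> : 3 * tau3 = 3 / n%:R ^+ 2 * (n%:R ^+ 2 * tau3) by field; rewrite gt_eqF.
  by rewrite ler_wpM2l// divr_ge0// sqr_ge0.
have := Egam1; lra.
Qed.

End ustatistic.

(** The inverse is continuous away from [0]; the point [0], where its value is [0] by convention, is
    a measurable singleton. *)
Lemma measurable_invr (R : realType) : measurable_fun setT (fun x : R => x^-1).
Proof.
have -> : [set: R] = [set 0] `|` ~` [set 0] by rewrite setUv.
apply/measurable_funU => //; first exact: measurableC.
split; first exact: measurable_fun_set1.
apply: open_continuous_measurable_fun; first exact: closed_openC.
by move=> x; rewrite inE /= => /eqP x0; exact: inv_continuous.
Qed.
Lemma measurable_max_inv (R : realType) (b : R) : 0 < b ->
  bmeas (fun x : R => (Num.max b x)^-1).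
Proof.
move=> b0; split.
  apply: (measurableT_comp (@measurable_invr R)); exact: measurable_maxr.
exists b^-1 => x; have m0 : b <= Num.max b x by rewrite le_max lexx.
rewrite ger0_norm ?invr_ge0 ?(le_trans (ltW b0))// lef_pV2 ?posrE//.
exact: lt_le_trans m0.
Qed.

(** * Comparison of the estimator with its main term *)

Section comparison.
Context {R : realType} {d : nat}.
Local Notation lam := (@lebesgue_rV R d).
Context {dO : measure_display} {Omega : measurableType dO} (P : probability Omega R).
Variables (X : nat -> {RV P >-> 'rV[R]_d}) (e : nat -> {RV P >-> R}).
Hypotheses (iidX : iid X) (iide : iid e) (XeI : independent_sequences X e).
Hypothesis Ee0 : \int[P]_w e 0%N w = 0.
Hypothesis Ee2 : P.-integrable setT (fun w => (e 0%N w ^+ 2)%:E).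
Variables (f : 'rV[R]_d -> R) (Fb : R).
Hypothesis Xf : has_density (X 0%N) f.
Hypothesis fF : forall x, `|f x| <= Fb.
Variables (r : nat) (K : 'rV[R]_d -> R) (C1 : R).
Hypothesis Kr : kernel_order r K.
Hypothesis KC : forall u, `|K u| <= C1.
Hypothesis Ksym : symmetric_kernel K.
Variables (wt sf : 'rV[R]_d -> R) (Mw Ms b : R) (Q : set 'rV[R]_d).
Hypothesis bw : bmeas wt.
Hypothesis wM : forall x, `|wt x| <= Mw.
Hypothesis bs : bmeas sf.
Hypothesis sM : forall x, `|sf x| <= Ms.
Hypothesis w0 : forall x, ~ Q x -> wt x = 0.
Hypothesis s0 : forall x, ~ Q x -> sf x = 0.
Hypothesis b0 : 0 < b.
Hypothesis fb : forall x, Q x -> b <= f x.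
Variable h : R.
Hypothesis h0 : 0 < h.
Variable n : nat.
Hypothesis n0 : (0 < n)%N.
Variable Cb : R.
Hypothesis bias : forall x, `|smooth K f h x - f x| <= Cb * h ^+ r.

Let kap := \int[lam]_u `|K u|.
Let T := C1 * (Fb * kap).
Let nh := n%:R * h ^+ d.
Let bet := Cb * h ^+ r + Fb * kap / n%:R.
Let VD := 2 * T / nh + 2 * bet ^+ 2.
Let nn : 0 < n%:R :> R. Proof. by rewrite ltr0n. Qed.
Let nh0 : 0 < nh. Proof. by rewrite mulr_gt0// exprn_gt0. Qed.
Let rn := Num.sqrt (n%:R : R).
Let rn0 : 0 < rn. Proof. by rewrite sqrtr_gt0. Qed.
Let rn2 : rn ^+ 2 = n%:R. Proof. by rewrite sqr_sqrtr// ltW. Qed.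
Let Ms0 : 0 <= Ms. Proof. by rewrite (le_trans _ (sM 0)). Qed.
Let Mw0 : 0 <= Mw. Proof. by rewrite (le_trans _ (wM 0)). Qed.
Let b2 : 0 < b / 2. Proof. by rewrite divr_gt0. Qed.
Let b4 : 0 < b / 4. Proof. by rewrite divr_gt0. Qed.

Let fhat i w := loo_kde K h n (fun j => X j w) i (X i w).
(* Equals [x^-1] for [b / 2 <= x], and is bounded everywhere. *)
Let tinv x := (Num.max (b / 2) x)^-1.
(** In the application [wt] is [g psi / f^2] and [sf] is [sigma psi / f], so [phi] and [s] are
    [g psi] and [sigma psi], and the numerators in [Zn] are the products of [Y] with [psi]. *)
Let phi x := wt x * f x ^+ 2.
Let s x := sf x * f x.
Let c := \int[P]_w (wt (X 0%N w) * f (X 0%N w)).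

Let Zn w := rn * (n%:R^-1 * \sum_(i < n) (phi (X i w) + s (X i w) * e i w) / fhat i w - c).
Let Nn w := rn^-1 * \sum_(i < n) sf (X i w) * e i w.
Let D i (w : Omega) := sf (X i w) * (f (X i w) - fhat i w) * tinv (fhat i w).
(* [A1], [A2], [A3]: noise, quadratic and U-statistic parts of the remainder when
   [b / 2 <= fhat i] at all sample points of [Q]; [A4] is at least [1] otherwise. *)
Let A1 w := \sum_(i < n) e i w * D i w.
Let A2 w := \sum_(i < n) wt (X i w) * (fhat i w - f (X i w)) ^+ 2 * tinv (fhat i w).
Let A3 w := ustat_error X f K h n wt w.
Let A4 w := \sum_(i < n) (kern_dev X f K h n i w / (b / 4 * nh)) ^+ 4.

Let tinv_le x : 0 <= tinv x <= 2 / b.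
Proof.
have m0 : b / 2 <= Num.max (b / 2) x by rewrite le_max lexx.
have M0 := lt_le_trans b2 m0.
by rewrite invr_ge0 (ltW M0)/= -[2 / b]invf_div lef_pV2 ?posrE.
Qed.

Let bf : bmeas f. Proof. by split; [case: Xf|exists Fb]. Qed.

Let btinv := measurable_max_inv b2.

Let bDseq i : bmeas (fun w : seqT X => D i w).
Proof.
have mX j := measurable_seqT X j.
have bl := bmeas_loo Kr KC h n i mX.
apply: bmeasM; last exact: (bmeas_comp btinv (bmeas_meas bl)).
apply: bmeasM; first exact: (bmeas_comp bs (mX i)).
by apply: bmeasB => //; exact: (bmeas_comp bf (mX i)).
Qed.

Let bloo i : bmeas (fhat i).
Proof. by apply: (bmeas_loo Kr KC). Qed.

Let bdev2 i : bmeas (fun w => (fhat i w - f (X i w)) ^+ 2).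
Proof. by apply: bmeasX; apply: bmeasB => //; exact: (bmeas_comp bf). Qed.

Let bD i : bmeas (fun w : Omega => D i w).
Proof. exact: (bmeas_comp (bDseq i) (measurable_to_seqT X)). Qed.

Let tauD := (Ms * (2 / b)) ^+ 2 * VD.

Let dev2 i : (i < n)%N -> \int[P]_w (fhat i w - f (X i w)) ^+ 2 <= VD.
Proof. by move=> ni; exact: (loo_dev2 iidX iide XeI Xf fF Kr KC h0 n0 bias ni). Qed.

Let D2 i : (i < n)%N -> \int[P]_w D i w ^+ 2 <= tauD.
Proof.
move=> ni; apply: (le_trans _ (ler_wpM2l (sqr_ge0 _) (dev2 ni))).
rewrite -(Rint_Zl P _ (bdev2 i)); apply: Rint_le.
- exact: bmeasX.
- by apply: bmeasM => //; exact: bmeas_cst.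
move=> w; have -> : D i w ^+ 2 = (sf (X i w) * tinv (fhat i w)) ^+ 2 * (fhat i w - f (X i w)) ^+ 2.
  by rewrite /D; ring.
rewrite ler_wpM2r ?sqr_ge0// -(real_normK (num_real _)) lerXn2r ?nnegrE//.
  by rewrite mulr_ge0// divr_ge0// ltW.
have /andP[t0 t1] := tinv_le (fhat i w).
by rewrite normrM (ger0_norm t0) ler_pM.
Qed.

Let sum_cst (x : R) : n%:R * x = \sum_(i < n) x.
Proof. by rewrite sumr_const card_ord mulr_natl. Qed.

Let A1_moment : P.-integrable setT (EFin \o (fun w => A1 w ^+ 2)) /\
  \int[P]_w A1 w ^+ 2 <= n%:R * (\int[P]_w e 0%N w ^+ 2 * tauD).
Proof. exact: (sum_noise_moment2 iide XeI Ee0 Ee2 bDseq D2). Qed.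

Let bA2 : bmeas A2.
Proof.
apply: bmeas_sum => i _; apply: bmeasM.
  by apply: bmeasM => //; exact: (bmeas_comp bw).
exact: (bmeas_comp btinv (bmeas_meas (bloo i))).
Qed.

Let A2_mean : \int[P]_w `|A2 w| <= n%:R * (Mw * (2 / b) * VD).
Proof.
pose B w := \sum_(i < n) (Mw * (2 / b)) * (fhat i w - f (X i w)) ^+ 2.
have bB (i : 'I_n) : bmeas (fun w => (Mw * (2 / b)) * (fhat i w - f (X i w)) ^+ 2).
  by apply: bmeasM => //; exact: bmeas_cst.
apply: (@le_trans _ _ (\int[P]_w B w)).
  apply: Rint_le; [exact: bmeas_norm|by apply: bmeas_sum|].
  move=> w; rewrite /A2 (le_trans (ler_norm_sum _ _ _))//; apply: ler_sum => i _.
  have /andP[t0 t1] := tinv_le (fhat i w).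
  rewrite normrM (ger0_norm t0) normrM (ger0_norm (sqr_ge0 _)) mulrAC.
  by rewrite ler_wpM2r ?sqr_ge0// ler_pM.
rewrite /B Rint_sum//.
rewrite sum_cst; apply: ler_sum => i _.
rewrite (Rint_Zl P _ (bdev2 i)) ler_wpM2l ?dev2//.
by rewrite mulr_ge0// divr_ge0// ltW.
Qed.

Let bA4 : bmeas A4.
Proof.
apply: bmeas_sum => i _; apply: bmeasX; apply: bmeasM; last exact: bmeas_cst.
exact: (bmeas_kern_dev Xf Kr KC h0).
Qed.

Let V4 := n%:R * ((8 * (nh * T) ^+ 2 + 12 * C1 ^+ 2 * (nh * T)) / (b / 4 * nh) ^+ 4).

Let A4_mean : \int[P]_w A4 w <= V4.
Proof.
have bk i : bmeas (fun w => kern_dev X f K h n i w ^+ 4).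
  by apply: bmeasX; exact: (bmeas_kern_dev Xf Kr KC h0).
have E i w : (kern_dev X f K h n i w / (b / 4 * nh)) ^+ 4 =
  ((b / 4 * nh) ^+ 4)^-1 * kern_dev X f K h n i w ^+ 4 by rewrite exprMn exprVn mulrC.
rewrite /A4 Rint_sum; last first.
  move=> i _; have := bmeasM (bmeas_cst (T := Omega) (((b / 4 * nh) ^+ 4)^-1)) (bk i).
  by under [in X in _ -> X]eq_fun do rewrite E.
rewrite /V4 sum_cst; apply: ler_sum => i _.
rewrite (eq_Rintegral P (fun w _ => E i w)) (Rint_Zl P _ (bk i)) mulrC.
apply: ler_wpM2r; first by rewrite invr_ge0 exprn_ge0// ltW// mulr_gt0.
exact: (kern_dev4 iidX iide XeI Xf fF Kr KC h0 n i).
Qed.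

Variables (u : R -> R) (L : R).
Hypothesis bu : bmeas u.
Hypothesis u01 : forall x, 0 <= u x <= 1.
Hypothesis L0 : 0 <= L.
Hypothesis uL : forall x y, `|u x - u y| <= L * `|x - y|.
Hypothesis bet_small : bet <= b / 4.

(** With [F] for the estimator, [f^2 / F = 2 f - F + (F - f)^2 / F] and [f / F = 1 + (f - F) / F]
    exactly. Points outside [Q] contribute nothing, as both weights vanish there. *)
Let good_event w : (forall i : 'I_n, Q (X i w) -> b / 2 <= fhat i w) ->
  Zn w - Nn w = rn^-1 * (A1 w + A2 w + A3 w).
Proof.
move=> good.
have -> : Zn w = rn^-1 * (\sum_(i < n) (phi (X i w) + s (X i w) * e i w) / fhat i w - n%:R * c).
  rewrite /Zn -rn2; field; by rewrite gt_eqF.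
rewrite -mulrBr; congr (_ * _); rewrite /A3 /ustat_error -/c.
rewrite [LHS]addrAC [RHS]addrA; congr (_ - _).
rewrite -sumrB -!big_split; apply: eq_bigr => i _ /=.
rewrite -/(fhat i w) /D /phi /s.
have [Qi|nQ] := pselect (Q (X i w)); last by rewrite w0// s0//; ring.
have Fg := good i Qi; have F0 := lt_le_trans b2 Fg.
by rewrite /tinv (max_idPr Fg); field; rewrite gt_eqF.
Qed.

(** If the estimator falls below [b / 2] where [f] is at least [b], it is off by more than [b / 2];
    the bias accounts for at most [b / 4], so one normalized deviation in [A4] is at least [1] in
    absolute value. *)
Let bad_event w : ~ (forall i : 'I_n, Q (X i w) -> b / 2 <= fhat i w) -> 1 <= A4 w.
Proof.
move=> /existsNP[i /not_implyP[Qi /negP]]; rewrite -ltNge => Fi.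
rewrite /A4 (bigD1 i)//= -[leLHS]addr0 lerD//; last first.
  by apply: sumr_ge0 => j _; rewrite exprn_even_ge0.
have H := loo_dev Xf fF Kr h0 n0 bias w (ltn_ord i).
rewrite -/(fhat i w) -/nh -/bet in H.
have fi := fb Qi.
have H2 : b / 4 <= `|kern_dev X f K h n i w| / nh.
  have : b / 2 <= `|fhat i w - f (X i w)| by rewrite distrC (le_trans _ (ler_norm _))//; lra.
  move: H bet_small; set t := `|fhat i w - _|; set v := _ / nh; lra.
rewrite -[leRHS]ger0_norm ?exprn_even_ge0// normrX exprn_ege1//.
rewrite normrM normfV (gtr0_norm (mulr_gt0 b4 nh0)).
by rewrite (ler_pdivlMr _ _ (mulr_gt0 b4 nh0)) mul1r -(ler_pdivlMr _ _ nh0).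
Qed.

(** The inequality [y <= del + y^2 / del] at [y = |x| / rn]; it lets second moments control first
    moments with a free parameter. *)
Let rmul_le (x del : R) : 0 < del -> rn^-1 * `|x| <= del + (n%:R * del)^-1 * x ^+ 2.
Proof.
move=> d0; have -> : (n%:R * del)^-1 * x ^+ 2 = (rn^-1 * `|x|) ^+ 2 / del.
  by rewrite exprMn exprVn rn2 real_normK ?num_real// invfM mulrAC.
set y := rn^-1 * _; have := sqr_ge0 (y - del).
rewrite -subr_ge0 => H.
have -> : del + y ^+ 2 / del - y = (del ^+ 2 + y ^+ 2 - y * del) / del.
  by field; rewrite gt_eqF.
rewrite divr_ge0 ?(ltW d0)//; have := sqr_ge0 y; have := sqr_ge0 del; lra.
Qed.

(** The Lipschitz bound serves on the good event; on its complement [u] varies by at most [1], which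
    [A4] dominates. *)
Let pointwise w : `|u (Zn w) - u (Nn w)| <= L * (rn^-1 * (`|A1 w| + `|A2 w| + `|A3 w|)) + A4 w.
Proof.
have A40 : 0 <= A4 w by apply: sumr_ge0 => j _; rewrite exprn_even_ge0.
have [good|bad] := pselect (forall i : 'I_n, Q (X i w) -> b / 2 <= fhat i w).
  rewrite (le_trans (uL _ _))// (good_event good) -[leLHS]addr0 lerD// ler_wpM2l//.
  rewrite normrM (ger0_norm (_ : 0 <= rn^-1)) ?invr_ge0 ?(ltW rn0)//.
  rewrite ler_wpM2l ?invr_ge0 ?(ltW rn0)// (le_trans (ler_normD _ _))// lerD//.
  exact: ler_normD.
rewrite (le_trans (y := 1))//.
  have /andP[? ?] := u01 (Zn w); have /andP[? ?] := u01 (Nn w).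
  by rewrite ler_norml; apply/andP; split; lra.
rewrite -[leLHS]add0r lerD ?(bad_event bad)// mulr_ge0// mulr_ge0 ?invr_ge0 ?(ltW rn0)//.
Qed.

Lemma measurable_estimator : measurable_fun setT Zn.
Proof.
have mf : measurable_fun setT f by case: bf.
apply: measurable_funM => //; apply: measurable_funB => //; apply: measurable_funM => //.
apply: measurable_sum => i; apply: measurable_funM; last first.
  by apply: (measurableT_comp (@measurable_invr R)); case: (bloo i).
have mc (F : 'rV[R]_d -> R) : bmeas F -> measurable_fun setT (fun w => F (X i w)).
  by case=> mF _; exact: (measurableT_comp mF).
apply: measurable_funD; first by apply: (mc phi); apply: bmeasM => //; exact: bmeasX.
by apply: measurable_funM => //; apply: (mc s); exact: bmeasM.
Qed.

Lemma measurable_main_term : measurable_fun setT Nn.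
Proof.
apply: measurable_funM => //; apply: measurable_sum => i; apply: measurable_funM => //.
by case: bs => ms _; exact: (measurableT_comp ms).
Qed.

Variable Vq : R.
Hypothesis smooth_q : \int[P]_w (smooth K (fun x => wt x * f x)%R h (X 0%N w) -
  wt (X 0%N w) * f (X 0%N w)) ^+ 2 <= Vq.

Let Mc := Mw * (Fb * kap).
Let V1 := \int[P]_w e 0%N w ^+ 2 * tauD.
Let V3 := 3 * (n%:R * (3 * (Mw * (Cb * h ^+ r)) ^+ 2 + 3 * Vq + 12 * Mc ^+ 2 / n%:R ^+ 2) +
  16 * (Mw ^+ 2 * T / h ^+ d + 3 * Mc ^+ 2) + (n%:R * (Mw * (Cb * h ^+ r)) + Mc) ^+ 2).

Let A3_moment : \int[P]_w A3 w ^+ 2 <= V3.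
Proof.
exact: (ustat_error_moment2 iidX iide XeI Xf fF Kr KC Ksym h0 n0 bias bw wM smooth_q).
Qed.

Let bA3 : bmeas A3. Proof. exact: (bmeas_ustat_error Xf fF Kr KC h n bw). Qed.

(** The expectation of [pointwise], with [rmul_le] applied to [A1] and [A3], for which second
    moments are known, while [A2] and [A4] are bounded in mean. *)
Lemma estimator_comparison (del : R) : 0 < del ->
  `|\int[P]_w u (Zn w) - \int[P]_w u (Nn w)| <=
  L * (2 * del + V1 / del + rn * (Mw * (2 / b) * VD) + V3 / n%:R / del) + V4.
Proof.
move=> d0.
have buZ := bmeas_comp bu measurable_estimator.
have buN := bmeas_comp bu measurable_main_term.
rewrite -(Rint_B P buZ buN); have bB := bmeasB buZ buN.
apply: (le_trans (Rint_norm P bB)).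
have [iA1 EA1] := A1_moment.
pose k := (n%:R * del)^-1.
have k0 : 0 <= k by rewrite invr_ge0 mulr_ge0 ?(ltW nn) ?(ltW d0).
pose B w := (L * (2 * del) + L * k * A3 w ^+ 2) + (L * rn^-1 * `|A2 w| + A4 w).
have b1 := bmeasX 2 bA3; have b2' := bmeas_norm bA2.
have b3 := bmeasM (bmeas_cst (T := Omega) (L * k)) b1.
have b4' := bmeasM (bmeas_cst (T := Omega) (L * rn^-1)) b2'.
have b5 := bmeasD b4' bA4.
have b6 := bmeasD (bmeas_cst (T := Omega) (L * (2 * del))) b3.
have bBB : bmeas B := bmeasD b6 b5.
have iB := bmeas_integrable P bBB.
have iA := integrable_realZ (L * k) iA1.
apply: (@le_trans _ _ (\int[P]_w (L * k * A1 w ^+ 2 + B w))).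
  apply: le_Rintegral => //.
  - exact: (bmeas_integrable P (bmeas_norm bB)).
  - exact: integrable_realD.
  move=> w _; apply: (le_trans (pointwise w)).
  have h1 := rmul_le (A1 w) d0; have h3 := rmul_le (A3 w) d0; rewrite -/k in h1 h3.
  rewrite /B !mulrDr.
  have := ler_wpM2l L0 h1; have := ler_wpM2l L0 h3.
  rewrite !mulrDr !mulrA; lra.
rewrite (RintegralD measurableT iA iB) RintegralZl//.
rewrite /B (Rint_D P b6 b5) (Rint_D P (bmeas_cst (T := Omega) (L * (2 * del))) b3).
rewrite (Rint_D P b4' bA4) (Rint_Zl P _ b1) (Rint_Zl P _ b2') Rintegral_prob_cst.
have Lk0 : 0 <= L * k by rewrite mulr_ge0.
have Lr0 : 0 <= L * rn^-1 by rewrite mulr_ge0// invr_ge0 ltW.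
have H1 : L * k * (\int[P]_w A1 w ^+ 2) <= L * (V1 / del).
  apply: (le_trans (ler_wpM2l Lk0 EA1)); rewrite -/V1 /k.
  by rewrite le_eqVlt; apply/orP; left; apply/eqP; field; rewrite !gt_eqF.
have H3 : L * k * (\int[P]_w A3 w ^+ 2) <= L * (V3 / n%:R / del).
  apply: (le_trans (ler_wpM2l Lk0 A3_moment)); rewrite /k.
  by rewrite le_eqVlt; apply/orP; left; apply/eqP; field; rewrite !gt_eqF.
have H2 : L * rn^-1 * (\int[P]_w `|A2 w|) <= L * (rn * (Mw * (2 / b) * VD)).
  apply: (le_trans (ler_wpM2l Lr0 A2_mean)); rewrite -rn2.
  by rewrite le_eqVlt; apply/orP; left; apply/eqP; field; rewrite !gt_eqF.
move: H1 H2 H3 A4_mean; move: (L * k * _) (L * _ * _) (L * k * _) (\int[P]_w A4 w).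
move: (V1 / del) (rn * _) (V3 / n%:R / del) V4 => v1 v2 v3 v4 I1 I2 I3 I4.
by rewrite !mulrDr; lra.
Qed.

End comparison.

(** * Asymptotic normality *)

Section main_term.
Context {dO : measure_display} {Omega : measurableType dO} {R : realType}.
Context (P : probability Omega R).
Context {d1 : measure_display} {T1 : measurableType d1}.
Variables (X : nat -> {RV P >-> T1}) (e : nat -> {RV P >-> R}).
Hypotheses (iidX : iid X) (iide : iid e) (XeI : independent_sequences X e).
Hypothesis Ee0 : \int[P]_w e 0%N w = 0.
Hypothesis Ee2 : P.-integrable setT (fun w => (e 0%N w ^+ 2)%:E).
Variable (sf : T1 -> R).
Hypothesis bs : bmeas sf.

Let S (m : nat) w := \sum_(i < m) sf (X i w) * e i w.
Let Z w := sf (X 0%N w) * e 0%N w.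

Let mterm i : measurable_fun setT (fun w => sf (X i w) * e i w).
Proof. by apply: measurable_funM => //; case: bs => ms _; exact: (measurableT_comp ms). Qed.

Let mS m : measurable_fun setT (S m).
Proof. by apply: measurable_sum => i. Qed.

Lemma noise_term_sqr_integrable : P.-integrable setT (fun w => (Z w ^+ 2)%:E).
Proof.
have [M M0 HM] := bmeas_bound bs.
apply: (le_integrable measurableT _ _ (integrable_realZ (M ^+ 2) Ee2)).
  by apply/measurable_EFinP; apply: measurable_funX; exact: mterm.
move=> w _ /=; rewrite lee_fin ger0_norm ?sqr_ge0// ger0_norm; last by apply: mulr_ge0; exact: sqr_ge0.
rewrite exprMn ler_wpM2r ?sqr_ge0// -(real_normK (num_real _)) lerXn2r ?nnegrE ?(ltW M0)//.
Qed.

(** The noise is taken as the first variable, since [decouple0] averages that one while the other is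
    frozen. *)
Lemma noise_term_mean : \int[P]_w Z w = 0.
Proof.
have ind : indep_rv P (e 0%N) (X 0%N).
  move=> A B mA mB; rewrite setIC muleC.
  exact: (indep_X_e XeI 0 0 mB mA).
rewrite /Rintegral (@decouple0 _ _ _ P _ _ _ _ (e 0%N) (X 0%N) _ _ ind
  (fun z => sf z.2 * z.1))//.
- apply: measurable_funM; last exact: measurable_fst.
  by case: bs => ms _; exact: (measurableT_comp ms measurable_snd).
- apply: (@integrable_of_sqr _ _ _ P Z); first exact: mterm.
  exact: noise_term_sqr_integrable.
- move=> y /=; under eq_integral do rewrite EFinM.
  by rewrite integralZl ?noise_mean ?mule0//; exact: noise_integrable.
Qed.

(** [S m] involves only indices below [m], so the pair of index [m] can be replaced by an
    independent copy of the pair of index [0]. *)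
Let stepS m (u : R -> R) : bmeas u ->
  \int[P]_w u (S m.+1 w) = \int[P]_w' (\int[P]_w u (S m w' + Z w)).
Proof.
move=> bu.
pose F (z : (T1 * R) * otherT X e m) := u (S m z.2 + sf z.1.1 * z.1.2).
have bF : bmeas F.
  apply: (bmeas_comp bu); apply: measurable_funD.
    apply: (measurableT_comp _ measurable_snd).
    apply: measurable_sum => i; have im : (i : nat) != m by rewrite ltn_eqF.
    apply: measurable_funM; last exact: measurable_other_e.
    case: bs => ms _; apply: (measurableT_comp ms); exact: measurable_other_X.
  have m1 : measurable_fun setT (fun z : (T1 * R) * otherT X e m => z.1) by exact: measurable_fst.
  apply: measurable_funM; last exact: (measurableT_comp measurable_snd m1).
  case: bs => ms _; apply: (measurableT_comp ms).
  exact: (measurableT_comp measurable_fst m1).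
rewrite -[RHS](decouple_pair iidX iide XeI bF); apply: eq_Rintegral => w _.
by rewrite /F /S big_ord_recr.
Qed.

Lemma main_term_cvg A B (u u1 u2 : R -> R) : 0 <= A -> 0 <= B ->
  bmeas u -> bmeas u1 -> bmeas u2 -> taylor2 A B u u1 u2 ->
  \int[P]_w u ((Num.sqrt n%:R)^-1 * \sum_(i < n) sf (X i w) * e i w) @[n --> \oo] -->
  gavg (Num.sqrt (\int[P]_w Z w ^+ 2)) u 0.
Proof.
move=> A0 B0 bu bu1 bu2 ut.
apply: (trotter_clt (S := S) (Z := Z) _ _ _ _ _ _ A0 B0 bu bu1 bu2 ut) => //.
- by move=> w; rewrite /S big_ord0.
- exact: mterm.
- exact: noise_term_sqr_integrable.
- exact: noise_term_mean.
Qed.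

Lemma noise_term_variance : fine 'V_P[Z] = \int[P]_w Z w ^+ 2.
Proof.
rewrite /variance unlock expectation.unlock.
have -> : (\int[P]_w (Z w)%:E = 0)%E.
  rewrite -[LHS]fineK; first by rewrite -[fine _]/(\int[P]_w Z w) noise_term_mean.
  apply: integrable_fin_num => //.
  by apply: integrable_of_sqr; [exact: mterm|exact: noise_term_sqr_integrable].
congr fine; apply: eq_integral => w _.
by congr EFin; rewrite expr2 -[Z w]subr0.
Qed.

End main_term.

(** * Rates of the error terms *)

Section rates.
Context {R : realType}.
Implicit Types (y z : nat -> R).

Definition null z := z @ \oo --> (0 : R).

Lemma nullD y z : null y -> null z -> null (fun n => y n + z n).
Proof. by move=> y0 z0; rewrite /null -(addr0 0); exact: cvgD. Qed.

Lemma nullM y z : null y -> null z -> null (fun n => y n * z n).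
Proof. by move=> y0 z0; rewrite /null -(mulr0 0); exact: cvgM. Qed.

Lemma nullZ (c : R) z : null z -> null (fun n => c * z n).
Proof. by move=> z0; rewrite /null -(mulr0 c); exact: cvgMl_tmp. Qed.

Lemma nullX k z : null z -> null (fun n => z n ^+ k.+1).
Proof.
move=> z0; elim: k => [|k IH]; first by under eq_fun do rewrite expr1.
by under eq_fun do rewrite exprS; exact: nullM.
Qed.

Lemma null_sqrt_norm z : null z -> null (fun n => Num.sqrt `|z n|).
Proof.
move=> z0; have nz : `|z n| @[n --> \oo] --> (0 : R) by rewrite -(normr0 R); exact: cvg_norm.
by have := cvg_comp _ _ nz (@sqrt_continuous R 0); rewrite sqrtr0.
Qed.

Lemma null_root r z : (0 < r)%N -> (forall n, 0 < z n) ->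
  null (fun n => z n ^+ r) -> null z.
Proof.
move=> r0 z0 /cvgrPdist_lt H; apply/cvgrPdist_lt => e e0.
have := H (e ^+ r) (exprn_gt0 r e0); apply: filterS => n.
rewrite !sub0r !normrN !gtr0_norm ?exprn_gt0// => zr.
by rewrite -(ltr_pXn2r r0) ?nnegrE ?(ltW e0) ?(ltW (z0 n)).
Qed.

Variables (h : nat -> R) (d r : nat).
Hypothesis h0 : forall n, 0 < h n.
Hypothesis r0 : (0 < r)%N.
(** The index [n] stands for the sample size [n.+1], which keeps all denominators positive. *)
Let rn n : R := Num.sqrt n.+1%:R.
Let N n : R := n.+1%:R.
Hypothesis hr : null (fun n => rn n * h n ^+ r).
Hypothesis hd : (fun n => rn n * h n ^+ d) @ \oo --> +oo.

Let rn0 n : 0 < rn n. Proof. by rewrite sqrtr_gt0. Qed.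
Let rn2 n : N n = rn n ^+ 2. Proof. by rewrite sqr_sqrtr. Qed.
Let t n := (rn n)^-1.
Let p n := (rn n * h n ^+ d)^-1.
Let a n := rn n * h n ^+ r.
Let hd0 n : 0 < h n ^+ d. Proof. exact: exprn_gt0. Qed.

(* All error terms are polynomials in the null sequences [t], [p], [a] and [vq]. *)
Lemma null_inv_sqrt : null t.
Proof.
apply/gtr0_cvgV0; first by apply: nearW => n; exact: rn0.
have := @cvg_sqrtn R; rewrite -(cvg_shiftS (fun n => Num.sqrt n%:R)); exact.
Qed.

Let null_t := null_inv_sqrt.

Let null_p : null p.
Proof. by apply/gtr0_cvgV0 => //; apply: nearW => n; exact: mulr_gt0. Qed.

(** That the bandwidth vanishes is not assumed but follows from [sqrt n * h^r -> 0], as [r] is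
    positive. *)
Lemma null_bandwidth : null h.
Proof.
apply: (null_root r0 h0); rewrite (_ : (fun n => h n ^+ r) = fun n => t n * a n).
  exact: nullM.
by apply/funext => n; rewrite /t /a mulKf// gt_eqF.
Qed.

Variables (Cb Fk T Mw Mc Ms b E2 C1 L : R) (vq : nat -> R).
Hypothesis b0 : 0 < b.
Hypothesis null_vq : null vq.

Let bet n := Cb * h n ^+ r + Fk / N n.
Let VD n := 2 * T / (N n * h n ^+ d) + 2 * bet n ^+ 2.
Let V1 n := E2 * ((Ms * (2 / b)) ^+ 2 * VD n).
Let V3 n := 3 * (N n * (3 * (Mw * (Cb * h n ^+ r)) ^+ 2 + 3 * vq n + 12 * Mc ^+ 2 / N n ^+ 2) +
  16 * (Mw ^+ 2 * T / h n ^+ d + 3 * Mc ^+ 2) + (N n * (Mw * (Cb * h n ^+ r)) + Mc) ^+ 2).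
Let V4 n := N n * ((8 * (N n * h n ^+ d * T) ^+ 2 + 12 * C1 ^+ 2 * (N n * h n ^+ d * T)) /
  (b / 4 * (N n * h n ^+ d)) ^+ 4).

Let hE n : h n ^+ r = t n * a n. Proof. by rewrite /t /a mulKf// gt_eqF. Qed.
Let dE n : h n ^+ d = (rn n * p n)^-1.
Proof. by rewrite /p invfM invrK mulKf// gt_eqF. Qed.
Let NE n : N n = (t n)^-1 ^+ 2. Proof. by rewrite /t invrK rn2. Qed.
Let rE n : rn n = (t n)^-1. Proof. by rewrite /t invrK. Qed.
Let t0 n : t n != 0. Proof. by rewrite invr_eq0 gt_eqF. Qed.
Let p0 n : p n != 0. Proof. by rewrite invr_eq0 gt_eqF// mulr_gt0. Qed.

Let ca n := Cb * a n + Fk * t n.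
Let null_ca : null ca. Proof. by apply: nullD; exact: nullZ. Qed.

Let betE n : bet n = t n * ca n.
Proof. by rewrite /bet /ca hE NE; field. Qed.

Lemma null_bias_bound : null bet.
Proof.
by rewrite (_ : bet = fun n => t n * ca n); [exact: nullM|apply/funext => n; exact: betE].
Qed.

Let VDE n : VD n = 2 * T * (t n * p n) + 2 * (t n * ca n) ^+ 2.
Proof. by rewrite /VD betE dE NE rE; field; rewrite t0 p0. Qed.

Let null_VD : null VD.
Proof.
rewrite (funext VDE).
apply: nullD; first by apply: nullZ; exact: nullM.
by apply: nullZ; apply: nullX; exact: nullM.
Qed.

(** The factor [sqrt n] cancels one [t], leaving [p + t * ca^2] up to constants. *)
Let null_V2 : null (fun n => rn n * (Mw * (2 / b) * VD n)).
Proof.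
have E n : rn n * (Mw * (2 / b) * VD n) =
    Mw * (2 / b) * (2 * T * p n + 2 * (t n * ca n ^+ 2)).
  by rewrite VDE rE; field; rewrite t0 gt_eqF.
rewrite (funext E).
apply: nullZ; apply: nullD; first exact: nullZ.
by apply: nullZ; apply: nullM => //; exact: nullX.
Qed.

Let null_V1 : null V1.
Proof. by apply: nullZ; exact: nullZ. Qed.

Let null_V3 : null (fun n => V3 n / N n).
Proof.
pose m n := Mw * Cb * a n + Mc * t n.
have null_m : null m by apply: nullD; exact: nullZ.
have E n : V3 n / N n = 3 * ((3 * ((Mw * Cb) ^+ 2 * (t n * a n) ^+ 2) + 3 * vq n +
    12 * Mc ^+ 2 * t n ^+ 4) + 16 * (Mw ^+ 2 * T * (t n * p n) + 3 * Mc ^+ 2 * t n ^+ 2) +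
    m n ^+ 2).
  by rewrite /V3 /m hE dE NE rE; field; rewrite t0 p0.
rewrite (funext E).
apply: nullZ; apply: nullD; last exact: nullX.
apply: nullD; last first.
  by apply: nullZ; apply: nullD; apply: nullZ; [exact: nullM|exact: nullX].
apply: nullD; last by apply: nullZ; exact: nullX.
by apply: nullD; apply: nullZ => //; apply: nullZ; apply: nullX; exact: nullM.
Qed.

(** As [N * h^d = (t * p)^-1], the two terms are of order [p^2] and [t * p^3]; second moments would
    leave [p / t], which need not vanish. *)
Let null_V4 : null V4.
Proof.
have E n : V4 n = (b / 4) ^- 4 * (8 * T ^+ 2 * p n ^+ 2 + 12 * C1 ^+ 2 * T * (t n * p n ^+ 3)).
  by rewrite /V4 dE NE rE; field; rewrite t0 p0 gt_eqF.
rewrite (funext E).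
apply: nullZ; apply: nullD; first by apply: nullZ; exact: nullX.
by apply: nullZ; apply: nullM => //; exact: nullX.
Qed.

Let W n := V1 n + V3 n / N n.

(** The choice [del = sqrt |W| + t] balances [del] against [W / del <= sqrt |W|]; the summand [t]
    keeps [del] positive where [W] vanishes. *)
Lemma null_comparison_bound : exists2 del : nat -> R, forall n, 0 < del n &
  exists2 E : nat -> R, null E & forall n, 0 <= L ->
  L * (2 * del n + V1 n / del n + rn n * (Mw * (2 / b) * VD n) + V3 n / N n / del n) + V4 n <= E n.
Proof.
pose s n := Num.sqrt `|W n|.
have null_s : null s by apply: null_sqrt_norm; exact: nullD.
pose del n := s n + t n.
have tp n : 0 < t n by rewrite invr_gt0.
have d0 n : 0 < del n by rewrite ltr_wpDl// sqrtr_ge0.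
exists del => //.
exists (fun n => L * ((2 * del n + s n) + rn n * (Mw * (2 / b) * VD n)) + V4 n).
  apply: nullD => //; apply: nullZ; apply: nullD => //; apply: nullD => //.
  by apply: nullZ; exact: nullD.
move=> n L0; rewrite lerD2r ler_wpM2l//.
have : W n / del n <= s n.
  rewrite ler_pdivrMr// (le_trans (ler_norm _))//.
  rewrite -(sqr_sqrtr (normr_ge0 (W n))) -/(s n) expr2 ler_wpM2l ?sqrtr_ge0//.
  by rewrite /del lerDl ltW.
rewrite /W mulrDl; move: (V1 n / del n) (V3 n / N n / del n) (s n) (rn n * _).
by move=> v1 v3 s1 v2; lra.
Qed.

End rates.

Lemma kernel_bounded (R : realType) d (K : 'rV[R]_d -> R) C1 C2 : 0 < C1 -> 0 < C2 ->
  (forall x, `|K x| <= C1 * expR (- C2 * enorm x)) -> forall x, `|K x| <= C1.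
Proof.
move=> C10 C20 KE x; rewrite (le_trans (KE x))// ger_pMr// expR_le1.
by rewrite mulNr oppr_le0 mulr_ge0 ?(ltW C20)// sqrtr_ge0.
Qed.

(** * Convergence of the estimator *)

Section convergence.
Context {R : realType} {d : nat}.
Local Notation lam := (@lebesgue_rV R d).
Context {dO : measure_display} {Omega : measurableType dO} (P : probability Omega R).
Variables (X : nat -> {RV P >-> 'rV[R]_d}) (e : nat -> {RV P >-> R}).
Hypotheses (iidX : iid X) (iide : iid e) (XeI : independent_sequences X e).
Hypothesis Ee0 : \int[P]_w e 0%N w = 0.
Hypothesis Ee2 : P.-integrable setT (fun w => (e 0%N w ^+ 2)%:E).
Variables (f : 'rV[R]_d -> R) (Fb : R).
Hypothesis Xf : has_density (X 0%N) f.
Hypothesis fF : forall x, `|f x| <= Fb.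
Variables (r : nat) (K : 'rV[R]_d -> R) (C1 : R).
Hypothesis r1 : (0 < r)%N.
Hypothesis bpf : bounded_partials r f.
Hypothesis Kr : kernel_order r K.
Hypothesis KC : forall u, `|K u| <= C1.
Hypothesis Ksym : symmetric_kernel K.
Variables (wt sf : 'rV[R]_d -> R) (b : R) (Q : set 'rV[R]_d).
Hypothesis cQ : compact Q.
Hypothesis bw : bmeas wt.
Hypothesis bs : bmeas sf.
Hypothesis w0 : forall x, ~ Q x -> wt x = 0.
Hypothesis s0 : forall x, ~ Q x -> sf x = 0.
Hypothesis wc : within_cvg Q wt.
Hypothesis b0 : 0 < b.
Hypothesis fb : forall x, Q x -> b <= f x.
Variable h : nat -> R.
Hypothesis h0 : forall n, (0 < n)%N -> 0 < h n.
Hypothesis hr : (fun n => Num.sqrt n%:R * h n ^+ r) @ \oo --> 0.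
Hypothesis hd : (fun n => Num.sqrt n%:R * h n ^+ d) @ \oo --> +oo.

Let Zn (n : nat) w := Num.sqrt n%:R * (n%:R^-1 *
  \sum_(i < n) (wt (X i w) * f (X i w) ^+ 2 + sf (X i w) * f (X i w) * e i w) /
    loo_kde K (h n) n (fun j => X j w) i (X i w) -
  \int[P]_w (wt (X 0%N w) * f (X 0%N w))).
Let Nn (n : nat) w := (Num.sqrt n%:R)^-1 * \sum_(i < n) sf (X i w) * e i w.

Let h1 n : 0 < h n.+1. Proof. exact: h0. Qed.

Let hr1 : null (fun n => Num.sqrt n.+1%:R * h n.+1 ^+ r).
Proof. by move: hr; rewrite -(cvg_shiftS (fun n => Num.sqrt n%:R * h n ^+ r)). Qed.

Let hd1 : (fun n => Num.sqrt n.+1%:R * h n.+1 ^+ d) @ \oo --> +oo.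
Proof. by move: hd; rewrite -(cvg_shiftS (fun n => Num.sqrt n%:R * h n ^+ d)). Qed.

Let q x := wt x * f x.

Let vq n := \int[P]_w (smooth K q (h n.+1) (X 0%N w) - q (X 0%N w)) ^+ 2.

Let null_vq : null vq.
Proof.
have mf : measurable_fun setT f by case: Xf.
have bq : bmeas q by apply: bmeasM => //; split => //; exists Fb.
have [M _ qM] := bmeas_bound bq.
have clQ : closed Q by apply: compact_closed => //; exact: norm_hausdorff.
have [N QN] : exists N : R, forall y, Q y -> `|y| <= N.
  have [N [_ HN]] := compact_bounded cQ; exists (`|N| + 1) => y Qy.
  by apply: HN => //; rewrite (le_lt_trans (ler_norm _))// ltrDl.
have qc : within_cvg Q q.
  by apply: within_cvgM => //; exact: (bounded_partials_within_cvg r1 bpf).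
have q0 y : ~ Q y -> q y = 0 by move=> nQ; rewrite /q w0// mul0r.
exact: (smooth_L2_cvg Xf fF Kr clQ QN (bmeas_meas bq) qM q0 ((within_cvgP _ _).1 qc)
  (null_bandwidth h1 r1 hr1) (fun n => bmeas_smooth Xf Kr KC (h1 n) bw)).
Qed.

Lemma comparison_cvg (u : R -> R) (L : R) : bmeas u -> (forall x, 0 <= u x <= 1) ->
  0 <= L -> (forall x y, `|u x - u y| <= L * `|x - y|) ->
  (\int[P]_w u (Zn n w) - \int[P]_w u (Nn n w)) @[n --> \oo] --> (0 : R).
Proof.
move=> bu u01 L0 uL.
have mf : measurable_fun setT f by case: Xf.
have [Cb Cb0 bias] := smooth_bias r1 Kr mf fF bpf.
have [Mw _ wM] := bmeas_bound bw; have [Ms _ sM] := bmeas_bound bs.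
pose kap := \int[lam]_u `|K u|.
rewrite -(cvg_shiftS (fun n => \int[P]_w u (Zn n w) - \int[P]_w u (Nn n w))) /=.
have [del d0 [E E0 HE]] := null_comparison_bound h1 hr1 hd1 Cb (Fb * kap) (C1 * (Fb * kap))
  Mw (Mw * (Fb * kap)) Ms (\int[P]_w e 0%N w ^+ 2) C1 L b0 null_vq.
have nb := null_bias_bound hr1 Cb (Fb * kap).
apply: (cvg_dist_le _ E0); near=> n.
rewrite subr0; apply: (le_trans _ (HE n L0)).
apply: (@estimator_comparison _ _ _ _ P X e iidX iide XeI Ee0 Ee2 f Fb Xf fF r K C1
  Kr KC Ksym wt sf Mw Ms b Q bw wM bs sM w0 s0 b0 fb (h n.+1) (h1 n) n.+1 isT Cb
  (fun x => bias _ x (ltW (h1 n))) u L bu u01 L0 uL _ (vq n) _ (del n) (d0 n)) => //.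
(* What remains is the one requirement that holds only for large [n]: the bias bound must be at most
   [b / 4]. *)
near: n.
have b40 : 0 < b / 4 by rewrite divr_gt0.
have /cvgrPdist_le /(_ _ b40) := nb; apply: filterS => n.
by rewrite sub0r normrN; apply: le_trans; exact: ler_norm.
Unshelve. all: by end_near. Qed.

Lemma estimator_cvg_in_distribution : cvg_in_distribution P Zn
  (normal_law 0 (\int[P]_w (sf (X 0%N w) * e 0%N w) ^+ 2)).
Proof.
apply: cvg_in_distribution_logistic.
  by move=> n; exact: (measurable_estimator e Xf fF Kr KC bw bs (h n) n).
move=> eps a eps0; pose u x := logistic (eps^-1 * (x - a)).
have bu : bmeas u by exact: bmeas_logistic.
have [L L0 uL] := logistic_lipschitz eps a.
have u01 x : 0 <= u x <= 1 by rewrite (ltW (logistic_gt0 _)) (ltW (logistic_lt1 _)).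
have [A [B [u1 [u2 [[A0 B0 ut] [bu1 bu2]]]]]] := logistic_taylor2 eps a.
have v0 : 0 <= \int[P]_w (sf (X 0%N w) * e 0%N w) ^+ 2.
  by apply: Rintegral_ge0 => w _; exact: sqr_ge0.
have -> := normal_law_gavg v0 bu.
have C := main_term_cvg iidX iide XeI Ee0 Ee2 bs A0 B0 bu bu1 bu2 ut.
have D := comparison_cvg bu u01 L0 uL.
rewrite -[X in _ --> X]add0r.
rewrite (_ : (fun n => _) = fun n => (\int[P]_w u (Zn n w) - \int[P]_w u (Nn n w)) +
    \int[P]_w u (Nn n w)); first exact: (cvgD D C).
by apply/funext => n; rewrite subrK.
Qed.

End convergence.

Theorem theorem2 (R : realType) (d r : nat) (dO : measure_display)
    (Omega : measurableType dO) (P : probability Omega R)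
    (X : nat -> {RV P >-> 'rV[R]_d}) (e : nat -> {RV P >-> R})
    (g sigma psi f K : 'rV[R]_d -> R) (Q : set 'rV[R]_d) (h : nat -> R)
    (b C1 C2 : R) :
  (1 <= d)%N -> (1 <= r)%N ->
  iid X -> iid e -> independent_sequences X e ->
  ('E_P[e 0%N] = 0)%E -> ('E_P[fun w => (e 0%N w ^+ 2)%R] < +oo)%E ->
  measurable_fun setT sigma ->
  compact Q ->
  (forall n, (1 <= n)%N -> 0 < h n) ->
  (* (i) *)
  has_density (X 0%N) f -> bounded_fun f -> bounded_partials r f ->
  (* (ii) *)
  0 < b -> (forall x, Q x -> b <= f x) ->
  (* (iii) *)
  symmetric_kernel K -> kernel_order r K ->
  0 < C1 -> 0 < C2 -> (forall x, `|K x| <= C1 * expR (- C2 * enorm x)) ->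
  (* (iv) *)
  (forall x, ~ Q x -> psi x = 0) -> holder_on Q psi ->
  Q !=set0 -> bounded_set Q -> convex_set Q ->
  (* (v) *)
  holder_on Q g -> bounded_fun sigma ->
  (* (vi) *)
  (fun n => Num.sqrt n%:R * h n ^+ r) @ \oo --> 0 ->
  (fun n => Num.sqrt n%:R * h n ^+ d) @ \oo --> +oo ->
  let Y i w := g (X i w) + sigma (X i w) * e i w in
  let c := \int[lebesgue_rV d]_x (g x * psi x) in
  let c_hat n w :=
    kernel_estimator K psi (h n) n (fun i => X i w) (fun i => Y i w) in
  let v := 'V_P[fun w => (Y 0%N w - g (X 0%N w)) / f (X 0%N w) *
                         psi (X 0%N w)] in
  cvg_in_distribution P (fun n w => Num.sqrt n%:R * (c_hat n w - c))
    (normal_law 0 (fine v)).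
Proof.
move=> _ r1 iidX iide XeI Ee0 Ee2 msig cQ h0 Xf bf bpf b0 fb Ksym Kr C10 C20 KE psi0 hpsi
  _ _ _ hg bsig hr hd Y c c_hat v.
have KC := kernel_bounded C10 C20 KE.
have [Fb _ fF] := bounded_fun_le bf; have [Sb _ sS] := bounded_fun_le bsig.
have f0 x : Q x -> f x != 0 by move=> Qx; rewrite gt_eqF// (lt_le_trans b0)// fb.
have mf : measurable_fun setT f by case: Xf.
have bfm : bmeas f by split => //; exists Fb.
have {}Ee2 : P.-integrable setT (fun w => (e 0%N w ^+ 2)%:E).
  apply/integrableP; split; first by apply/measurable_EFinP; exact: measurable_funX.
  move: Ee2; rewrite expectation.unlock; apply: le_lt_trans.
  rewrite le_eqVlt; apply/orP; left; apply/eqP; apply: eq_integral => w _.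
  by rewrite gee0_abs// lee_fin sqr_ge0.
have {}Ee0 : \int[P]_w e 0%N w = 0 by move: Ee0; rewrite expectation.unlock /Rintegral => ->.
have cpsi := holder_within_cvg hpsi; have cg := holder_within_cvg hg.
have cf := bounded_partials_within_cvg (Q := Q) r1 bpf.
have cfV := within_cvgV f0 cf.
(* Outside [Q], where [f] may vanish, the quotient is [0] because [psi] is, so [pf] is bounded and
   measurable on the whole space. *)
pose pf x := psi x / f x; have cpf : within_cvg Q pf by exact: within_cvgM.
have pf0 x : ~ Q x -> pf x = 0 by move=> nQ; rewrite /pf psi0// mul0r.
have bpf' : bmeas pf by exact: (within_cvg_bmeas cQ).
(* Chosen so that [wt * f^2 = g psi]; below, [sf] satisfies likewise [sf * f = sigma psi]. Both
   identities hold everywhere, trivially outside [Q]. *)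
pose wt x := g x * pf x / f x.
have cwt : within_cvg Q wt by apply: within_cvgM => //; exact: within_cvgM.
have wt0 x : ~ Q x -> wt x = 0 by move=> nQ; rewrite /wt pf0// mulr0 mul0r.
have bwt : bmeas wt by exact: (within_cvg_bmeas cQ).
pose sf x := sigma x * pf x.
have bsf : bmeas sf by apply: bmeasM => //; split => //; exists Sb.
have sf0 x : ~ Q x -> sf x = 0 by move=> nQ; rewrite /sf pf0// mulr0.
have wtE x : wt x * f x ^+ 2 = g x * psi x.
  have [Qx|nQ] := pselect (Q x); last by rewrite wt0// psi0// mul0r mulr0.
  by rewrite /wt /pf; field; exact: f0.
have sfE x : sf x * f x = sigma x * psi x.
  have [Qx|nQ] := pselect (Q x); last by rewrite sf0// psi0// mul0r mulr0.
  by rewrite /sf /pf; field; exact: f0.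
(* Integrating [g psi = (wt * f) * f] against Lebesgue measure is taking the mean of [wt * f] at
   [X 0]. *)
have cE : c = \int[P]_w (wt (X 0%N w) * f (X 0%N w)).
  rewrite (Rint_density Xf (F := fun x => wt x * f x)); last exact: bmeasM.
  by apply: eq_Rintegral => x _; rewrite -wtE expr2 mulrA.
have vE : fine v = \int[P]_w (sf (X 0%N w) * e 0%N w) ^+ 2.
  rewrite -(noise_term_variance iide XeI Ee0 Ee2 bsf); congr (fine 'V_P[_]).
  apply/funext => w; rewrite /Y addrC addKr /sf /pf; ring.
have := estimator_cvg_in_distribution iidX iide XeI Ee0 Ee2 Xf fF r1 bpf Kr KC Ksym cQ
  bwt bsf wt0 sf0 cwt b0 fb h0 hr hd.
rewrite vE; congr (cvg_in_distribution P _ _); apply/funext => n; apply/funext => w.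
rewrite -cE /c_hat /kernel_estimator; congr (_ * (_ * _ - _)).
by apply: eq_bigr => i _; rewrite wtE sfE /Y; congr (_ / _); ring.
Qed.
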